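(* Let $b>0$, $1<p<\infty$, let $\Omega\subset\mathbb{R}^n$ be a convex domain, and let $u$ be a convex weak solution to $$-b\,\operatorname{div}\left(\frac{\nabla u}{|\nabla u|}\right)-\operatorname{div}\left(|\nabla u|^{p-2}\nabla u\right)=0\quad\text{in }\Omega .$$ Let $F=\{x\in\Omega\mid u(x)\le u(y)\text{ for all }y\in\Omega\}$ be the facet of $u$. Then $u$ is affine in each connected component of the open set $D:=\Omega\setminus F$. In particular, if $F=\emptyset$, then $u$ is affine in $\Omega$.
   Context: A domain is a nonempty connected open set (not necessarily bounded). $\langle\cdot\mid\cdot\rangle$ is the standard inner product on $\mathbb{R}^n$. For $z\in\mathbb{R}^n$, $\partial|\cdot|(z)$ is the subdifferential of the Euclidean norm at $z$: it equals $\{z/|z|\}$ if $z\ne0$ and the closed unit ball if $z=0$. The vector $|z|^{p-2}z$ is understood as $0$ for $z=0$. Weak solution: $u\in W^{1,p}_{\mathrm{loc}}(\Omega)$ is a weak solution of the equation (with right-hand side $0$) if for every bounded Lipschitz domain $\omega\Subset\Omega$ there exists $Z\in L^\infty(\omega,\mathbb{R}^n)$ such that $Z(x)\in\partial|\cdot|(\nabla u(x))$ for a.e. $x\in\omega$ and $$b\int_\omega\langle Z\mid\nabla\phi\rangle\,dx+\int_\omega\langle|\nabla u|^{p-2}\nabla u\mid\nabla\phi\rangle\,dx=0\quad\text{for all }\phi\in W^{1,p}_0(\omega).$$ *)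

(* Defs.v *)
From HB Require Import structures.
From mathcomp Require Import all_boot all_order all_algebra.
From mathcomp Require Import ring lra.
From mathcomp Require Import all_classical all_reals all_analysis.

Set Implicit Arguments.
Unset Strict Implicit.
Unset Printing Implicit Defensive.

Import Order.TTheory GRing.Theory Num.Theory.
Import numFieldNormedType.Exports.

Local Open Scope classical_set_scope.
Local Open Scope ring_scope.

(* R^n is 'rV[R]_n; its library norm `| x | is the max norm, which is only used
   below where the choice of a norm does not matter. *)

Section euclidean.
Context {R : realType} {n : nat}.
Implicit Types (u v x y z : 'rV[R]_n).

Definition dotp u v : R := \sum_i u ord0 i * v ord0 i.

Definition enorm u : R := Num.sqrt (dotp u u).

Definition subdifferential (f : 'rV[R]_n -> R) z : set 'rV[R]_n :=
  [set w | forall y, f z + dotp w (y - z) <= f y].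

End euclidean.

Section euclidean_theory.
Context {R : realType} {n : nat}.
Implicit Types (u v w z : 'rV[R]_n).

Lemma dotpC u v : dotp u v = dotp v u.
Proof. by apply: eq_bigr => i _; rewrite mulrC. Qed.

Lemma dotpDr u v w : dotp u (v + w) = dotp u v + dotp u w.
Proof. by rewrite -big_split; apply: eq_bigr => i _; rewrite mxE mulrDr. Qed.

Lemma dotpZr u a v : dotp u (a *: v) = a * dotp u v.
Proof. by rewrite mulr_sumr; apply: eq_bigr => i _; rewrite mxE mulrCA. Qed.

Lemma dotpBr u v w : dotp u (v - w) = dotp u v - dotp u w.
Proof. by rewrite dotpDr -scaleN1r dotpZr mulN1r. Qed.

Lemma dotpZl u a v : dotp (a *: u) v = a * dotp u v.
Proof. by rewrite dotpC dotpZr dotpC. Qed.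

Lemma dotpBl u v w : dotp (u - v) w = dotp u w - dotp v w.
Proof. by rewrite dotpC dotpBr !(dotpC w). Qed.

Lemma dotp0 u : dotp u 0 = 0.
Proof. by rewrite -(scale0r 0) dotpZr mul0r. Qed.

Lemma dotpp_ge0 u : 0 <= dotp u u.
Proof. by apply: sumr_ge0 => i _; rewrite -expr2 sqr_ge0. Qed.

Lemma dotpp_eq0 u : dotp u u = 0 -> u = 0.
Proof.
move=> u0; apply/rowP => i; rewrite mxE.
have := psumr_eq0P (fun i _ => sqr_ge0 (u ord0 i)) u0.
by move=> /(_ i erefl)/eqP; rewrite mulf_eq0 orbb => /eqP.
Qed.

Lemma enorm_ge0 u : 0 <= enorm u. Proof. exact: sqrtr_ge0. Qed.

Lemma sqr_enorm u : enorm u ^+ 2 = dotp u u.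
Proof. exact/sqr_sqrtr/dotpp_ge0. Qed.

Lemma enorm0 : enorm (0 : 'rV[R]_n) = 0.
Proof. by rewrite /enorm dotp0 sqrtr0. Qed.

Lemma enorm_eq0 u : enorm u = 0 -> u = 0.
Proof. by move=> u0; apply: dotpp_eq0; rewrite -sqr_enorm u0 expr0n. Qed.

Lemma enormZ a u : enorm (a *: u) = `|a| * enorm u.
Proof.
rewrite /enorm dotpZr dotpC dotpZr mulrA -expr2.
by rewrite sqrtrM ?sqr_ge0// sqrtr_sqr.
Qed.

Lemma dotp_le u v : dotp u v <= enorm u * enorm v.
Proof.
have [v0|v0] := eqVneq (enorm v) 0.
  by rewrite v0 mulr0 (enorm_eq0 v0) dotp0.
have [u0|u0] := eqVneq (enorm u) 0.
  by rewrite u0 mul0r (enorm_eq0 u0) dotpC dotp0.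
have uv : 0 < enorm u * enorm v by rewrite mulr_gt0// lt0r ?u0 ?v0 enorm_ge0.
have := dotpp_ge0 (enorm v *: u - enorm u *: v).
rewrite dotpBr !dotpBl !dotpZl !dotpZr -!sqr_enorm (dotpC v u).
set a := enorm u; set b := enorm v; set d := dotp u v => h.
have : 0 <= (a * b) * (2 * (a * b - d)).
  by apply: le_trans h _; rewrite le_eqVlt; apply/orP; left; apply/eqP; ring.
by rewrite pmulr_rge0// pmulr_rge0// subr_ge0.
Qed.

Lemma subdifferential_enormE z : subdifferential enorm z =
  if z == 0 then [set w | enorm w <= 1] else [set (enorm z)^-1 *: z].
Proof.
apply/seteqP; have sub1 w : (forall y, dotp w y <= enorm y) -> enorm w <= 1.
  move=> /(_ w); rewrite -sqr_enorm => w1; have [->|w0] := eqVneq (enorm w) 0.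
    exact: ler01.
  by rewrite -(ler_pM2l (x := enorm w)) ?lt0r ?w0 ?enorm_ge0// mulr1 -expr2.
case: eqVneq => [->|z0]; split => w /=.
- by move=> wP; apply: sub1 => y; have := wP y; rewrite enorm0 add0r subr0.
- move=> w1 y; rewrite enorm0 add0r subr0 (le_trans (dotp_le _ _))//.
  by rewrite ler_piMl// enorm_ge0.
- move=> wP; have nz0 : enorm z != 0 by apply: contra_neq z0; exact: enorm_eq0.
  have wz : dotp w z = enorm z.
    apply/eqP; rewrite eq_le; apply/andP; split.
      have := wP (2 *: z); rewrite dotpBr dotpZr enormZ ger0_norm//.
      by move: (dotp _ _) (enorm _) => c d h; lra.
    by have := wP 0; rewrite dotpBr dotp0 sub0r enorm0 subr_le0.
  have w1 : enorm w <= 1.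
    by apply: sub1 => y; have := wP y; rewrite dotpBr wz addrC subrK.
  apply/eqP; rewrite -subr_eq0; apply/eqP/dotpp_eq0/eqP.
  rewrite eq_le dotpp_ge0 andbT dotpBr !dotpBl !dotpZl !dotpZr (dotpC z w) wz.
  rewrite -!sqr_enorm expr2 (mulrA _ (enorm z)) mulVf// mul1r mulVf// subrr.
  by rewrite subr0 subr_le0 mulr_ile1 ?enorm_ge0.
- move=> -> y; have nz0 : enorm z != 0 by apply: contra_neq z0; exact: enorm_eq0.
  rewrite dotpZl dotpBr -sqr_enorm mulrBr expr2 mulrA mulVf// mul1r addrC subrK.
  by rewrite ler_pdivrMl ?lt0r ?nz0 ?enorm_ge0// dotp_le.
Qed.

End euclidean_theory.

(* The product sigma-algebra of R^n, generated by the coordinate maps; it is the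
   Borel sigma-algebra. *)
Definition rV_display : measure_display. Proof. exact: default_measure_display. Qed.

Section measurable_rV.
Context {R : realType} {n : nat}.

Definition rV_coord (i : 'I_n) (x : 'rV[R]_n) : measurableTypeR R := x ord0 i.

Let rV_set0 : g_sigma_preimage rV_coord set0.
Proof. exact: sigma_algebra0. Qed.

Let rV_setC A : g_sigma_preimage rV_coord A -> g_sigma_preimage rV_coord (~` A).
Proof. exact: sigma_algebraC. Qed.

Let rV_bigcup (F : _^nat) : (forall i, g_sigma_preimage rV_coord (F i)) ->
  g_sigma_preimage rV_coord (\bigcup_i (F i)).
Proof. exact: sigma_algebra_bigcup. Qed.

HB.instance Definition _ := @isMeasurable.Build rV_display
  'rV[R]_n (g_sigma_preimage rV_coord) rV_set0 rV_setC rV_bigcup.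

End measurable_rV.

Section lebesgue_rV.
Context {R : realType}.
Local Open Scope ereal_scope.

Definition rV_cons n (y : measurableTypeR R * 'rV[R]_n) : 'rV[R]_n.+1 :=
  \row_i oapp (fun j => y.2 ord0 j) y.1 (unlift ord0 i).

Definition rV_uncons n (x : 'rV[R]_n.+1) : measurableTypeR R * 'rV[R]_n :=
  (x ord0 ord0, \row_j x ord0 (lift ord0 j)).

Lemma rV_consK n : cancel (@rV_cons n) (@rV_uncons n).
Proof.
move=> [a v]; rewrite /rV_uncons /rV_cons mxE unlift_none; congr pair.
by apply/rowP => j; rewrite !mxE liftK.
Qed.

Lemma rV_unconsK n : cancel (@rV_uncons n) (@rV_cons n).
Proof.
move=> x; apply/rowP => i; rewrite mxE.
by case: unliftP => [j ->|->] //=; rewrite mxE.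
Qed.

Lemma measurable_rV_coord n (i : 'I_n) :
  measurable_fun [set: 'rV[R]_n] (rV_coord i).
Proof.
move=> _ Y mY; rewrite setTI; apply: sub_sigma_algebra => /=.
rewrite -bigcup_seq/=; exists i => /=; first by rewrite mem_index_enum.
by exists Y => //; rewrite setTI.
Qed.

Lemma measurable_fun_rVP d (T : measurableType d) n (f : T -> 'rV[R]_n) :
  measurable_fun [set: T] f <->
  forall i, measurable_fun [set: T] (rV_coord i \o f).
Proof.
split=> [mf i|mf].
  by apply: measurableT_comp => //; exact: measurable_rV_coord.
move=> _ A mA; rewrite setTI; move: A mA.
apply: (@smallest_sub _ (@sigma_algebra _ setT) _
  [set B | measurable (f @^-1` B)]).
- split => [|B mB|F mF] /=; first by rewrite preimage_set0.
    by rewrite setTD preimage_setC; exact: measurableC.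
  by rewrite preimage_bigcup; exact: bigcupT_measurable.
- rewrite -bigcup_seq => B [i _ [C mC <-]] /=.
  by rewrite setTI -comp_preimage -[_ @^-1` _]setTI; exact: mf.
Qed.

Lemma measurable_rV_cons n : measurable_fun setT (@rV_cons n).
Proof.
apply/measurable_fun_rVP => i; case: (unliftP ord0 i) => [j ->|->].
- rewrite (_ : _ \o _ = rV_coord j \o snd); last first.
    by apply/funext => y; rewrite /rV_coord /= mxE liftK.
  by apply: measurableT_comp => //; exact: measurable_rV_coord.
- rewrite (_ : _ \o _ = fst)//.
  by apply/funext => y; rewrite /rV_coord /= mxE unlift_none.
Qed.

Lemma measurable_rV_uncons n : measurable_fun setT (@rV_uncons n).
Proof.
apply/measurable_fun_pairP; split; first exact: (measurable_rV_coord ord0).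
apply/measurable_fun_rVP => j; rewrite (_ : _ \o _ = rV_coord (lift ord0 j)).
  exact: measurable_rV_coord.
by apply/funext => x; rewrite /rV_coord /= mxE.
Qed.

Section succ.
Context n (mu : {sigma_finite_measure set 'rV[R]_n -> \bar R}).

Definition lebesgue_rV_succ : set 'rV[R]_n.+1 -> \bar R :=
  pushforward (@lebesgue_measure R \x mu) (@rV_cons n).

Let lebesgue_rV_succ0 : lebesgue_rV_succ set0 = 0.
Proof. by rewrite /lebesgue_rV_succ /pushforward preimage_set0 measure0. Qed.

Let lebesgue_rV_succ_ge0 A : 0 <= lebesgue_rV_succ A.
Proof. by rewrite /lebesgue_rV_succ /pushforward measure_ge0. Qed.

Let lebesgue_rV_succ_sigma_additive : semi_sigma_additive lebesgue_rV_succ.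
Proof.
have mc A : measurable A -> measurable (@rV_cons n @^-1` A).
  by move=> mA; rewrite -[_ @^-1` _]setTI; exact: measurable_rV_cons.
move=> F mF tF mUF; rewrite /lebesgue_rV_succ /pushforward preimage_bigcup.
apply: measure_semi_sigma_additive.
- by move=> k; exact: mc.
- apply/trivIsetP => /= i j _ _ ij; rewrite -preimage_setI.
  by move/trivIsetP : tF => /(_ _ _ _ _ ij) ->//; rewrite preimage_set0.
- by rewrite -preimage_bigcup; exact: mc.
Qed.

HB.instance Definition _ := isMeasure.Build _ _ _ lebesgue_rV_succ
  lebesgue_rV_succ0 lebesgue_rV_succ_ge0 lebesgue_rV_succ_sigma_additive.

Let lebesgue_rV_succ_sigma_finite : sigma_finite setT lebesgue_rV_succ.
Proof.
have /sigma_finiteP[F [TF ndF Foo]] := sigma_finiteT (@lebesgue_measure R).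
have /sigma_finiteP[G [TG ndG Goo]] := sigma_finiteT mu.
exists (fun k => @rV_uncons n @^-1` (F k `*` G k)).
  rewrite -preimage_bigcup (_ : \bigcup_k _ = setT) ?preimage_setT//.
  rewrite -setXTT TF TG predeqE => -[x y]; split.
    by move=> [k _ []/= ? ?]; split; exists k.
  move=> [/= [k _ Fkx] [l _ Gly]]; exists (maxn k l) => //; split.
  - by move: x Fkx; exact/subsetPset/ndF/leq_maxl.
  - by move: y Gly; exact/subsetPset/ndG/leq_maxr.
move=> k; have [mF Fk] := Foo k; have [mG Gk] := Goo k; split.
  rewrite -[_ @^-1` _]setTI; apply: measurable_rV_uncons => //.
  exact: measurableX.
rewrite /lebesgue_rV_succ /pushforward -comp_preimage.
rewrite (_ : _ \o _ = id); last by apply/funext; exact: rV_consK.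
by rewrite preimage_id product_measure1E// lte_mul_pinfty// ge0_fin_numE.
Qed.

HB.instance Definition _ := @Measure_isSigmaFinite.Build _ _ _
  lebesgue_rV_succ lebesgue_rV_succ_sigma_finite.

End succ.

Fixpoint lebesgue_rV n : {sigma_finite_measure set 'rV[R]_n -> \bar R} :=
  match n with
  | 0%N => dirac (0%R : 'rV[R]_0)
  | m.+1 => lebesgue_rV_succ (lebesgue_rV m)
  end.

End lebesgue_rV.

Section lebesgue_rV_theory.
Context {R : realType}.
Local Open Scope ereal_scope.

Lemma lebesgue_rV_box n (A : 'I_n -> set R) : (forall i, measurable (A i)) ->
  lebesgue_rV n [set x | forall i, A i (x ord0 i)] =
  \prod_(i < n) lebesgue_measure (A i).
Proof.
elim: n => [|n IHn] in A * => mA.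
  by rewrite big_ord0 /= diracE mem_set// => -[].
rewrite big_ord_recl -IHn => [|i]; last exact: mA.
rewrite /= /lebesgue_rV_succ /pushforward.
rewrite -product_measure1E//.
- congr (_ _); apply/seteqP; split=> -[a v] /=.
    move=> Aav; split=> [|i]; first by have := Aav ord0; rewrite mxE unlift_none.
    by have := Aav (lift ord0 i); rewrite mxE liftK.
  by move=> [/= Aa Av] i; rewrite mxE; case: unliftP => [j ->|->].
- exact: mA.
- rewrite (_ : (fun=> _) = \bigcap_(i in setT) (rV_coord i @^-1` A (lift ord0 i))).
    apply: fin_bigcap_measurable => // i _.
    by rewrite -[_ @^-1` _]setTI; apply: measurable_rV_coord => //; exact: mA.
  by apply/seteqP; split=> x /= Ax i => [_|]; exact: Ax.
Qed.

End lebesgue_rV_theory.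

Section sets.
Context {R : realType} {n : nat}.
Implicit Types (A w Omega : set 'rV[R]_n) (u : 'rV[R]_n -> R).

Definition domain Omega := [/\ Omega !=set0, open Omega & connected Omega].

Definition compactly_contained w Omega :=
  compact (closure w) /\ closure w `<=` Omega.

(* Near each boundary point, after a rotation taking the last coordinate axis to
   the unit vector e, w is the epigraph of a Lipschitz function g of the
   remaining variables; these are represented by the hyperplane orthogonal to e,
   so that the values of g outside of it are irrelevant. *)
Definition lipschitz_boundary w :=
  forall x0, (closure w `\` w°) x0 ->
  exists (e : 'rV[R]_n) (g : 'rV[R]_n -> R),
    [/\ enorm e = 1,
        [lipschitz g y | y in [set y | dotp y e = 0]] &
        \forall x \near x0, w x <-> g (x - dotp x e *: e) < dotp x e].

Definition bounded_lipschitz_domain w :=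
  [/\ domain w, bounded_set w & lipschitz_boundary w].

Definition affine_on A u :=
  exists (a : 'rV[R]_n) (c : R), forall x, A x -> u x = dotp a x + c.

Definition facet Omega u : set 'rV[R]_n :=
  [set x | Omega x /\ forall y, Omega y -> u x <= u y].

End sets.

Section sobolev.
Context {R : realType} {n : nat}.
Implicit Types (A w Omega : set 'rV[R]_n) (u phi : 'rV[R]_n -> R).
Implicit Types (G Z : 'rV[R]_n -> 'rV[R]_n) (p b : R).

Local Notation mu := (lebesgue_rV (R := R) n).

Definition partial (i : 'I_n) u x : R := 'D_(delta_mx ord0 i) u x.

Fixpoint Ck k u : Prop :=
  continuous u /\
  match k with
  | 0%N => True
  | k'.+1 => forall i, (forall x, derivable u x (delta_mx ord0 i)) /\
                       Ck k' (partial i u)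
  end.

Definition test_function A phi :=
  (forall k, Ck k phi) /\
  compactly_contained [set x | phi x != 0] A.

(* u is only constrained on A: u \_ A is u extended by 0 outside of A. *)
Definition Lp_on A (q : \bar R) u := u \_ A \in Lfun mu q.

Definition Lp_vect_on A (q : \bar R) G :=
  forall i, Lp_on A q (fun x => G x ord0 i).

Definition weak_gradient A u G := forall phi i, test_function A phi ->
  \int[mu]_(x in A) (u x * partial i phi x) =
  - \int[mu]_(x in A) (G x ord0 i * phi x).

(* In the Sobolev spaces the weak gradient G, unique up to a.e. equality, is an
   explicit argument. *)
Definition sobolev A p u G :=
  [/\ Lp_on A p%:E u, Lp_vect_on A p%:E G & weak_gradient A u G].

Definition sobolev_loc Omega p u G := forall A,
  open A -> compactly_contained A Omega -> sobolev A p u G.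

Definition cvg_Lp A p (f : nat -> 'rV[R]_n -> R) u :=
  Lnorm mu p%:E (EFin \o (f k \- u) \_ A) @[k --> \oo] --> 0%E.

(* The closure of the test functions in W^{1,p}(A). *)
Definition sobolev0 A p u G :=
  sobolev A p u G /\
  exists f : nat -> 'rV[R]_n -> R,
    [/\ forall k, test_function A (f k),
        cvg_Lp A p f u &
        forall i, cvg_Lp A p (fun k => partial i (f k)) (fun x => G x ord0 i)].

(* |z|^(p-2) z; it vanishes at z = 0 whatever the value of 0 `^ (p - 2). *)
Definition pflux p (z : 'rV[R]_n) : 'rV[R]_n := (enorm z `^ (p - 2)) *: z.

Definition weak_solution b p Omega u :=
  exists2 Du, sobolev_loc Omega p u Du &
  forall w, bounded_lipschitz_domain w -> compactly_contained w Omega ->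
  exists Z, [/\ Lp_vect_on w +oo%E Z,
    {ae mu, forall x, w x -> subdifferential enorm (Du x) (Z x)} &
    forall phi Dphi, sobolev0 w p phi Dphi ->
      b * \int[mu]_(x in w) dotp (Z x) (Dphi x) +
      \int[mu]_(x in w) dotp (pflux p (Du x)) (Dphi x) = 0].

End sobolev.

(* Main.v *)
Require Import Defs.
From mathcomp Require Import all_boot all_order all_algebra.
From mathcomp Require Import ring lra.
From mathcomp Require Import all_classical all_reals all_analysis.
From mathcomp Require Import measurable_realfun.

Set Implicit Arguments.
Unset Strict Implicit.
Unset Printing Implicit Defensive.

Import Order.TTheory GRing.Theory Num.Theory.
Import numFieldNormedType.Exports.

Local Open Scope classical_set_scope.
Local Open Scope ring_scope.

(* If u is not minimal at x0, then u < u(x0) at some point of Omega, so all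
   subgradients near x0 are bounded away from 0 and from infinity. There u is a
   uniform limit of smooth convex functions f (soft maxima of affine minorants of
   u) whose gradients stay away from 0 and converge a.e. to the weak gradient of
   u. For such f, div (grad f / |grad f|) >= 0 and div (|grad f|^(p-2) grad f) is
   at least a positive constant times the Laplacian of f, while the integral of
   b div (grad f / |grad f|) + div (|grad f|^(p-2) grad f) against a test function
   tends to 0 by the equation. Hence the distributional Laplacian of u vanishes
   near x0, and so do its nonnegative pure second derivatives. Therefore the
   second differences of u along the coordinate axes vanish, and since u is
   convex it is affine near x0. A function that is locally affine on a connected
   set is affine on it. *)

(** The normalised gradient alone controls nothing in the direction of the gradient: the divergence
    of [|z|^(2q) z] dominates min(1, 1 + 2q) |z|^(2q) times the trace of the Hessian, and this
    factor is 0 for q = -1/2. The b-term is therefore only kept nonnegative, and the p-term, with 1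
    + 2q = p - 1 > 0, yields the Laplacian. Both need a nonzero gradient. The approximations f stay
    below u + eps on all of [Omega], not only near x0, so the subgradient inequality of f towards
    the distant lower point bounds grad f from below. These bounds also make dominated convergence
    carry the fluxes to the weak gradient G, where the multiplier [Z] is forced to be G/|G|. The
    weak gradient is tied to u through difference quotients: along an axis they are monotone for
    convex u, hence convergent, and testing identifies the limit a.e. Second derivatives of f occur
    only under integrals against test functions, and integration by parts returns them to u. The
    equation is posed on Lipschitz domains and the calculus is done on boxes; a Euclidean ball
    around nested cubes joins the two. *)

Section rV_norm.
Context {R : realType} {n : nat}.
Implicit Types (x y v : 'rV[R]_n).

Lemma rV_norm_leP x r : 0 <= r ->
  reflect (forall i, `|x ord0 i| <= r) (`|x| <= r).
Proof.
move=> r0; apply: (iffP idP) => [xr i|xr].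
  apply: le_trans xr; rewrite [leRHS]mx_normrE.
  exact: (le_bigmax _ (fun i : 'I_1 * 'I_n => `|x i.1 i.2|) (ord0, i)).
rewrite [leLHS]mx_normrE; apply/bigmax_leP; split => // -[i j] _ /=.
by rewrite (ord1 i).
Qed.

Lemma rV_norm_ltP x r : 0 < r ->
  reflect (forall i, `|x ord0 i| < r) (`|x| < r).
Proof.
move=> r0; apply: (iffP idP) => [xr i|xr].
  by apply: le_lt_trans xr; exact/(@rV_norm_leP x `|x|).
rewrite [ltLHS]mx_normrE; apply/bigmax_ltP; split => // -[i j] _ /=.
by rewrite (ord1 i).
Qed.

Lemma coord_le_norm x i : `|x ord0 i| <= `|x|.
Proof. exact/(@rV_norm_leP x `|x|). Qed.

Lemma continuous_at_normP (f : 'rV[R]_n -> R) x : {for x, continuous f} <->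
  forall e, 0 < e ->
    exists2 d : R, 0 < d & forall y, `|y - x| < d -> `|f y - f x| < e.
Proof.
split=> [/(@cvgrPdist_lt _ _ _ (nbhs x) (nbhs_filter x)) cf e e0|cf].
  have /nbhs_ballP[d /= d0 df] := cf _ e0; exists d => // y yx.
  by rewrite distrC; apply: df; rewrite mx_norm_ball /ball_/= distrC.
apply/(@cvgrPdist_lt _ _ _ (nbhs x) (nbhs_filter x)) => e e0.
have [d d0 df] := cf _ e0; apply/nbhs_ballP; exists d => //= y.
by rewrite mx_norm_ball /ball_/= distrC => /df; rewrite distrC.
Qed.

Lemma delta_coord (i j : 'I_n) :
  (delta_mx ord0 i : 'rV[R]_n) ord0 j = (j == i)%:R.
Proof. by rewrite mxE eqxx. Qed.

Lemma norm_delta (a : R) (i : 'I_n) :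
  `|a *: (delta_mx ord0 i : 'rV[R]_n)| = `|a|.
Proof.
apply/eqP; rewrite eq_le; apply/andP; split.
  apply/rV_norm_leP => // j; rewrite mxE delta_coord.
  by case: eqP => _; rewrite ?mulr1 ?mulr0 ?normr0.
apply: le_trans (coord_le_norm _ i).
by rewrite mxE delta_coord eqxx mulr1.
Qed.

Lemma rV_sum_coord x : x = \sum_i x ord0 i *: delta_mx ord0 i.
Proof. by rewrite [LHS]row_sum_delta. Qed.

Lemma dotp_delta x i : dotp x (delta_mx ord0 i) = x ord0 i.
Proof.
rewrite /dotp (bigD1 i)//= delta_coord eqxx mulr1 big1 ?addr0// => j ji.
by rewrite delta_coord (negPf ji) mulr0.
Qed.

Lemma coord_le_enorm x i : `|x ord0 i| <= enorm x.
Proof.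
rewrite -sqrtr_sqr ler_sqrt ?dotpp_ge0// /dotp (bigD1 i)//= expr2 lerDl.
by apply: sumr_ge0 => j _; rewrite -expr2 sqr_ge0.
Qed.

Lemma enorm_le x : enorm x <= Num.sqrt n%:R * `|x|.
Proof.
rewrite -(ger0_norm (normr_ge0 x)) -sqrtr_sqr -sqrtrM ?ler0n//.
rewrite ler_sqrt ?mulr_ge0 ?ler0n ?sqr_ge0// /dotp.
apply: (@le_trans _ _ (\sum_(i < n) `|x| ^+ 2)).
  apply: ler_sum => i _.
  by rewrite -expr2 -real_normK ?num_real// lerXn2r ?nnegrE// coord_le_norm.
by rewrite sumr_const card_ord mulr_natl.
Qed.

Lemma enorm_le_norm x : `|x| <= enorm x.
Proof. by apply/rV_norm_leP => [|i]; rewrite ?enorm_ge0 ?coord_le_enorm. Qed.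

End rV_norm.

(** * Jensen's inequality for averages of points *)

Section jensen.
Context {R : realType} {V : lmodType R}.
Variables (A : set V) (u : V -> R).
Hypothesis cA : forall x y (t : R), A x -> A y -> 0 <= t <= 1 ->
  A (t *: x + (1 - t) *: y).
Hypothesis cu : forall x y (t : R), A x -> A y -> 0 <= t <= 1 ->
  u (t *: x + (1 - t) *: y) <= t * u x + (1 - t) * u y.

(** Induction on the number of points: the average of m+2 points combines the average of the first
    m+1, with weight [t], and the last point, with weight 1/(m+2). Membership in [A] is carried
    along because convexity of [u] is applied at the inductive average. *)
Lemma jensen_average m (y : 'I_m.+1 -> V) : (forall i, A (y i)) ->
  A (m.+1%:R^-1 *: \sum_i y i) /\
  u (m.+1%:R^-1 *: \sum_i y i) <= m.+1%:R^-1 * \sum_i u (y i).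
Proof.
elim: m => [|m IHm] in y * => Ay.
  by rewrite !big_ord1 invr1 scale1r mul1r.
have [Am um] := IHm (fun i => y (widen_ord (leqnSn _) i)) (fun i => Ay _).
set t : R := m.+1%:R / m.+2%:R.
have t01 : 0 <= t <= 1.
  by rewrite divr_ge0//= ler_pdivrMr ?ltr0Sn// mul1r ler_nat.
have t1 : 1 - t = m.+2%:R^-1.
  by rewrite /t -[X in X - _](@divff _ m.+2%:R) ?pnatr_eq0// -mulrBl -natrB// subSnn mul1r.
have tm : t * m.+1%:R^-1 = m.+2%:R^-1 by rewrite /t mulrAC divff ?pnatr_eq0// mul1r.
have -> : m.+2%:R^-1 *: \sum_i y i =
    t *: (m.+1%:R^-1 *: \sum_(i < m.+1) y (widen_ord (leqnSn _) i)) +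
    (1 - t) *: y ord_max.
  by rewrite big_ord_recr/= scalerDr scalerA tm t1.
split; first exact: cA.
apply: (le_trans (cu Am (Ay ord_max) t01)).
rewrite [in leRHS]big_ord_recr/= mulrDr t1; apply: lerD => //.
rewrite -tm -[leRHS]mulrA; apply: ler_wpM2l => //.
by case/andP: t01.
Qed.

End jensen.

(** * Convex functions *)

Section convex.
Context {R : realType} {n : nat}.
Variables (A : set 'rV[R]_n.+1) (u : 'rV[R]_n.+1 -> R).
Hypothesis cA : forall x y (t : R), A x -> A y -> 0 <= t <= 1 ->
  A (t *: x + (1 - t) *: y).
Hypothesis cu : forall x y (t : R), A x -> A y -> 0 <= t <= 1 ->
  u (t *: x + (1 - t) *: y) <= t * u x + (1 - t) * u y.
Local Notation e := (delta_mx ord0).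
Implicit Types (x y h v G : 'rV[R]_n.+1).

(* x + v is the average of the n+1 points x + (n+1) v_i e_i. *)
Lemma convex_coord_split x v :
  (forall i, A (x + (n.+1%:R * v ord0 i) *: e i)) ->
  u (x + v) <= n.+1%:R^-1 * \sum_i u (x + (n.+1%:R * v ord0 i) *: e i).
Proof.
move=> Ax; have [_] := jensen_average cA cu Ax.
rewrite big_split/= sumr_const card_ord scalerDr -[x *+ _]scaler_nat scalerA.
rewrite mulVf ?pnatr_eq0// scale1r.
suff -> : n.+1%:R^-1 *: \sum_i (n.+1%:R * v ord0 i) *: e i = v by [].
rewrite scaler_sumr [RHS]rV_sum_coord; apply: eq_bigr => i _.
by rewrite scalerA mulrA mulVf ?pnatr_eq0// mul1r.
Qed.

(** The point x divides the segment from x - h to x + t h, with weight 1/(1+t) on the far end. This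
    bounds u ahead of x from below by its values behind x, which is what subgradient inequalities
    need. *)
Lemma convex_extrapolate x h (t : R) : A (x - h) -> A (x + t *: h) -> 0 < t ->
  A x -> t * (u x - u (x - h)) <= u (x + t *: h) - u x.
Proof.
move=> Am Ap t0 Ax; have t1 : 0 < 1 + t by rewrite addr_gt0.
have t1n0 : 1 + t != 0 by rewrite gt_eqF.
have s01 : 0 <= (1 + t)^-1 <= 1.
  by rewrite invr_ge0 ltW//= invf_le1// lerDl ltW.
have := cu Ap Am s01.
have -> : (1 + t)^-1 *: (x + t *: h) + (1 - (1 + t)^-1) *: (x - h) = x.
  apply/rowP => i; rewrite !mxE; field; exact: t1n0.
move=> H; have : (1 + t) * u x <= u (x + t *: h) + t * u (x - h).
  apply: (le_trans (ler_wpM2l (ltW t1) H)); rewrite le_eqVlt; apply/orP; left.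
  by apply/eqP; field; exact: t1n0.
by lra.
Qed.

Lemma convex_slope x h (t : R) : A x -> A (x + h) -> 0 <= t <= 1 ->
  u (x + t *: h) - u x <= t * (u (x + h) - u x).
Proof.
move=> Ax Ah t01; have := cu Ah Ax t01.
have -> : t *: (x + h) + (1 - t) *: x = x + t *: h.
  by apply/rowP => i; rewrite !mxE; ring.
lra.
Qed.

(** The increment is compared with those over [k], which is h stretched to length rho: from above
    with the chord to x + k, from below with the chord to x - k extrapolated through x. Each of
    these chords rises or falls by at most 2M. *)
Lemma convex_lipschitz x (rho M : R) h : 0 < rho ->
  (forall y, `|y - x| <= rho -> A y /\ `|u y| <= M) ->
  `|h| <= rho -> `|u (x + h) - u x| <= (2 * M / rho) * `|h|.
Proof.
move=> rho0 uM hrho; have [->|h0] := eqVneq h 0.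
  by rewrite addr0 subrr normr0 mulr_ge0 ?mulr_ge0 ?invr_ge0 ?(ltW rho0)//;
     have [_] := uM x (eq_ind_r (fun z => `|z| <= rho)
        (eq_ind_r (fun z => z <= rho) (ltW rho0) (normr0 _)) (subrr x));
     move=> /(le_trans _); apply.
have nh0 : 0 < `|h| by rewrite normr_gt0.
set t := `|h| / rho; have t0 : 0 < t by rewrite divr_gt0.
have t1 : t <= 1 by rewrite ler_pdivrMr// mul1r.
set k := t^-1 *: h.
have kn : `|k| = rho.
  by rewrite normrZ gtr0_norm ?invr_gt0// /t invf_div -mulrA mulVf ?mulr1 ?gt_eqF.
have tk : t *: k = h by rewrite scalerA divff ?scale1r// gt_eqF.
have [Ax Mx] : A x /\ `|u x| <= M by apply: uM; rewrite subrr normr0 ltW.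
have [Akp Mkp] : A (x + k) /\ `|u (x + k)| <= M.
  by apply: uM; rewrite addrC addKr kn.
have [Akm Mkm] : A (x - k) /\ `|u (x - k)| <= M.
  by apply: uM; rewrite addrC addKr normrN kn.
have [Ah Mh] : A (x + h) /\ `|u (x + h)| <= M by apply: uM; rewrite addrC addKr.
have -> : 2 * M / rho * `|h| = t * (2 * M) by rewrite /t; ring.
rewrite ler_norml; apply/andP; split.
- have := @convex_extrapolate x k t Akm; rewrite tk => /(_ Ah t0 Ax).
  move: Mx Mkm; rewrite !ler_norml => /andP[a b] /andP[c d].
  apply: le_trans; rewrite -mulrN; apply: ler_wpM2l; first exact: ltW.
  by lra.
- have := @convex_slope x k t Ax Akp; rewrite tk t1 (ltW t0) => /(_ isT).
  move=> H; apply: (le_trans H); apply: ler_wpM2l; first exact: ltW.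
  by move: Mx Mkp; rewrite !ler_norml => /andP[a b] /andP[c d]; lra.
Qed.

Hypothesis oA : open A.

Lemma open_cube x : A x -> exists2 r : R, 0 < r & forall y, `|y - x| <= r -> A y.
Proof.
move=> Ax; have /nbhs_ballP[r /= r0 rA] := open_nbhs_nbhs (conj oA Ax).
exists (r / 2); first by rewrite divr_gt0.
move=> y yr; apply: rA; rewrite mx_norm_ball /ball_/= distrC.
by apply: (le_lt_trans yr); rewrite ltr_pdivrMr// mulr_natr mulr2n ltrDl.
Qed.

(** For |y - x| <= r/(n+1) the points of [convex_coord_split] lie on the segments from x to x + r
    e_i or x - r e_i, where [s i] bounds u by convexity. This gives the upper bound, and a
    reflection then gives the lower one. *)
Lemma convex_locally_bounded x : A x -> exists r M : R, 0 < r /\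
  forall y, `|y - x| <= r -> A y /\ `|u y| <= M.
Proof.
move=> Ax; have [r r0 rA] := open_cube Ax.
have rn0 : 0 < r / n.+1%:R by rewrite divr_gt0.
pose s i := `|u (x + r *: e i)| + `|u (x - r *: e i)| + `|u x|.
pose M := \sum_i s i.
have s_ge i : s i <= M by rewrite /M (bigD1 i)//= lerDl sumr_ge0// => j _; rewrite !addr_ge0.
have upper y : `|y - x| <= r / n.+1%:R -> u y <= M.
  move=> yx; pose v := y - x; have -> : y = x + v by rewrite addrC subrK.
  have vi i : `|n.+1%:R * v ord0 i| <= r.
    rewrite normrM ger0_norm// mulrC -ler_pdivlMr//.
    exact: le_trans (coord_le_norm _ _) yx.
  apply: (le_trans (convex_coord_split _)) => [i|].
    by apply: rA; rewrite addrC addKr norm_delta.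
  rewrite mulrC ler_pdivrMr//.
  rewrite mulr_natr -[X in M *+ X](card_ord n.+1) -sumr_const.
  apply: ler_sum => i _; apply: le_trans (s_ge i).
  set c := n.+1%:R * v ord0 i; pose t := `|c| / r.
  have t01 : 0 <= t <= 1 by rewrite divr_ge0// ?(ltW r0)//= ler_pdivrMr// mul1r vi.
  have side (z : 'rV[R]_n.+1) : A (x + z) -> t *: z = c *: e i ->
      `|u (x + z)| + `|u x| <= s i -> u (x + c *: e i) <= s i.
    move=> Az tz H; have := @convex_slope x z t Ax Az t01; rewrite tz => H2.
    apply: le_trans H; case/andP: t01 => t0 t1.
    have a1 := ler_norm (u (x + z)). have a2 := ler_norm (u x).
    have: t * (u (x + z) - u x) + u x <= `|u (x + z)| + `|u x|.
      have -> : t * (u (x + z) - u x) + u x = t * u (x + z) + (1 - t) * u x by ring.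
      apply: lerD; apply: (le_trans (ler_norm _)); rewrite normrM ler_piMl//.
        by rewrite ger0_norm.
      by rewrite ger0_norm; lra.
    by lra.
  have Ap : A (x + r *: e i) by apply: rA; rewrite addrC addKr norm_delta gtr0_norm.
  have Am : A (x - r *: e i).
    by apply: rA; rewrite addrC addKr normrN norm_delta gtr0_norm.
  have [c0|c0] := leP 0 c.
    apply: (side (r *: e i)) => //.
      by rewrite scalerA /t (ger0_norm c0) divfK// gt_eqF.
    by rewrite /s; have := normr_ge0 (u (x - r *: e i)); lra.
  apply: (side (- (r *: e i))) => //.
    by rewrite scalerN scalerA /t (ltr0_norm c0) divfK ?gt_eqF// scaleNr opprK.
  by rewrite /s; have := normr_ge0 (u (x + r *: e i)); lra.
exists (r / n.+1%:R), (2 * M + `|u x| * 2); split => // y yx.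
have yr : `|y - x| <= r by rewrite (le_trans yx)// ler_pdivrMr// ler_peMr ?(ltW r0)// ler1n.
split; first exact: rA.
have uy := upper _ yx.
have xxy : x + x - y - x = x - y by rewrite addrAC addrK.
(* The lower bound at y comes from the reflected point 2x - y, where u is at most [M]: x is the
   midpoint of the two. *)
have : u (x + x - y) <= M.
  by apply: upper; rewrite xxy distrC.
have Ay' : A (x + x - y) by apply: rA; rewrite xxy distrC.
have h2 : 0 <= (2^-1 : R) <= 1 by apply/andP; split; lra.
have := cu (rA _ yr) Ay' h2.
have -> : 2^-1 *: y + (1 - 2^-1) *: (x + x - y) = x.
  by apply/rowP => i; rewrite !mxE; field.
have M0 : 0 <= M by apply: sumr_ge0 => i _; rewrite !addr_ge0.
have := ler_norm (u x); have := ler_norm (- u x); rewrite normrN.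
move=> a1 a2 a3 a4; rewrite ler_norml; apply/andP; split; lra.
Qed.

Lemma convex_continuous x : A x -> {for x, continuous u}.
Proof.
move=> Ax; have [r [M [r0 rM]]] := convex_locally_bounded Ax.
have M0 : 0 <= M.
  have [|_] := rM x; first by rewrite subrr normr0 ltW.
  by apply: le_trans.
apply/continuous_at_normP => eps eps0.
have L0 : 0 < 2 * M / r + 1 by rewrite ltr_wpDl// divr_ge0 ?mulr_ge0// ltW.
exists (Num.min r (eps / (2 * M / r + 1))); first by rewrite lt_min r0 divr_gt0.
move=> y; rewrite lt_min => /andP[yr ye].
have := @convex_lipschitz x r M (y - x) r0 rM (ltW yr).
rewrite (addrC x) subrK => /le_lt_trans; apply.
apply: (@le_lt_trans _ _ ((2 * M / r + 1) * `|y - x|)).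
  by rewrite ler_wpM2r// lerDl.
by rewrite mulrC -ltr_pdivlMr.
Qed.

(** Upper bounds along the axes suffice. [convex_coord_split] combines them into an upper bound on u
    at x - t v, slightly behind x as seen from y = x + v, and extrapolating through x turns it into
    a lower bound at y. *)
Lemma convex_subgradient x G : A x ->
  (forall eps : R, 0 < eps -> exists2 s0 : R, 0 < s0 & forall i s,
     `|s| <= s0 -> u (x + s *: e i) - u x <= s * G ord0 i + eps * `|s|) ->
  forall y, A y -> u x + dotp G (y - x) <= u y.
Proof.
move=> Ax good y Ay; pose v := y - x.
have vy : x + v = y by rewrite addrC subrK.
suff key eps : 0 < eps -> u x + dotp G v <= u y + eps * `|v| *+ n.+1.
  apply/ler_addgt0Pr => d d0.
  have e0 : 0 < d / (`|v| *+ n.+1 + 1).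
    by rewrite divr_gt0// ltr_wpDl// mulrn_wge0.
  apply: (le_trans (key _ e0)); rewrite lerD2l -mulrnAr -mulrA ler_piMr ?(ltW d0)//.
  by rewrite mulrC ler_pdivrMr ?mul1r ?lerDl// ltr_wpDl// mulrn_wge0.
move=> eps0; have [s0 s00 sG] := good _ eps0.
have [r r0 rA] := open_cube Ax.
pose m := Num.min s0 r.
have m0 : 0 < m by rewrite lt_min s00.
(* All points used by [convex_coord_split] at x - t v are then within [m] of x, inside [A] and in
   the range of the axis bounds; the summand 1 covers y = x. *)
pose t := m / (n.+1%:R * (`|v| + 1)).
have nv0 : 0 < n.+1%:R * (`|v| + 1) by rewrite mulr_gt0// ltr_wpDl.
have t0 : 0 < t by rewrite divr_gt0.
have tE : n.+1%:R * (t * (`|v| + 1)) = m.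
  by rewrite mulrCA divfK// gt_eqF.
have vE i : (- (t *: v)) ord0 i = - (t * v ord0 i).
  by rewrite mxE; congr (- _); rewrite mxE.
have tvi i : `|n.+1%:R * (- (t *: v)) ord0 i| <= m.
  rewrite vE normrM ger0_norm// normrN normrM (gtr0_norm t0) -tE.
  rewrite ler_wpM2l// ler_wpM2l ?(ltW t0)//.
  by rewrite (le_trans (coord_le_norm _ _))// lerDl.
have step : u (x - t *: v) <= u x - t * dotp G v + t * (eps * `|v| *+ n.+1).
  apply: (le_trans (convex_coord_split _)) => [i|].
    by apply: rA; rewrite addrC addKr norm_delta (le_trans (tvi i))// ge_min lexx orbT.
  rewrite mulrC ler_pdivrMr//.
  have bnd i : u (x + (n.+1%:R * (- (t *: v)) ord0 i) *: e i) <=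
      u x - t * n.+1%:R * (G ord0 i * v ord0 i) + t * n.+1%:R * (eps * `|v|).
    have sm : `|n.+1%:R * (- (t *: v)) ord0 i| <= s0.
      by rewrite (le_trans (tvi i))// ge_min lexx.
    have := sG i _ sm; rewrite lerBlDl => /le_trans; apply.
    rewrite -addrA lerD2l; apply: lerD.
      by rewrite vE le_eqVlt; apply/orP; left; apply/eqP; ring.
    rewrite vE normrM ger0_norm// normrN normrM (gtr0_norm t0).
    have -> : eps * (n.+1%:R * (t * `|v ord0 i|)) = t * n.+1%:R * (eps * `|v ord0 i|).
      by ring.
    by apply: ler_wpM2l; [rewrite mulr_ge0// ltW|rewrite ler_wpM2l ?(ltW eps0)// coord_le_norm].
  apply: (le_trans (ler_sum _ (fun i _ => bnd i))).
  rewrite !big_split/= !sumr_const card_ord sumrN -mulr_sumr -/(dotp G v).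
  rewrite le_eqVlt; apply/orP; left; apply/eqP.
  rewrite -[u x *+ _]mulr_natr -[(_ * (eps * _)) *+ _]mulr_natr.
  by rewrite -[(eps * _) *+ _]mulr_natr; ring.
have Am : A (x - t *: v).
  apply: rA; rewrite addrC addKr normrN normrZ (gtr0_norm t0).
  apply: (@le_trans _ _ m); last by rewrite ge_min lexx orbT.
  rewrite -tE (@le_trans _ _ (t * (`|v| + 1)))//.
    by rewrite ler_wpM2l ?(ltW t0)// lerDl.
  by rewrite ler_peMl ?ler1n// mulr_ge0 ?addr_ge0// ltW.
have tn0 : t^-1 *: (t *: v) = v by rewrite scalerA mulVf ?scale1r// gt_eqF.
have ti0 : 0 < t^-1 by rewrite invr_gt0.
have := @convex_extrapolate x (t *: v) t^-1 Am; rewrite tn0 vy => /(_ Ay ti0 Ax).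
rewrite mulrC ler_pdivrMr// => H.
have : t * (u x + dotp G v) <= t * (u y + eps * `|v| *+ n.+1).
  by move: H step; rewrite !mulrDr !mulrBl; lra.
by rewrite ler_pM2l.
Qed.

End convex.

(** * Lebesgue measure on boxes *)

Section box.
Context {R : realType} {n : nat}.
Implicit Types (a b x v : 'rV[R]_n).

Definition box a b : set 'rV[R]_n :=
  [set x | forall i, a ord0 i < x ord0 i < b ord0 i].

Lemma measurable_box a b : measurable (box a b).
Proof.
rewrite (_ : box a b =
    \bigcap_(i in setT) (rV_coord i @^-1` `]a ord0 i, b ord0 i[%classic)).
  apply: fin_bigcap_measurable => // i _; rewrite -[_ @^-1` _]setTI.
  exact: measurable_rV_coord.
apply/seteqP; split=> x /= h i; first by move=> _ /=; rewrite in_itv /=; exact: h.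
by have := h i I; rewrite /= in_itv.
Qed.

Lemma open_box a b : open (box a b).
Proof.
rewrite openE => x xab; apply/nbhs_ballP.
pose d := \big[Num.min/1]_(i < n)
  Num.min (x ord0 i - a ord0 i) (b ord0 i - x ord0 i).
have d0 : 0 < d.
  apply/bigmin_gtP; split=> // i _.
  by rewrite lt_min !subr_gt0; exact: xab.
exists d => //= y; rewrite mx_norm_ball /ball_/= => /(rV_norm_ltP _ d0) xy i.
have := xy i; rewrite !mxE => /lt_le_trans.
move=> /(_ (Num.min (x ord0 i - a ord0 i) (b ord0 i - x ord0 i))).
move=> /(_ (bigmin_le_cond _ (fun i => Num.min (x ord0 i - a ord0 i) (b ord0 i - x ord0 i)) isT)).
by rewrite lt_min !ltr_norml => /andP[/andP[? ?] /andP[? ?]]; apply/andP; split; lra.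
Qed.

Lemma box_setI a b c d : box a b `&` box c d =
  box (\row_i Num.max (a ord0 i) (c ord0 i))
      (\row_i Num.min (b ord0 i) (d ord0 i)).
Proof.
apply/seteqP; split=> x.
  move=> [h k] i; rewrite !mxE gt_max lt_min.
  by have /andP[-> ->] := h i; have /andP[-> ->] := k i.
move=> h; split=> i; have := h i; rewrite !mxE gt_max lt_min;
by move=> /andP[/andP[? ?] /andP[? ?]]; apply/andP; split.
Qed.

(** The sigma-algebra is generated by the coordinates, so open sets need an argument: each is the
    union of the boxes inside it with rational centre and half-width 1/(k+1), which are countably
    many. *)
Lemma open_rV_measurable (U : set 'rV[R]_n) : open U -> measurable U.
Proof.
move=> oU; pose q (s : 'rV[rat]_n * nat) : 'rV[R]_n := map_mx ratr s.1.
pose B (s : 'rV[rat]_n * nat) : set 'rV[R]_n :=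
  box (q s - const_mx s.2.+1%:R^-1) (q s + const_mx s.2.+1%:R^-1).
rewrite (_ : U = \bigcup_s (if `[< B s `<=` U >] then B s else set0)).
  apply: countable_bigcupT_measurable => // s.
  by case: ifP => _ //; exact: measurable_box.
apply/seteqP; split=> [x Ux|x [s _]]; last first.
  by case: asboolP => // sU /sU.
have /nbhs_ballP[r /= r0 rU] := open_nbhs_nbhs (conj oU Ux).
have [k kr] : exists k, k.+1%:R^-1 < r / 2.
  have [k _ /(_ k (leqnn k))] := near_infty_natSinv_lt (PosNum (divr_gt0 r0 (ltr0Sn _ 1))).
  by exists k.
have /fin_all_exists[g gP] : forall i : 'I_n, exists z : rat,
    x ord0 i - k.+1%:R^-1 < ratr z < x ord0 i + k.+1%:R^-1.
  move=> i; have [|z] := @rat_in_itvoo R (x ord0 i - k.+1%:R^-1) (x ord0 i + k.+1%:R^-1).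
    by rewrite ltrD2l gtrN// invr_gt0.
  by rewrite in_itv; exists z.
exists (\row_i g i, k) => //; case: asboolP => [_|].
  move=> i; rewrite !mxE /=; have /andP[? ?] := gP i.
  by apply/andP; split; [rewrite ltrBlDr|rewrite -ltrBlDr].
case=> y yB; apply: rU; rewrite mx_norm_ball /ball_/=.
apply/rV_norm_ltP => // i; rewrite !mxE.
have := yB i; rewrite !mxE/= !ltr_norml; move: kr (gP i).
by move: k.+1%:R^-1 => c ? /andP[? ?] /andP[? ?]; apply/andP; split; lra.
Qed.

Lemma continuous_rV_measurable (U : set 'rV[R]_n) (f : 'rV[R]_n -> R) :
  open U -> (forall x, U x -> {for x, continuous f}) -> measurable_fun U f.
Proof.
move=> oU cf; apply: (measurability _ (RGenOpens.measurableE R)).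
move=> _ [_ [a [b ->] <-]]; apply: open_rV_measurable.
rewrite openE => x [Ux /= fx]; apply: filterI.
  exact: (open_nbhs_nbhs (conj oU Ux)).
by apply: (cf _ Ux); apply: open_nbhs_nbhs; split => //; exact: interval_open.
Qed.

(** Boxes are stable under intersection, as required for uniqueness of measures and for the Dynkin
    argument in [fundamental_lemma]. A slab with one coordinate in ]x, y[ is the union over k of the
    boxes whose other sides are ]-k, k[. *)
Lemma measurable_rV_boxE : @measurable _ 'rV[R]_n =
  <<s [set A | exists a b, A = box a b] >>.
Proof.
apply/seteqP; split; last first.
  apply: smallest_sub; first exact: sigma_algebra_measurable.
  by move=> _ [a [b ->]]; exact: measurable_box.
apply: smallest_sub; first exact: smallest_sigma_algebra.
set G := (X in <<s X >>).
rewrite -bigcup_seq => B [i _ [C mC <-]] /=; rewrite setTI.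
move: C mC; rewrite RGenOpens.measurableE.
apply: (@smallest_sub _ (@sigma_algebra _ setT) _
  [set B | <<s G >> (rV_coord i @^-1` B)]).
- have [s0 sC sU] : sigma_algebra setT <<s G >> by exact: smallest_sigma_algebra.
  split => [|D mD|F mF] /=; first by rewrite preimage_set0.
    by rewrite setTD preimage_setC -setTD; exact: sC.
  by rewrite preimage_bigcup; exact: sU.
- move=> _ [x [y ->]] /=.
  have [_ _ sU] : sigma_algebra setT <<s G >> by exact: smallest_sigma_algebra.
  pose lo (k : nat) : 'rV[R]_n := \row_j if j == i then x else - k%:R.
  pose hi (k : nat) : 'rV[R]_n := \row_j if j == i then y else k%:R.
  rewrite (_ : _ @^-1` _ = \bigcup_k box (lo k) (hi k)).
    by apply: sU => k; apply: sub_sigma_algebra; exists (lo k), (hi k).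
  apply/seteqP; split=> z /=.
    rewrite in_itv /= => zi; exists (Num.truncn `|z|).+1 => //= j; rewrite !mxE.
    case: eqP => [->//|_]; rewrite -ltr_norml.
    by rewrite (le_lt_trans (coord_le_norm _ _))// truncnS_gt.
  by move=> [k _] /(_ i); rewrite !mxE eqxx in_itv.
Qed.

Lemma measure_rV_unique (m1 m2 : {measure set 'rV[R]_n -> \bar R}) :
  (forall a b, m1 (box a b) = m2 (box a b)) ->
  (forall a b, (m1 (box a b) < +oo)%E) ->
  forall A, measurable A -> m1 A = m2 A.
Proof.
move=> m12 m1oo; apply: (@measure_unique _ _ _ [set A | exists a b, A = box a b]
    (fun k => box (const_mx (- k%:R)) (const_mx k%:R)) measurable_rV_boxE
    _ _ _ m1 m2) => //.
- by move=> _ _ [a [b ->]] [c [d ->]]; rewrite box_setI; do 2 eexists.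
- by move=> k; do 2 eexists.
- apply/seteqP; split=> // x _; exists (Num.truncn `|x|).+1 => //= i.
  rewrite !mxE -ltr_norml (le_lt_trans (coord_le_norm _ _))//.
  by rewrite truncnS_gt.
- by move=> _ [a [b ->]].
Qed.

Local Notation mu := (lebesgue_rV (R := R) n).

Lemma lebesgue_rV_boxE a b : mu (box a b) =
  (\prod_(i < n) (Num.max 0 (b ord0 i - a ord0 i))%:E)%E.
Proof.
have -> : box a b =
    [set x | forall i, (fun i => `]a ord0 i, b ord0 i[%classic) i (x ord0 i)].
  by apply/seteqP; split=> x /= h i; have := h i; rewrite /= in_itv.
rewrite [LHS](@lebesgue_rV_box R n (fun i => `]a ord0 i, b ord0 i[%classic))//.
apply: eq_bigr => i _.
rewrite lebesgue_measure_itv/= lte_fin; case: ltP => ab.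
  by rewrite max_r// subr_ge0 ltW.
by rewrite max_l// subr_le0.
Qed.

Lemma lebesgue_rV_box_lty a b : (mu (box a b) < +oo)%E.
Proof. by rewrite lebesgue_rV_boxE prodEFin ltry. Qed.

Lemma lebesgue_rV_box_gt0 a b : (forall i, a ord0 i < b ord0 i) ->
  (0 < mu (box a b))%E.
Proof.
move=> ab; rewrite lebesgue_rV_boxE prodEFin lte_fin; apply: prodr_gt0 => i _.
by rewrite lt_max subr_gt0 ab orbT.
Qed.

Lemma measurable_rV_shift v :
  measurable_fun [set: 'rV[R]_n] (fun x : 'rV[R]_n => x + v).
Proof.
apply/measurable_fun_rVP => i.
rewrite (_ : _ \o _ = fun x => rV_coord i x + v ord0 i).
  by apply: measurable_funD => //; exact: measurable_rV_coord.
by apply/funext => x; rewrite /rV_coord /= mxE.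
Qed.

(** A translated box has the same side lengths, and the values on boxes determine the measure. *)
Lemma lebesgue_rV_shift v A : measurable A ->
  pushforward mu (fun x : 'rV[R]_n => x + v) A = mu A.
Proof.
move=> mA; apply/esym.
apply: (@measure_rV_unique mu (measure_function_pushforward__canonical__measure_function_Measure
  mu (measurable_rV_shift v))) => //= a b; last exact: lebesgue_rV_box_lty.
rewrite /pushforward/= (_ : _ @^-1` _ = box (a - v) (b - v)).
  rewrite !lebesgue_rV_boxE; apply: eq_bigr => i _; rewrite !mxE.
  by rewrite opprB addrA subrK.
by apply/seteqP; split=> x /= h i; have := h i; rewrite !mxE ltrBlDr ltrBrDr.
Qed.

Lemma Rintegral_rV_shift (f : 'rV[R]_n -> R) v :
  mu.-integrable setT (EFin \o f) ->
  mu.-integrable setT (EFin \o (fun x => f (x + v))) ->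
  \int[mu]_x f (x + v) = \int[mu]_x f x.
Proof.
move=> intf intfv; congr fine.
have mf : measurable_fun [set: 'rV[R]_n] (EFin \o f) by case/integrableP: intf.
have := integral_pushforward (measurable_rV_shift v) mf.
move=> /(_ mu setT); rewrite preimage_setT => /(_ intfv measurableT).
rewrite /= => <-; apply: eq_measure_integral => [|mv A mA _]; first exact: measurable_rV_shift.
exact: lebesgue_rV_shift.
Qed.

End box.

(** * Pointwise continuity and functions vanishing near a point *)

Section continuous_at.
Context {R : realType} {V : topologicalType}.
Implicit Types (x : V) (f g : V -> R).

Lemma continuous_atM f g x : {for x, continuous f} -> {for x, continuous g} ->
  {for x, continuous (fun y => f y * g y)}.
Proof. exact: cvgM. Qed.

Lemma continuous_atD f g x : {for x, continuous f} -> {for x, continuous g} ->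
  {for x, continuous (fun y => f y + g y)}.
Proof. exact: cvgD. Qed.

Lemma continuous_atN f x : {for x, continuous f} ->
  {for x, continuous (fun y => - f y)}.
Proof. exact: cvgN. Qed.

Lemma continuous_at_cst (a : R) x : {for x, continuous (fun=> a)}.
Proof. exact: cvg_cst. Qed.

Lemma continuous_at_chain (h : R -> R) f x : {for f x, continuous h} ->
  {for x, continuous f} -> {for x, continuous (fun y => h (f y))}.
Proof. by move=> ch cf; exact: (continuous_comp cf ch). Qed.

Lemma continuous_at_sum (I : Type) (r : seq I) (F : I -> V -> R) x :
  (forall i, {for x, continuous (F i)}) ->
  {for x, continuous (fun y => \sum_(i <- r) F i y)}.
Proof.
move=> cF; elim: r => [|i r IHr].
  have -> : (fun y => \sum_(i <- [::]) F i y) = (fun=> 0).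
    by apply/funext => y; rewrite big_nil.
  exact: continuous_at_cst.
have -> : (fun y => \sum_(j <- i :: r) F j y) =
    (fun y => F i y + \sum_(j <- r) F j y).
  by apply/funext => y; rewrite big_cons.
exact: continuous_atD.
Qed.

Lemma continuous_at_near0 f x : (\forall y \near x, f y = 0) ->
  {for x, continuous f}.
Proof.
move=> f0; rewrite /prop_for /continuous_at (nbhs_singleton f0).
have := near_eq_cvg (F := nbhs x) (f := fun=> 0) (g := f).
move=> /(_ _ _)/cvg_trans; apply; last exact: cvg_cst.
by apply: filterS f0 => y ->.
Qed.

Lemma near_is_derive0 (W : normedModType R) (f : W -> R) (x v : W) :
  (\forall y \near x, f y = 0) -> is_derive x v f 0.
Proof.
move=> f0; apply: (@near_eq_is_derive _ _ _ (cst 0)).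
by apply: filterS f0 => y ->.
Qed.

End continuous_at.

(** * Integration by parts *)

Section compact_support.
Context {R : realType} {n : nat}.
Implicit Types (x v : 'rV[R]_n) (U K : set 'rV[R]_n) (f g : 'rV[R]_n -> R).

Lemma compact_fun_bounded K f : compact K ->
  (forall x, K x -> {for x, continuous f}) ->
  exists M, forall x, K x -> `|f x| <= M.
Proof.
move=> cK cf; have /compact_bounded/pinfty_ex_gt0[M M0 fM] : compact (f @` K).
  apply: continuous_compact => //; apply: continuous_in_subspaceT => x.
  by rewrite inE; exact: cf.
by exists M => x Kx; apply: fM => /=; exists x.
Qed.

Lemma continuous_at_shift f v x : {for x + v, continuous f} ->
  {for x, continuous (fun y : 'rV[R]_n => f (y + v))}.
Proof.
move=> /continuous_at_normP cf; apply/continuous_at_normP => d d0.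
have [r r0 fr] := cf d d0; exists r => // y yx.
by apply: fr; rewrite opprD addrACA subrr addr0.
Qed.

Lemma bounded_subset_box (A : set 'rV[R]_n) : bounded_set A ->
  exists2 r : R, 0 < r & A `<=` box (const_mx (- r)) (const_mx r).
Proof.
move=> /pinfty_ex_gt0[M M0 AM]; exists (M + 1); first by rewrite addr_gt0.
move=> x Ax i; rewrite !mxE -ltr_norml (le_lt_trans (coord_le_norm _ _))//.
by rewrite (le_lt_trans (AM _ Ax))// ltrDl.
Qed.

Lemma not_closure_near_eq0 f x : ~ closure [set y | f y != 0] x ->
  \forall y \near x, f y = 0.
Proof.
move=> /existsNP[B /not_implyP[Bx /set0P/negP/negPn/eqP H]].
apply: filterS Bx => y By; apply: contrapT => /eqP fy.
suff : ([set y | f y != 0] `&` B) y by rewrite H.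
by split.
Qed.

(** Outside [U] the point avoids the closed support of [f], so the product vanishes near it whatever
    [g] does there. This allows fluxes that are regular only where the gradient is known to be
    nonzero. *)
Lemma mul_support_continuous U f g : open U ->
  compactly_contained [set x | f x != 0] U ->
  continuous f -> (forall x, U x -> {for x, continuous g}) ->
  continuous (f \* g).
Proof.
move=> oU [cS SU] cf cg x; have [Ux|nUx] := pselect (U x).
  by apply: continuous_atM; [exact: cf|exact: cg].
apply: continuous_at_near0.
have f0 : \forall y \near x, f y = 0.
  by apply: not_closure_near_eq0 => /SU.
by apply: filterS f0 => y /= ->; rewrite mul0r.
Qed.

Lemma continuous_support_bounded f (r : R) : continuous f ->
  (forall x, f x != 0 -> box (const_mx (- r)) (const_mx r) x) ->
  exists2 M, 0 <= M & forall x, `|f x| <= M.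
Proof.
move=> cf fr.
have cK : compact [set x : 'rV[R]_n | forall i, `[- r, r]%classic (x ord0 i)].
  exact: (@rV_compact R n (fun=> `[- r, r]%classic) (fun=> @segment_compact R _ _)).
have [M fM] := compact_fun_bounded cK (fun x _ => cf x).
exists `|M| => // x; have [->|fx] := eqVneq (f x) 0; first by rewrite normr0.
apply: le_trans (ler_norm M); apply: fM => i /=; rewrite in_itv/=.
by have := fr x fx i; rewrite !mxE => /andP[/ltW -> /ltW ->].
Qed.

Local Notation mu := (lebesgue_rV (R := R) n).

Lemma bounded_integrable (A : set 'rV[R]_n) f (M : R) :
  measurable A -> (mu A < +oo)%E ->
  measurable_fun A f -> (forall x, A x -> `|f x| <= M) ->
  mu.-integrable A (EFin \o f).
Proof.
move=> mA Aoo mf fM; apply: measurable_bounded_integrable => //.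
exists M; split; first by rewrite num_real.
by move=> N MN x Ax; apply: le_trans (fM _ Ax) (ltW MN).
Qed.

Lemma support_integrable (A : set 'rV[R]_n) f (M r : R) : measurable A ->
  measurable_fun A f -> (forall x, A x -> `|f x| <= M) ->
  (forall x, A x -> f x != 0 -> box (const_mx (- r)) (const_mx r) x) ->
  mu.-integrable A (EFin \o f).
Proof.
move=> mA mf fM fr; pose B : set 'rV[R]_n := box (const_mx (- r)) (const_mx r).
have mB : measurable B by exact: measurable_box.
have : mu.-integrable (A `&` B) (EFin \o f).
  apply: (@bounded_integrable _ _ M); first exact: measurableI.
  - apply: (@le_lt_trans _ _ (mu B)); last exact: lebesgue_rV_box_lty.
    by apply: le_measure; rewrite ?inE//; exact: measurableI.
  - by apply: measurable_funS mf => //; exact: subIsetl.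
  - by move=> x [/fM].
move=> /(integrable_restrict mu mB mA)/(@eq_integrable _ _ _ _ _ _ _ _); apply => //.
move=> x; rewrite inE => Ax; rewrite /patch; case: ifPn => //.
rewrite notin_setE => nBx; rewrite /=; congr EFin.
by apply: contrapT => /eqP; rewrite eq_sym => /(fr _ Ax).
Qed.

Lemma continuous_support_integrable (A : set 'rV[R]_n) f (r : R) :
  measurable A -> continuous f ->
  (forall x, f x != 0 -> box (const_mx (- r)) (const_mx r) x) ->
  mu.-integrable A (EFin \o f).
Proof.
move=> mA cf fr; have [M M0 fM] := continuous_support_bounded cf fr.
apply: (@support_integrable _ _ M r) => //; last by move=> x _; exact: fr.
apply: (@measurable_funS _ _ _ _ setT) => //.
exact: (continuous_rV_measurable openT (fun x _ => cf x)).
Qed.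

Lemma Rintegral_support (A : set 'rV[R]_n) f :
  (forall x, f x != 0 -> A x) -> \int[mu]_(x in A) f x = \int[mu]_x f x.
Proof.
move=> fA; rewrite Rintegral_mkcond; congr (Rintegral _ _ _); apply/funext => x.
rewrite /patch; case: ifPn => //; rewrite notin_setE => nAx.
by apply/esym/eqP; apply: contra_notT nAx; exact: fA.
Qed.

Lemma Rintegral_dominated_cvg (A : set 'rV[R]_n) (F : nat -> 'rV[R]_n -> R) f g :
  measurable A -> (forall k, measurable_fun A (F k)) -> measurable_fun A f ->
  {ae mu, forall x, A x -> F ^~ x @ \oo --> f x} ->
  mu.-integrable A (EFin \o g) ->
  {ae mu, forall x, forall k, A x -> `|F k x| <= g x} ->
  \int[mu]_(x in A) F k x @[k --> \oo] --> \int[mu]_(x in A) f x.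
Proof.
move=> mA mF mf Ff ig Fg.
have [||||i1 _ i2] := @dominated_convergence _ _ _ mu A mA
    (fun k => EFin \o F k) (EFin \o f) (EFin \o g) _ _ _ ig.
- by move=> k; exact/measurable_EFinP.
- exact/measurable_EFinP.
- by apply: filterS Ff => x Ff Ax; apply: cvg_EFin; [exact: nearW|exact: Ff].
- by apply: filterS Fg => x Fg k Ax; rewrite /= lee_fin; exact: Fg.
apply: fine_cvg; rewrite /Rintegral fineK//.
exact: integrable_fin_num.
Qed.

End compact_support.

Section line.
Context {R : realType} {V : normedModType R}.

(** Both sides are limits of the same difference quotient; rules for one real variable thereby apply
    to directional derivatives. *)
Lemma is_derive_line (f : V -> R) x v (t df : R) :
  is_derive (x + t *: v) v f df <->
  is_derive t 1 (fun s : R => f (x + s *: v)) df.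
Proof.
have E : (fun h : R => h^-1 *: (f (h *: v + (x + t *: v)) - f (x + t *: v))) =
    (fun h : R => h^-1 *: ((fun s : R => f (x + s *: v)) (h *: 1 + t) -
              (fun s : R => f (x + s *: v)) t)).
  apply/funext => h; congr (_ *: (f _ - f _)).
  by rewrite scalerDl addrCA [h *: 1]mulr1.
split=> -[d1 d2]; split.
- by move: d1; rewrite /derivable E.
- by move: d2; rewrite /derive E.
- by move: d1; rewrite /derivable -E.
- by move: d2; rewrite /derive -E.
Qed.

Lemma is_derive_line0 (f : V -> R) x v (df : R) :
  is_derive x v f df <-> is_derive (0 : R) (1 : R) (fun s : R => f (x + s *: v)) df.
Proof.
by split=> [|/is_derive_line];
  [rewrite -{1}[x]addr0 -(scale0r v) => /is_derive_line|rewrite scale0r addr0].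
Qed.

Lemma is_derive_chain (g : R -> R) (f : V -> R) x v (dg df : R) :
  is_derive (f x) 1 g dg -> is_derive x v f df ->
  is_derive x v (fun y => g (f y)) (dg * df).
Proof.
move=> hg /is_derive_line0 hf; apply/is_derive_line0.
apply: (@is_derive1_comp _ g (fun s : R => f (x + s *: v))) => //.
by rewrite scale0r addr0.
Qed.

Lemma is_derive_derive1 (f : R -> R) (x df : R) :
  is_derive x 1 f df -> f^`()%classic x = df.
Proof. by rewrite derive1E => -[]. Qed.

Lemma is_derive_continuous1 (f : R -> R) (x df : R) :
  is_derive x 1 f df -> {for x, continuous f}.
Proof. by move=> [/derivable1_diffP/differentiable_continuous]. Qed.

End line.

Section integration_by_parts.
Context {R : realType} {n : nat}.
Implicit Types (x v : 'rV[R]_n) (U K : set 'rV[R]_n) (f g : 'rV[R]_n -> R).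
Local Notation mu := (lebesgue_rV (R := R) n).
Local Notation e := (delta_mx ord0).

(** By translation invariance the integral of P(x + t e_i) does not depend on t; differentiating
    under the integral sign at t = 0 gives the claim, with a multiple of the indicator of a box as
    majorant. *)
Lemma Rintegral_partial_eq0 (P P' : 'rV[R]_n -> R) (i : 'I_n) (r : R) :
  continuous P -> continuous P' -> (forall x, is_derive x (e i) P (P' x)) ->
  (forall x, P x != 0 -> box (const_mx (- r)) (const_mx r) x) ->
  (forall x, P' x != 0 -> box (const_mx (- r)) (const_mx r) x) ->
  \int[mu]_x P' x = 0.
Proof.
move=> cP cP' dP Pr P'r.
have [M M0 P'M] := continuous_support_bounded cP' P'r.
pose f (t : R) (x : 'rV[R]_n) := P (x + t *: e i).
(* A translation by |t| < 1 moves the support by at most 1, so a single box of half-width r + 1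
   serves for all t. *)
have grow (Q : 'rV[R]_n -> R) t x : `]-1, 1[%classic t ->
    (forall x, Q x != 0 -> box (const_mx (- r)) (const_mx r) x) ->
    Q (x + t *: e i) != 0 -> box (const_mx (- (r + 1))) (const_mx (r + 1)) x.
  rewrite /= in_itv/= => /andP[t1 t2] Qr /Qr H j; have := H j.
  rewrite !mxE eqxx/=; case: eqP => _; rewrite ?mulr1 ?mulr0 => /andP[? ?];
  by apply/andP; split; lra.
have shift_cont (Q : 'rV[R]_n -> R) t : continuous Q ->
    continuous (fun x : 'rV[R]_n => Q (x + t *: e i)).
  by move=> cQ x; apply/continuous_at_shift/cQ.
have intf t : `]-1, 1[%classic t -> mu.-integrable setT (EFin \o f t).
  move=> t1; apply: (@continuous_support_integrable _ _ _ _ (r + 1)) => //.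
    exact: shift_cont.
  by move=> x; exact: grow t1 Pr.
have z01 : `]-1, 1[%classic (0 : R) by rewrite /= in_itv/= ltrN10 ltr01.
have fconst t : `]-1, 1[%classic t -> \int[mu]_x f t x = \int[mu]_x P x.
  move=> t1; apply: Rintegral_rV_shift; last exact: intf.
  by have := intf 0 z01; rewrite /f; under [X in EFin \o X]eq_fun do rewrite scale0r addr0.
have df (t : R) x : is_derive t (1 : R) (f ^~ x) (P' (x + t *: e i)).
  exact: (is_derive_line P x (e i) t _).1 (dP _).
pose B : set 'rV[R]_n := box (const_mx (- (r + 1))) (const_mx (r + 1)).
pose G x := M * \1_B x.
have mB : measurable B by exact: measurable_box.
have := @differentiation_under_integral R _ _ mu f setT measurableT 0 (-1) 1 z01
  intf _ G _ _ _.
have -> : (fun t => \int[mu]_x f t x)^`()%classic 0 = 0.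
  apply: is_derive_derive1.
  apply: (@near_eq_is_derive _ _ _ (cst (\int[mu]_x P x))).
  near=> t; apply/esym/fconst => /=.
  by near: t; exact: near_in_itvoo.
move=> H; transitivity (\int[mu]_y partial1of2 f 0 y); last (symmetry; apply: H).
- apply: eq_Rintegral => x _; rewrite /partial1of2.
  by rewrite (is_derive_derive1 (df 0 x)) scale0r addr0.
- by move=> t x _ _; have [] := df t x.
- by move=> x; rewrite /G mulr_ge0// indicE.
- apply: (@support_integrable _ _ _ _ M (r + 1)) => //.
  + by apply: measurable_funM => //; exact: measurable_indic.
  + by move=> x _; rewrite normrM ger0_norm// ler_piMr// indicE;
      case: (_ \in _); rewrite ?normr1 ?normr0.
  + by move=> x _; rewrite /G indicE; case: (boolP (x \in B)) => [|_]; rewrite ?inE// mulr0 eqxx.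
- move=> t x t1 _; rewrite /partial1of2 (is_derive_derive1 (df t x)).
  rewrite /G indicE; case: (boolP (x \in B)) => [_|]; first by rewrite mulr1.
  rewrite notin_setE mulr0 normr_le0 => nBx; apply/eqP.
  by apply: contrapT => /eqP /(grow _ _ _ t1 P'r).
Unshelve. all: by end_near.
Qed.

Lemma partial_support U (f df : 'rV[R]_n -> R) (i : 'I_n) :
  compactly_contained [set x | f x != 0] U ->
  (forall x, is_derive x (e i) f (df x)) ->
  compactly_contained [set x | df x != 0] U.
Proof.
move=> [cS SU] fdf.
suff sub : closure [set x | df x != 0] `<=` closure [set x | f x != 0].
  split; last exact: subset_trans sub SU.
  by apply: subclosed_compact cS sub; exact: closed_closure.
rewrite [X in _ `<=` X](closure_id _).1; last exact: closed_closure.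
apply: closureS => x /= dfx; apply: contrapT => nSx.
have f0 := not_closure_near_eq0 nSx.
have : is_derive x (e i) f 0 by exact: near_is_derive0.
by move=> [_ d0]; have [_ d1] := fdf x; move: dfx; rewrite -d1 d0 eqxx.
Qed.

Lemma compactly_contained_box (f : 'rV[R]_n -> R) U :
  compactly_contained [set x | f x != 0] U ->
  exists2 r : R, 0 < r &
    forall x, f x != 0 -> box (const_mx (- r)) (const_mx r) x.
Proof.
move=> [/compact_bounded/bounded_subset_box[r r0 Sr] _]; exists r => // x fx.
by apply: Sr; exact: subset_closure.
Qed.

Lemma mul_support_integrable U (A : set 'rV[R]_n) f g : open U -> measurable A ->
  compactly_contained [set x | f x != 0] U ->
  continuous f -> (forall x, U x -> {for x, continuous g}) ->
  mu.-integrable A (EFin \o (f \* g)).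
Proof.
move=> oU mA fU cf cg; have [r r0 fr] := compactly_contained_box fU.
apply: (@continuous_support_integrable _ _ _ _ r) => //.
  exact: mul_support_continuous cg.
by move=> x /=; rewrite mulf_eq0 negb_or => /andP[/fr].
Qed.

(** The sum of the two integrands is the partial derivative of the compactly supported product
    [f \* g], so its integral vanishes. Regularity of [g] is required on [U] only. *)
Lemma Rintegral_by_parts U (f df g dg : 'rV[R]_n -> R) (i : 'I_n) : open U ->
  compactly_contained [set x | f x != 0] U ->
  continuous f -> (forall x, is_derive x (e i) f (df x)) -> continuous df ->
  (forall x, U x -> {for x, continuous g}) ->
  (forall x, U x -> is_derive x (e i) g (dg x)) ->
  (forall x, U x -> {for x, continuous dg}) ->
  \int[mu]_(x in U) (f x * dg x) = - \int[mu]_(x in U) (df x * g x).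
Proof.
move=> oU fU cf fdf cdf cg gdg cdg.
have dfU := partial_support fU fdf.
have [r r0 fr] := compactly_contained_box fU.
have [s s0 ds] := compactly_contained_box dfU.
have mU := open_rV_measurable oU.
have suppU (h k : 'rV[R]_n -> R) x : compactly_contained [set x | h x != 0] U ->
    h x * k x != 0 -> U x.
  move=> [_ hU]; rewrite mulf_eq0 negb_or => /andP[hx _].
  by apply: hU; exact: subset_closure.
apply/eqP; rewrite -addr_eq0 -RintegralD//; [|exact: mul_support_integrable cdg
  |exact: mul_support_integrable cg].
rewrite (@Rintegral_support _ _ U (fun x => f x * dg x + df x * g x)).
apply/eqP; apply: (@Rintegral_partial_eq0 (f \* g) _ i (Num.max r s)).
- exact: mul_support_continuous cg.
- have ct : continuous (fun x : 'rV[R]_n => f x * dg x + df x * g x).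
    move=> x.
    have c1 : {for x, continuous (f \* dg)} by apply: (mul_support_continuous oU fU cf cdg).
    have c2 : {for x, continuous (df \* g)} by apply: (mul_support_continuous oU dfU cdf cg).
    have := continuous_atD c1 c2.
    exact.
  exact: ct.
- move=> x; have [Ux|nUx] := pselect (U x).
    have := is_deriveM (fdf x) (gdg x Ux).
    by rewrite /GRing.scale/= (mulrC (g x)).
  (* Outside [U] the product vanishes near x, and the formula for its derivative gives 0 there
     because [f] and [df] do. *)
  have f0 : \forall y \near x, f y = 0.
    by apply: not_closure_near_eq0; case: fU => _ SU /SU.
  have df0 : df x = 0.
    apply: contrapT => /eqP dfx; apply: nUx; case: dfU => _; apply.
    exact: subset_closure.
  rewrite df0 (nbhs_singleton f0) !mul0r addr0.
  by apply: near_is_derive0; apply: filterS f0 => y /= ->; rewrite mul0r.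
- move=> x /=; rewrite mulf_eq0 negb_or => /andP[/fr H _] i0.
  have := H i0; rewrite !mxE => /andP[H1 H2]; apply/andP; split.
    by rewrite (le_lt_trans _ H1)// lerN2 le_max lexx.
  by rewrite (lt_le_trans H2)// le_max lexx.
- move=> x /= H i0.
  have [fx|fx] := eqVneq (f x) 0.
    have dfx : df x != 0 by apply: contraNneq H => ->; rewrite fx !mul0r addr0.
    have := ds _ dfx i0; rewrite !mxE => /andP[H1 H2]; apply/andP; split.
      by rewrite (le_lt_trans _ H1)// lerN2 le_max lexx orbT.
    by rewrite (lt_le_trans H2)// le_max lexx orbT.
  have := fr _ fx i0; rewrite !mxE => /andP[H1 H2]; apply/andP; split.
    by rewrite (le_lt_trans _ H1)// lerN2 le_max lexx.
  by rewrite (lt_le_trans H2)// le_max lexx.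
- move=> x H; have [H1|H1] := eqVneq (f x * dg x) 0.
    by apply: (suppU df g) => //; move: H; rewrite H1 add0r.
  exact: suppU H1.
Qed.

End integration_by_parts.

(** * Test functions of product form *)

Section smooth.
Context {R : realType}.
Implicit Types (f g : R -> R) (p q : {poly R}).

Fixpoint cdiff k f : Prop :=
  match k with
  | 0%N => continuous f
  | k'.+1 => exists2 g, (forall x : R, is_derive x 1 f (g x)) & cdiff k' g
  end.

Lemma cdiffS k f : cdiff k.+1 f -> cdiff k f.
Proof.
elim: k f => [|k IHk] f [g fg cg]; last by exists g => //; exact: IHk.
by move=> x; exact: is_derive_continuous1 (fg x).
Qed.

Lemma cdiffD k f g : cdiff k f -> cdiff k g -> cdiff k (fun x => f x + g x).
Proof.
elim: k f g => [|k IHk] f g; first by move=> cf cg x; apply: continuous_atD; [exact: cf|exact: cg].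
move=> [f' ff' cf'] [g' gg' cg']; exists (fun x => f' x + g' x) => [x|].
  exact: is_deriveD.
exact: IHk.
Qed.

Lemma cdiffM k f g : cdiff k f -> cdiff k g -> cdiff k (fun x => f x * g x).
Proof.
elim: k f g => [|k IHk] f g; first by move=> cf cg x; apply: continuous_atM; [exact: cf|exact: cg].
move=> cf cg; have cf0 := cdiffS cf; have cg0 := cdiffS cg.
case: cf => f' ff' cf'; case: cg => g' gg' cg'.
exists (fun x => f x * g' x + g x * f' x) => [x|]; first exact: is_deriveM.
by apply: cdiffD; exact: IHk.
Qed.

Lemma cdiff_cst k (c : R) : cdiff k (fun=> c).
Proof.
elim: k c => [|k IHk] c; first by move=> x; exact: cvg_cst.
by exists (fun=> 0) => // x; exact: is_derive_cst.
Qed.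

Lemma is_derive_affine f (c d x df : R) : is_derive (c * x + d) 1 f df ->
  is_derive x 1 (fun y => f (c * y + d)) (df * c).
Proof.
move=> fd; apply: (@is_derive1_comp _ f (fun y => c * y + d)) => //.
have := is_deriveD (is_deriveZ c (is_derive_id x (1 : R))) (is_derive_cst d x (1 : R)).
by rewrite addr0 [_ *: _]mulr1.
Qed.

Lemma cdiff_affine k f (c d : R) : cdiff k f -> cdiff k (fun x => f (c * x + d)).
Proof.
elim: k f => [|k IHk] f.
  move=> cf x; apply: (@continuous_at_chain _ _ f (fun x => c * x + d)).
    exact: cf.
  apply: continuous_atD; last exact: continuous_at_cst.
  apply: continuous_atM; first exact: continuous_at_cst.
  exact: cvg_id.
move=> [f' ff' cf']; exists (fun x => f' (c * x + d) * c) => [x|].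
  exact: is_derive_affine.
apply: cdiffM; last exact: cdiff_cst.
exact: IHk.
Qed.

Definition smooth f := forall k, cdiff k f.

Lemma smoothM f g : smooth f -> smooth g -> smooth (fun x => f x * g x).
Proof. by move=> sf sg k; exact: cdiffM. Qed.

Lemma smooth_affine f (c d : R) : smooth f -> smooth (fun x => f (c * x + d)).
Proof. by move=> sf k; exact: cdiff_affine. Qed.

Lemma smooth_is_derive f : smooth f ->
  forall x : R, is_derive x 1 f (f^`()%classic x).
Proof.
by move=> /(_ 1) [g fg _] x; rewrite derive1E; have [d1 d2] := fg x; split.
Qed.

Lemma smooth_derive1 f : smooth f -> smooth f^`()%classic.
Proof.
move=> sf k; have [g fg cg] := sf k.+1.
suff -> : f^`()%classic = g by [].
by apply/funext => x; rewrite derive1E; have [_] := fg x.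
Qed.

Lemma smooth_continuous f : smooth f -> continuous f.
Proof. by move=> /(_ 0%N). Qed.

(** Each monomial satisfies s^i <= i! exp s for s >= 0, by the exponential series. *)
Lemma poly_expR_bound q : exists2 C, 0 <= C &
  forall s, 0 <= s -> `|q.[s]| <= C * expR s.
Proof.
exists (\sum_(i < size q) `|q`_i| * i`!%:R) => [|s s0].
  by apply: sumr_ge0 => i _; rewrite mulr_ge0.
rewrite horner_coef (le_trans (ler_norm_sum _ _ _))// mulr_suml.
apply: ler_sum => i _; rewrite normrM -mulrA ler_wpM2l//.
rewrite ger0_norm ?exprn_ge0// mulrC -ler_pdivrMr ?ltr0n ?fact_gt0//.
case: (nat_of_ord i) => [|j].
  by rewrite expr0 fact0 divr1 (le_trans _ (expR_ge1Dx s))// lerDl.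
by apply: le_trans (expR_ge1Dxn j s0); rewrite lerDr.
Qed.

(* With a polynomial factor p, the family is stable under differentiation. *)
Definition flat p (t : R) : R :=
  if 0 < t then p.[t^-1] * expR (- t^-1) else 0.

(** The exponential bound is applied to X^2 p at s = 1/t: the two extra powers of s become the
    factor t^2, which forces a zero derivative at 0. *)
Lemma flat_bound p : exists2 C, 0 <= C & forall t, `|flat p t| <= C * t ^+ 2.
Proof.
have [C C0 pC] := poly_expR_bound ('X^2 * p); exists C => // t.
rewrite /flat; case: ifPn => [t0|_]; last by rewrite normr0 mulr_ge0// sqr_ge0.
have s0 : 0 <= t^-1 by rewrite invr_ge0 ltW.
have := pC _ s0; rewrite hornerM hornerXn normrM normrX (ger0_norm s0).
rewrite normrM (ger0_norm (expR_ge0 _)) expRN -ler_pdivrMr ?expR_gt0// -mulrA.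
by rewrite exprVn mulrC ler_pdivrMr ?exprn_gt0.
Qed.

(** With s = 1/t, differentiating p(s) exp(-s) in t gives s^2 (p - p')(s) exp(-s). At 0 the
    difference quotient is at most C |h| by [flat_bound]. *)
Lemma is_derive_flat p (x : R) :
  is_derive x 1 (flat p) (flat ('X^2 * (p - p^`())) x).
Proof.
have [x0|x0|->] := ltgtP x 0.
- rewrite [X in is_derive _ _ _ X](_ : _ = 0); last first.
    by rewrite /flat ltNge (ltW x0).
  apply: near_is_derive0; near=> y; rewrite /flat ltNge ltW//.
  by near: y; exact: lt_nbhsl.
- pose h y := p.[y^-1] * expR (- y^-1).
  apply: (@near_eq_is_derive _ _ _ h).
    near=> y; rewrite /flat /h; suff -> : 0 < y by [].
    by near: y; exact: lt_nbhsr.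
  have xn0 : x != 0 by rewrite gt_eqF.
  have dV : is_derive x 1 (fun y : R => y^-1) (- x ^- 2).
    by have := is_deriveV xn0 (is_derive_id x (1 : R)); rewrite [_ *: _]mulr1.
  have dp : is_derive x 1 (fun y => p.[y^-1]) (p^`().[x^-1] * - x ^- 2).
    apply: (@is_derive1_comp _ (horner p) (fun y => y^-1)) => //.
  have de : is_derive x 1 (fun y => expR (- y^-1)) (expR (- x^-1) * x ^- 2).
    apply: (@is_derive1_comp _ expR (fun y => - y^-1)) => //.
    by have := is_deriveN dV; rewrite opprK.
  have dh := is_deriveM dp de; apply: (is_derive_eq dh).
  rewrite /flat x0 !hornerE /GRing.scale/=; field.
  exact: xn0.
- have [C C0 fC] := flat_bound p.
  rewrite [X in is_derive _ _ _ X](_ : _ = 0); last by rewrite /flat ltxx.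
  have f0 : flat p 0 = 0 by rewrite /flat ltxx.
  suff H : (fun h : R => h^-1 *: (flat p (h *: 1 + 0) - flat p 0)) @ 0^' --> (0 : R).
    by split; [apply/cvg_ex; exists 0|exact: cvg_lim H].
  apply/cvgrPdist_lt => eps eps0; near=> h.
  rewrite f0 subr0 addr0 sub0r normrN [h *: 1]mulr1 [_ *: _]/GRing.scale/=.
  have hn0 : h != 0 by near: h; exact: nbhs_dnbhs_neq.
  rewrite normrM normfV mulrC ltr_pdivrMr ?normr_gt0//.
  apply: (le_lt_trans (fC h)).
  rewrite -real_normK ?num_real// expr2 mulrA ltr_pM2r ?normr_gt0//.
  apply: (@le_lt_trans _ _ ((C + 1) * `|h|)); first by rewrite ler_wpM2r// lerDl.
  rewrite mulrC -ltr_pdivlMr ?ltr_wpDl//.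
  by near: h; apply: dnbhs0_lt; rewrite divr_gt0// ltr_wpDl.
Unshelve. all: by end_near.
Qed.

Lemma smooth_flat p : smooth (flat p).
Proof.
move=> k; elim: k p => [|k IHk] p.
  by move=> x; exact: is_derive_continuous1 (is_derive_flat p x).
by exists (flat ('X^2 * (p - p^`()))) => // x; exact: is_derive_flat.
Qed.

(** The shifts by 1 confine the support to [a + 1/k, b - 1/k] for k > 0, hence compactly inside ]a,
    b[; the scaling makes the values tend to 1 on ]a, b[ as k grows, because [flat 1] tends to 1 at
    infinity. *)
Definition bump (k a b t : R) : R :=
  flat 1 (k * (t - a) - 1) * flat 1 (k * (b - t) - 1).

Lemma flat1_ge0 t : 0 <= flat 1 t.
Proof. by rewrite /flat; case: ifP => // _; rewrite hornerE mul1r expR_ge0. Qed.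

Lemma flat1_gt0 t : 0 < t -> 0 < flat 1 t.
Proof. by rewrite /flat => ->; rewrite hornerE mul1r expR_gt0. Qed.

Lemma flat1_le1 t : flat 1 t <= 1.
Proof.
rewrite /flat; case: ifP => [t0|_]; last exact: ler01.
by rewrite hornerE mul1r expR_le1// oppr_le0 invr_ge0 ltW.
Qed.

Lemma flat_neq0 p t : flat p t != 0 -> 0 < t.
Proof. by rewrite /flat; case: ifP => //; rewrite eqxx. Qed.

Lemma smooth_bump k a b : smooth (bump k a b).
Proof.
have E : bump k a b = fun t =>
    flat 1 (k * t + (- k * a - 1)) * flat 1 (- k * t + (k * b - 1)).
  by apply/funext => t; rewrite /bump; congr (flat _ _ * flat _ _); ring.
rewrite E; apply: smoothM; apply: smooth_affine; exact: smooth_flat.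
Qed.

Lemma bump_ge0 k a b t : 0 <= bump k a b t.
Proof. by rewrite mulr_ge0// flat1_ge0. Qed.

Lemma bump_le1 k a b t : bump k a b t <= 1.
Proof. by rewrite mulr_ile1 ?flat1_ge0 ?flat1_le1. Qed.

Lemma bump_gt0 k a b t : 0 < k -> a + k^-1 < t < b - k^-1 -> 0 < bump k a b t.
Proof.
move=> k0 /andP[at_ tb]; rewrite mulr_gt0// flat1_gt0// subr_gt0 mulrC.
  by rewrite -ltr_pdivrMr// mul1r ltrBrDl.
by rewrite -ltr_pdivrMr// mul1r ltrBrDl -ltrBrDr.
Qed.

Lemma bump_support k a b t : 0 < k -> bump k a b t != 0 ->
  a + k^-1 <= t <= b - k^-1.
Proof.
move=> k0; rewrite mulf_eq0 negb_or => /andP[/flat_neq0 + /flat_neq0].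
rewrite !subr_gt0 !(mulrC k) -!ltr_pdivrMr// !mul1r => h1 h2.
by apply/andP; split; lra.
Qed.

Lemma flat1_cvg1 (c : R) : 0 < c ->
  flat 1 (k.+1%:R * c - 1) @[k --> \oo] --> (1 : R).
Proof.
move=> c0; apply/cvgrPdist_lt => eps eps0; near=> k.
rewrite ger0_norm ?subr_ge0 ?flat1_le1//.
have s0 : eps^-1 < k.+1%:R * c - 1.
  rewrite ltrBrDr -ltr_pdivrMr// (lt_le_trans (truncnS_gt _))// ler_nat ltnS.
  by near: k; exact: nbhs_infty_ge.
have i0 : 0 < eps^-1 by rewrite invr_gt0.
have sp := lt_trans i0 s0.
rewrite /flat sp hornerE mul1r ltrBlDl -ltrBlDr.
apply: (@lt_le_trans _ _ (1 - (k.+1%:R * c - 1)^-1)); last exact: expR_ge1Dx.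
by rewrite ltrD2l ltrN2 invf_plt.
Unshelve. all: by end_near.
Qed.

Lemma bump_cvg1 a b t : a < t < b -> bump k.+1%:R a b t @[k --> \oo] --> (1 : R).
Proof.
move=> /andP[at_ tb]; rewrite -[X in _ --> X]mulr1.
by apply: cvgM; apply: flat1_cvg1; rewrite subr_gt0.
Qed.

Lemma bump_eq0 k a b t : 0 < k -> ~~ (a < t < b) -> bump k a b t = 0.
Proof.
move=> k0; apply: contraNeq => /(bump_support k0) /andP[h1 h2].
have ki : 0 < k^-1 by rewrite invr_gt0.
by apply/andP; split; lra.
Qed.

End smooth.

Section tensor.
Context {R : realType} {n : nat}.
Implicit Types (x a b c d : 'rV[R]_n) (eta : 'I_n -> R -> R) (i j : 'I_n).
Local Notation e := (delta_mx ord0).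
Local Notation mu := (lebesgue_rV (R := R) n).

(** Partial derivatives of such products are again such products, so smoothness reduces to one
    variable, and products of bumps approximate indicators of boxes. *)
Definition tensor eta x : R := \prod_i eta i (x ord0 i).

Definition tensor_derive i eta : 'I_n -> R -> R :=
  fun j => if j == i then (eta j)^`()%classic else eta j.

Lemma tensor_derive_smooth i eta : (forall j, smooth (eta j)) ->
  forall j, smooth (tensor_derive i eta j).
Proof.
by move=> se j; rewrite /tensor_derive; case: eqP => // _; exact: smooth_derive1.
Qed.

Lemma is_derive_tensor i eta x : (forall j, smooth (eta j)) ->
  is_derive x (e i) (tensor eta) (tensor (tensor_derive i eta) x).
Proof.
move=> se; apply/is_derive_line0.
pose c := \prod_(j | j != i) eta j (x ord0 j).
have E s : tensor eta (x + s *: e i) = eta i (1 * s + x ord0 i) * c.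
  rewrite /tensor (bigD1 i)//=; congr (eta i _ * _).
    by rewrite !mxE !eqxx mulr1 mul1r addrC.
  apply: eq_bigr => j ji.
  by rewrite !mxE eqxx (negPf ji) mulr0 addr0.
rewrite (_ : (fun s : R => tensor eta _) = fun s => eta i (1 * s + x ord0 i) * c);
  last by apply/funext => s; exact: E.
have -> : tensor (tensor_derive i eta) x = (eta i)^`()%classic (x ord0 i) * c.
  rewrite /tensor (bigD1 i)//= {1}/tensor_derive eqxx; congr (_ * _).
  by apply: eq_bigr => j ji; rewrite /tensor_derive (negPf ji).
have d1 : is_derive (0 : R) (1 : R) (fun s : R => eta i (1 * s + x ord0 i))
    ((eta i)^`()%classic (x ord0 i)).
  rewrite -[X in is_derive _ _ _ X]mulr1; apply: is_derive_affine.
  by rewrite mulr0 add0r; exact: smooth_is_derive.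
have := is_deriveM d1 (is_derive_cst c (0 : R) (1 : R)).
by rewrite scaler0 add0r [_ *: _]mulrC.
Qed.

Lemma continuous_at_prod (I : Type) (r : seq I) (F : I -> 'rV[R]_n -> R) x :
  (forall m, {for x, continuous (F m)}) ->
  {for x, continuous (fun y => \prod_(m <- r) F m y)}.
Proof.
move=> cF; elim: r => [|m r IHr].
  have -> : (fun y => \prod_(m <- [::]) F m y) = (fun=> 1).
    by apply/funext => y; rewrite big_nil.
  exact: continuous_at_cst.
have -> : (fun y => \prod_(l <- m :: r) F l y) =
    (fun y => F m y * \prod_(l <- r) F l y).
  by apply/funext => y; rewrite big_cons.
exact: continuous_atM.
Qed.

Lemma continuous_at_coord i x : {for x, continuous (fun y : 'rV[R]_n => y ord0 i)}.
Proof. exact: coord_continuous. Qed.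

Lemma continuous_tensor eta : (forall j, smooth (eta j)) ->
  continuous (tensor eta).
Proof.
move=> se x; apply: continuous_at_prod => j.
apply: (@continuous_at_chain _ _ (eta j) (fun y : 'rV[R]_n => y ord0 j)).
  exact: smooth_continuous.
exact: continuous_at_coord.
Qed.

Lemma partial_tensor i eta : (forall j, smooth (eta j)) ->
  partial i (tensor eta) = tensor (tensor_derive i eta).
Proof. by move=> se; apply/funext => x; have [_] := is_derive_tensor i x se. Qed.

Lemma Ck_tensor k eta : (forall j, smooth (eta j)) -> Ck k (tensor eta).
Proof.
elim: k eta => [|k IHk] eta se.
  by split=> //; exact: continuous_tensor.
split; first exact: continuous_tensor.
move=> i; split; first by move=> x; have [] := is_derive_tensor i x se.
by rewrite partial_tensor//; apply: IHk; exact: tensor_derive_smooth.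
Qed.

Definition cbox a b : set 'rV[R]_n :=
  [set x | forall i, a ord0 i <= x ord0 i <= b ord0 i].

Lemma compact_cbox a b : compact (cbox a b).
Proof.
have := @rV_compact R n (fun i => `[a ord0 i, b ord0 i]%classic)
  (fun i => @segment_compact R _ _).
congr compact; apply/seteqP; split=> x /= h i; have := h i; rewrite /= in_itv//=.
Qed.

Lemma compactly_contained_cbox (A U : set 'rV[R]_n) a b :
  A `<=` cbox a b -> cbox a b `<=` U -> compactly_contained A U.
Proof.
move=> Aab abU; suff sub : closure A `<=` cbox a b.
  split; last exact: subset_trans abU.
  exact: (subclosed_compact (@closed_closure _ A) (compact_cbox (a := a) (b := b)) sub).
rewrite [X in _ `<=` X](closure_id _).1; first exact: closureS.
apply: compact_closed; last exact: compact_cbox.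
exact: norm_hausdorff.
Qed.

Lemma tensor_support eta a b :
  (forall i t, eta i t != 0 -> a ord0 i <= t <= b ord0 i) ->
  [set x | tensor eta x != 0] `<=` cbox a b.
Proof. by move=> etaab x /= /prodf_neq0 H i; apply: etaab; exact: H. Qed.

Lemma test_function_tensor eta a b (U : set 'rV[R]_n) :
  (forall j, smooth (eta j)) ->
  (forall i t, eta i t != 0 -> a ord0 i <= t <= b ord0 i) ->
  cbox a b `<=` U -> test_function U (tensor eta).
Proof.
move=> se etaab abU; split; first by move=> k; exact: Ck_tensor.
exact: compactly_contained_cbox (tensor_support etaab) abU.
Qed.

Lemma cvg_prod1 (I : Type) (r : seq I) (F : I -> nat -> R) :
  (forall m, F m k @[k --> \oo] --> (1 : R)) ->
  \prod_(m <- r) F m k @[k --> \oo] --> (1 : R).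
Proof.
move=> F1; elim: r => [|m r IHr].
  have -> : (fun k => \prod_(m <- [::]) F m k) = (fun=> 1).
    by apply/funext => k; rewrite big_nil.
  exact: cvg_cst.
have -> : (fun k => \prod_(l <- m :: r) F l k) =
    (fun k => F m k * \prod_(l <- r) F l k).
  by apply/funext => k; rewrite big_cons.
have := cvgM (F1 m) IHr; rewrite mulr1; exact.
Qed.

(** No sign is imposed, so that the class is stable under [tensor_derive]; the gap between [l, h]
    and the faces of the box leaves room for small translations. *)
Definition bump_in a b eta := (forall j, smooth (eta j)) /\
  exists l h : 'rV[R]_n, (forall i, a ord0 i < l ord0 i /\ h ord0 i < b ord0 i) /\
    forall i t, eta i t != 0 -> l ord0 i <= t <= h ord0 i.

Lemma bump_in_test a b eta : bump_in a b eta ->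
  test_function (box a b) (tensor eta).
Proof.
move=> [se [l [h [lh etalh]]]]; apply: test_function_tensor se etalh _.
move=> x lxh i; have [al hb] := lh i; have /andP[lx xh] := lxh i.
by rewrite (lt_le_trans al lx) (le_lt_trans xh hb).
Qed.

Lemma bump_in_derive a b eta i : bump_in a b eta ->
  bump_in a b (tensor_derive i eta).
Proof.
move=> [se [l [h [lh etalh]]]]; split; first exact: tensor_derive_smooth.
exists l, h; split=> // j t; rewrite /tensor_derive; case: (j =P i) => _; last exact: etalh.
move=> dt; apply/negPn/negP; rewrite negb_and -!ltNge => /orP tlh.
suff d0 : is_derive t (1 : R) (eta j) 0.
  by move: dt; rewrite (is_derive_derive1 d0) eqxx.
apply: near_is_derive0.
have H s : ~~ (l ord0 j <= s <= h ord0 j) -> eta j s = 0.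
  by move=> sP; apply/eqP; apply: contraNT sP; exact: etalh.
case: tlh => tj; near=> s; apply: H; rewrite negb_and -!ltNge.
  by apply/orP; left; near: s; exact: lt_nbhsl.
by apply/orP; right; near: s; exact: lt_nbhsr.
Unshelve. all: by end_near.
Qed.

(** Products of bumps with growing k tend to the indicator of the smaller box and are bounded by 1,
    so [|f|] dominates. *)
Lemma Rintegral_box_eq0 (f : 'rV[R]_n -> R) a b a' b' :
  mu.-integrable (box a b) (EFin \o f) ->
  (forall i, a ord0 i <= a' ord0 i /\ b' ord0 i <= b ord0 i) ->
  (forall eta, bump_in a b eta ->
    \int[mu]_(x in box a b) (f x * tensor eta x) = 0) ->
  \int[mu]_(x in box a' b') f x = 0.
Proof.
move=> intf aabb f0.
have sub : box a' b' `<=` box a b.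
  move=> x H i; have [? ?] := aabb i; have /andP[? ?] := H i.
  by apply/andP; split; lra.
have mB := measurable_box a b; have mB' := measurable_box a' b'.
have mf : measurable_fun (box a b) f by apply/measurable_EFinP; case/integrableP: intf.
pose eta k i := bump k.+1%:R (a' ord0 i) (b' ord0 i).
have se k i : smooth (eta k i) by exact: smooth_bump.
have etaE k x : ~ box a' b' x -> tensor (eta k) x = 0.
  move=> /existsNP[i /negP xi]; rewrite /tensor (bigD1 i)//= {1}/eta.
  by rewrite bump_eq0 ?mul0r.
have eta01 k x : `|tensor (eta k) x| <= 1.
  rewrite ger0_norm ?prodr_ge0// => [|i _]; last exact: bump_ge0.
  by apply: prodr_ile1 => i _; rewrite bump_ge0 bump_le1.
have test k : bump_in a b (eta k).
  split=> //; exists (\row_i (a' ord0 i + k.+1%:R^-1)).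
  exists (\row_i (b' ord0 i - k.+1%:R^-1)); split => [i|i t].
    have k0 : 0 < (k.+1%:R^-1 : R) by rewrite invr_gt0.
    have [aa bb] := aabb i; rewrite !mxE; split.
      by rewrite (le_lt_trans aa)// ltrDl.
    by rewrite (lt_le_trans _ bb)// gtrBl.
  by move=> /bump_support; rewrite !mxE; apply.
have lim : \int[mu]_(x in box a b) (f x * tensor (eta k) x) @[k --> \oo] -->
    \int[mu]_(x in box a b) (f x * \1_(box a' b') x).
  apply: (@Rintegral_dominated_cvg _ _ _ _ _ (fun x => `|f x|)) => //.
  - move=> k; apply: measurable_funM => //.
    apply: (@measurable_funS _ _ _ _ setT) => //.
    apply: (continuous_rV_measurable openT) => x _.
    exact: continuous_tensor.
  - by apply: measurable_funM => //; exact: measurable_indic.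
  - apply: aeW => x xab; apply: cvgM; first exact: cvg_cst.
    rewrite indicE; case: (boolP (x \in box a' b')) => [|]; last first.
      rewrite notin_setE => nx; under eq_fun do rewrite etaE//.
      exact: cvg_cst.
    rewrite inE => xab'; rewrite /tensor.
    by apply: cvg_prod1 => i; apply: bump_cvg1; exact: xab'.
  - by apply: integrable_norm.
  - by apply: aeW => x k _; rewrite normrM ler_piMr.
have zero k : \int[mu]_(x in box a b) (f x * tensor (eta k) x) = 0 by exact: f0.
have : \int[mu]_(x in box a b) (f x * \1_(box a' b') x) = 0.
  move: lim; have -> : (fun k =>
      \int[mu]_(x in box a b) (f x * tensor (eta k) x)) = (fun=> 0).
    by apply/funext => k; exact: zero.
  by move=> lim; apply/esym; exact: (cvg_unique _ (cvg_cst _) lim).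
move=> <-; rewrite -{1}(setIidr sub) Rintegral_mkcondr.
apply: eq_Rintegral => x _; rewrite patchE indicE.
by case: ifP => _; rewrite ?mulr1 ?mulr0.
Qed.

(** The sets over which f integrates to 0 inside the box form a Dynkin class containing all boxes,
    hence contain all measurable sets; a function with zero integral over every measurable subset
    vanishes a.e. *)
Lemma fundamental_lemma (f : 'rV[R]_n -> R) a b :
  mu.-integrable (box a b) (EFin \o f) ->
  (forall eta, bump_in a b eta ->
    \int[mu]_(x in box a b) (f x * tensor eta x) = 0) ->
  {ae mu, forall x, box a b x -> f x = 0}.
Proof.
move=> intf f0; have mB := measurable_box a b.
have f0E A : measurable A -> (\int[mu]_(x in box a b `&` A) (f x)%:E)%E = 0%E.
  have intS E : measurable E -> E `<=` box a b ->
      mu.-integrable E (EFin \o f) by move=> mE Eab; exact: (integrableS mB mE Eab intf).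
  have fin0 E : measurable E -> E `<=` box a b ->
      \int[mu]_(x in E) f x = 0 -> (\int[mu]_(x in E) (f x)%:E)%E = 0%E.
    move=> mE Eab; rewrite /Rintegral => E0.
    by rewrite -[LHS]fineK ?E0//; apply: integrable_fin_num => //; exact: intS.
  rewrite [X in X -> _](_ : _ = (<<s [set A | exists a b : 'rV[R]_n, A = box a b] >> A));
    last by rewrite -measurable_rV_boxE.
  apply: (dynkin_induction (P := fun A => (\int[mu]_(x in box a b `&` A) (f x)%:E)%E = 0%E)
    measurable_rV_boxE).
  - by move=> _ _ [? [? ->]] [? [? ->]]; rewrite box_setI; do 2 eexists.
  - by rewrite setIT; apply: fin0 => //; apply: Rintegral_box_eq0 f0.
  - move=> _ [a' [b' ->]]; rewrite box_setI; apply: fin0.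
    + exact: measurable_box.
    + by rewrite -box_setI; exact: subIsetl.
    + apply: (Rintegral_box_eq0 intf _ f0) => i; rewrite !mxE.
      by rewrite le_max ge_min !lexx.
  - move=> S mS S0.
    have mBS : measurable (box a b `&` S) by exact: measurableI.
    have mBS' : measurable (box a b `&` ~` S).
      by apply: measurableI => //; exact: measurableC.
    have := @integral_setU _ _ _ mu (box a b `&` S) (box a b `&` ~` S)
      (EFin \o f) mBS mBS'.
    rewrite -setIUr setUv setIT S0 add0e => <-.
    + by apply: fin0 => //; apply: Rintegral_box_eq0 f0.
    + by case/integrableP: intf.
    + apply/disj_set2P; rewrite setIACA setICr setI0//.
  - move=> F mF tF F0; rewrite setI_bigcupr integral_bigcup.
    + by rewrite eseries0.
    + exact: trivIset_setIl.
    + by move=> k; exact: measurableI.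
    + apply: intS; last by rewrite -setI_bigcupr; exact: subIsetl.
      by apply: bigcup_measurable => k _; exact: measurableI.
have := @integral_ae_eq _ _ _ mu _ mB (cst 0%E) (EFin \o f) intf (measurable_cst _).
move=> H; have {}H : ae_eq mu (box a b) (EFin \o f) (cst 0%E).
  apply: H => E Eab mE; rewrite integral0 -(setIidr Eab); exact: f0E.
by apply: filterS H => x H xab; have [] := H xab.
Qed.

End tensor.

(** * Translations of test functions *)

Section translate.
Context {R : realType} {n : nat}.
Implicit Types (x v : 'rV[R]_n) (w : set 'rV[R]_n).
Local Notation e := (delta_mx ord0).
Local Notation mu := (lebesgue_rV (R := R) n).

Lemma real_integrableZ w (c : R) (f : 'rV[R]_n -> R) : measurable w ->
  mu.-integrable w (EFin \o f) -> mu.-integrable w (EFin \o (fun x => c * f x)).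
Proof. by move=> mw /(integrableZl mw c); exact: eq_integrable. Qed.

Lemma real_integrableD w (f g : 'rV[R]_n -> R) : measurable w ->
  mu.-integrable w (EFin \o f) -> mu.-integrable w (EFin \o g) ->
  mu.-integrable w (EFin \o (fun x => f x + g x)).
Proof.
move=> mw i1 i2; have := integrableD mw i1 i2.
exact: eq_integrable.
Qed.

Lemma real_integrableB w (f g : 'rV[R]_n -> R) : measurable w ->
  mu.-integrable w (EFin \o f) -> mu.-integrable w (EFin \o g) ->
  mu.-integrable w (EFin \o (fun x => f x - g x)).
Proof.
move=> mw i1 i2; have := integrableB mw i1 i2.
exact: eq_integrable.
Qed.

Lemma integrable_mul_bounded w (u f : 'rV[R]_n -> R) (C : R) : measurable w ->
  mu.-integrable w (EFin \o u) -> measurable_fun w f ->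
  (forall x, w x -> `|f x| <= C) ->
  mu.-integrable w (EFin \o (fun x => u x * f x)).
Proof.
move=> mw iu mf fC.
have mu_ : measurable_fun w u by apply/measurable_EFinP; case/integrableP: iu.
apply: (@le_integrable _ _ _ mu _ mw _ (EFin \o (fun x => C * `|u x|))).
- by apply/measurable_EFinP; apply: measurable_funM.
- move=> x wx /=; rewrite lee_fin normrM [leRHS]ger0_norm.
    by rewrite mulrC ler_wpM2r// fC.
  by rewrite mulr_ge0// (le_trans _ (fC x wx)).
- by apply: real_integrableZ => //; exact: integrable_norm.
Qed.

Lemma measurable_continuous w (f : 'rV[R]_n -> R) : measurable w ->
  continuous f -> measurable_fun w f.
Proof.
move=> mw cf; apply: (@measurable_funS _ _ _ _ setT) => //.
exact: (continuous_rV_measurable openT (fun x _ => cf x)).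
Qed.

(** The translation acts on the smooth factor, so the integral is differentiable in t although u is
    merely integrable; a multiple of |u| is the majorant. *)
Lemma is_derive_translate w (u f df : 'rV[R]_n -> R) (i : 'I_n) (C C' t : R) :
  measurable w -> mu.-integrable w (EFin \o u) ->
  continuous f -> (forall x, `|f x| <= C) ->
  (forall x, is_derive x (e i) f (df x)) -> (forall x, `|df x| <= C') ->
  is_derive t (1 : R)
    (fun t : R => \int[mu]_(x in w) (u x * f (x + t *: e i)))
    (\int[mu]_(x in w) (u x * df (x + t *: e i))).
Proof.
move=> mw iu cf fC fdf dfC.
pose F (s : R) x := u x * f (x + s *: e i).
have tI : `]t - 1, t + 1[%classic t by rewrite /= in_itv/= ltrDl gtrBl ltr01.
have cfs s : continuous (fun x : 'rV[R]_n => f (x + s *: e i)).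
  by move=> x; apply/continuous_at_shift/cf.
have intF s : `]t - 1, t + 1[%classic s -> mu.-integrable w (EFin \o F s).
  move=> _; apply: (@integrable_mul_bounded _ _ _ C) => //.
  exact: measurable_continuous.
have dF (s : R) x : is_derive s (1 : R) (F ^~ x) (u x * df (x + s *: e i)).
  have d1 := (is_derive_line f x (e i) s _).1 (fdf _).
  exact: (is_deriveZ (u x) d1).
have derF s x : `]t - 1, t + 1[%classic s -> w x -> derivable (F ^~ x) s 1.
  by move=> _ _; have [] := dF s x.
pose G x := C' * `|u x|.
have C'0 : 0 <= C' by exact: le_trans (dfC 0).
have G0 x : 0 <= G x by rewrite mulr_ge0.
have iG : mu.-integrable w (EFin \o G).
  by apply: real_integrableZ => //; exact: integrable_norm.
have FG s x : `]t - 1, t + 1[%classic s -> w x -> `|partial1of2 F s x| <= G x.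
  move=> _ _; rewrite /partial1of2 (is_derive_derive1 (dF s x)) normrM mulrC.
  by rewrite ler_wpM2r.
have := differentiation_under_integral mw tI intF derF G0 iG FG.
rewrite derive1E => E; split.
  exact: (derivable_under_integral mw tI intF derF G0 iG FG).
rewrite E; apply: eq_Rintegral => x _.
by rewrite /partial1of2 (is_derive_derive1 (dF t x)).
Qed.

(** The factor 1 gives the argument the form c * x + d expected by [smooth_affine] and
    [is_derive_affine]. *)
Definition bump_shift (v : 'rV[R]_n) (eta : 'I_n -> R -> R) : 'I_n -> R -> R :=
  fun j s => eta j (1 * s + v ord0 j).

Lemma tensor_bump_shift v eta x : tensor (bump_shift v eta) x = tensor eta (x + v).
Proof. by apply: eq_bigr => j _; rewrite /bump_shift mul1r mxE. Qed.

Lemma bump_in_shift a b (eta : 'I_n -> R -> R) : bump_in a b eta ->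
  exists2 tau : R, 0 < tau & forall v, `|v| <= tau -> bump_in a b (bump_shift v eta).
Proof.
move=> [se [l [h [lh etalh]]]].
pose tau := \big[Num.min/1]_(i < n)
  (Num.min (l ord0 i - a ord0 i) (b ord0 i - h ord0 i) / 2).
have tau0 : 0 < tau.
  apply/bigmin_gtP; split=> // i _; have [? ?] := lh i.
  by rewrite divr_gt0// lt_min !subr_gt0; apply/andP.
have tau_le i : tau < l ord0 i - a ord0 i /\ tau < b ord0 i - h ord0 i.
  have : tau <= Num.min (l ord0 i - a ord0 i) (b ord0 i - h ord0 i) / 2.
    exact: bigmin_le_cond.
  have [? ?] := lh i.
  by rewrite ler_pdivlMr// le_min => /andP[? ?]; split; lra.
exists tau => // v vtau; split; first by move=> j; exact: smooth_affine.
exists (l - v), (h - v); split.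
  move=> i; rewrite !mxE; have [? ?] := tau_le i.
  by have := le_trans (coord_le_norm v i) vtau; rewrite ler_norml => /andP[? ?]; split; lra.
move=> i s /etalh; rewrite !mxE mul1r.
by rewrite lerBlDr lerBrDr.
Qed.

Lemma bump_shift_derive v i eta : (forall j, smooth (eta j)) ->
  tensor_derive i (bump_shift v eta) = bump_shift v (tensor_derive i eta).
Proof.
move=> se; apply/funext => j; rewrite /tensor_derive /bump_shift.
case: eqP => // _; apply/funext => s.
apply: is_derive_derive1; rewrite -[X in is_derive _ _ _ X]mulr1.
apply: is_derive_affine; exact: smooth_is_derive.
Qed.

(** Both the bump and its translate are supported in the box, so both integrals extend to the whole
    space, where translation invariance applies. *)
Lemma Rintegral_bump_shift a b eta (u : 'rV[R]_n -> R) v :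
  bump_in a b eta -> bump_in a b (bump_shift (- v) eta) ->
  (forall x, box a b x -> {for x, continuous u}) ->
  (forall x, box a b x -> {for x + v, continuous u}) ->
  \int[mu]_(x in box a b) (u x * tensor eta (x - v)) =
  \int[mu]_(x in box a b) (u (x + v) * tensor eta x).
Proof.
move=> eb eb' uC uvC; have [se _] := eb; have [_ etaw] := bump_in_test eb.
have [_ etaw'] := bump_in_test eb'.
have ct : continuous (tensor eta) by exact: continuous_tensor.
have ct' : continuous (tensor (bump_shift (- v) eta)).
  by apply: continuous_tensor; case: eb'.
have uvC' x : box a b x -> {for x, continuous (fun y : 'rV[R]_n => u (y + v))}.
  by move=> wx; apply/continuous_at_shift/uvC.
have i1 := mul_support_integrable (open_box (a := a) (b := b)) measurableT
  etaw' ct' uC.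
have i2 := mul_support_integrable (open_box (a := a) (b := b)) measurableT
  etaw ct uvC'.
pose F x := tensor (bump_shift (- v) eta) x * u x.
transitivity (\int[mu]_x F x).
  rewrite -(@Rintegral_support _ _ (box a b) F); last first.
    move=> x; rewrite mulf_eq0 negb_or => /andP[H _].
    by apply: etaw'.2; exact: subset_closure.
  by apply: eq_Rintegral => x _; rewrite mulrC /F tensor_bump_shift.
have FE : (fun x => F (x + v)) = fun x => tensor eta x * u (x + v).
  by apply/funext => x; rewrite /F tensor_bump_shift addrK.
rewrite -(Rintegral_rV_shift (v := v) i1); last by rewrite FE.
rewrite FE -(@Rintegral_support _ _ (box a b)); last first.
  move=> x; rewrite mulf_eq0 negb_or => /andP[H _].
  by apply: etaw.2; exact: subset_closure.
by apply: eq_Rintegral => x _; rewrite mulrC.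
Qed.

Lemma near_cvg_eq (f g : nat -> R) (l : R) :
  (\forall k \near \oo, f k = g k) -> f k @[k --> \oo] --> l ->
  g k @[k --> \oo] --> l.
Proof.
move=> fg; apply: cvg_trans; apply: near_eq_cvg.
by apply: filterS fg => k ->.
Qed.

Lemma is_derive_seq (m : R -> R) (dm : R) (h : nat -> R) :
  is_derive (0 : R) (1 : R) m dm -> (forall k, h k != 0) ->
  h k @[k --> \oo] --> (0 : R) ->
  (m (h k) - m 0) / h k @[k --> \oo] --> dm.
Proof.
move=> [d1 d2] hn0 h0.
have H : (fun s : R => s^-1 *: (m (s *: 1 + 0) - m 0)) @ 0^' --> dm.
  by rewrite -d2; exact: d1.
have h0' : h k @[k --> \oo] --> 0^'.
  move=> A [eps /= eps0 epsA]; move/cvgrPdist_lt : h0 => /(_ eps eps0).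
  by apply: filterS => k; rewrite sub0r normrN => hk; apply: epsA => //=; rewrite sub0r normrN.
rewrite [X in X @ _ --> _](_ : _ =
    (fun s : R => s^-1 *: (m (s *: 1 + 0) - m 0)) \o h); first exact: cvg_comp H.
by apply/funext => k /=; rewrite addr0 [_ *: 1]mulr1 [_ *: _]mulrC.
Qed.

End translate.

(** * Weak gradients of convex functions *)

Section slopes.
Context {R : realType} {n : nat}.
Variables (A : set 'rV[R]_n.+1) (u : 'rV[R]_n.+1 -> R).
Hypothesis cA : forall x y (t : R), A x -> A y -> 0 <= t <= 1 ->
  A (t *: x + (1 - t) *: y).
Hypothesis cu : forall x y (t : R), A x -> A y -> 0 <= t <= 1 ->
  u (t *: x + (1 - t) *: y) <= t * u x + (1 - t) * u y.
Hypothesis oA : open A.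
Local Notation e := (delta_mx ord0).
Local Notation mu := (lebesgue_rV (R := R) n.+1).
Implicit Types (x y h v : 'rV[R]_n.+1).

Lemma convex_slope_le x v (s t : R) : A x -> A (x + t *: v) -> 0 < s <= t ->
  (u (x + s *: v) - u x) / s <= (u (x + t *: v) - u x) / t.
Proof.
move=> Ax At /andP[s0 st]; have t0 := lt_le_trans s0 st.
have st01 : 0 <= s / t <= 1 by rewrite divr_ge0 ?(ltW s0) ?(ltW t0)//= ler_pdivrMr// mul1r.
have := @convex_slope _ _ _ _ cu x (t *: v) (s / t) Ax At st01.
rewrite scalerA divfK ?gt_eqF// => H; rewrite ler_pdivrMr//.
by apply: (le_trans H); rewrite le_eqVlt; apply/orP; left; apply/eqP; field; rewrite gt_eqF.
Qed.

Variables (a b : 'rV[R]_n.+1) (rho M : R).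
Hypothesis rho0 : 0 < rho.
Hypothesis uM : forall x y, box a b x -> `|y - x| <= rho -> A y /\ `|u y| <= M.
Let w := box a b.

Let wA x : w x -> A x.
Proof. by move=> wx; have [|//] := @uM x x wx; rewrite subrr normr0 ltW. Qed.

Let uC x : A x -> {for x, continuous u}.
Proof. exact: convex_continuous. Qed.

Let mw : measurable w. Proof. exact: measurable_box. Qed.

Lemma box_u_integrable : mu.-integrable w (EFin \o u).
Proof.
apply: (@bounded_integrable _ _ _ _ M) => //.
- exact: lebesgue_rV_box_lty.
- apply: continuous_rV_measurable; first exact: open_box.
  by move=> x wx; apply: uC; exact: wA.
- by move=> x wx; have [|//] := @uM x x wx; rewrite subrr normr0 ltW.
Qed.

(** Along steps decreasing to 0 the slopes of a convex function decrease, and the Lipschitz bound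
    keeps them bounded, so they converge at every point of the box. The limit has the same integrals
    against test functions as [sg * G], and [fundamental_lemma] concludes. The sign [sg] treats
    right and left slopes together. *)
Lemma slope_cvg_weak (G : 'rV[R]_n.+1 -> R) (i : 'I_n.+1) (sg : R) :
  `|sg| = 1 -> mu.-integrable w (EFin \o G) ->
  (forall eta, bump_in a b eta ->
    \int[mu]_(x in w) (u x * tensor (tensor_derive i eta) x) =
    - \int[mu]_(x in w) (G x * tensor eta x)) ->
  {ae mu, forall x, w x ->
    (u (x + (rho / k.+1%:R) *: (sg *: e i)) - u x) / (rho / k.+1%:R)
      @[k --> \oo] --> sg * G x}.
Proof.
move=> sg1 iG weakG; pose r k : R := rho / k.+1%:R.
have r0 k : 0 < r k by rewrite divr_gt0.
have rrho k : r k <= rho by rewrite ler_pdivrMr// ler_peMr ?(ltW rho0)// ler1n.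
have rk0 : r k @[k --> \oo] --> (0 : R).
  rewrite -(mulr0 rho); apply: cvgM; first exact: cvg_cst.
  exact: cvg_harmonic.
pose v : 'rV[R]_n.+1 := sg *: e i.
have vn (s : R) : `|s *: v| = `|s| by rewrite scalerA norm_delta normrM sg1 mulr1.
have rvn k : `|r k *: v| <= rho by rewrite vn gtr0_norm.
pose q k x := (u (x + r k *: v) - u x) / r k.
have Arv k x : w x -> A (x + r k *: v).
  by move=> wx; have [|//] := @uM x (x + r k *: v) wx; rewrite addrC addKr.
have qL k x : w x -> `|q k x| <= 2 * M / rho.
  move=> wx; rewrite /q normrM normfV (gtr0_norm (r0 k)) ler_pdivrMr//.
  have := @convex_lipschitz _ _ _ _ cu x rho M (r k *: v) rho0 (fun y => @uM x y wx) (rvn k).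
  by rewrite vn (gtr0_norm (r0 k)).
have qcvg x : w x -> cvgn (q ^~ x).
  move=> wx; apply: nonincreasing_is_cvgn.
    move=> k l kl; apply: convex_slope_le; [exact: wA|exact: Arv|].
    rewrite r0/= ler_pM2l// lef_pV2 ?posrE ?ltr0n//.
    by rewrite ler_nat.
  exists (- (2 * M / rho)) => _ [k _ <-].
  by have := qL k x wx; rewrite ler_norml => /andP[].
pose g x : R := limn (q ^~ x).
have gq x : w x -> q k x @[k --> \oo] --> g x by exact: qcvg.
have mq k : measurable_fun w (q k).
  apply: measurable_funM => //; apply: measurable_funB.
    apply: continuous_rV_measurable; first exact: open_box.
    by move=> x wx; apply/continuous_at_shift/uC/Arv.
  apply: continuous_rV_measurable; first exact: open_box.
  by move=> x wx; apply/uC/wA.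
have mg : measurable_fun w g.
  by apply: (measurable_fun_cvg mq) => x wx; exact: gq.
have woo : (mu w < +oo)%E by exact: lebesgue_rV_box_lty.
have gL x : w x -> `|g x| <= 2 * M / rho.
  move=> wx; have H : `|q k x| @[k --> \oo] --> `|g x| by apply: cvg_norm; exact: gq.
  by apply: (cvgr_to_le H); apply: nearW => k; exact: qL.
have ig : mu.-integrable w (EFin \o g) by exact: bounded_integrable gL.
have iu := box_u_integrable.
have weakg eta : bump_in a b eta ->
    \int[mu]_(x in w) (g x * tensor eta x) =
    - sg * \int[mu]_(x in w) (u x * tensor (tensor_derive i eta) x).
  move=> ebump; have [se _] := ebump; have [_ etaw] := bump_in_test ebump.
  have ct : continuous (tensor eta) by exact: continuous_tensor.
  have [s s0 ets] := compactly_contained_box etaw.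
  have [C C0 eC] := continuous_support_bounded ct ets.
  have mt : measurable_fun w (tensor eta) by exact: measurable_continuous.
  have dbump := bump_in_derive i ebump; have [sde _] := dbump.
  have cdt : continuous (tensor (tensor_derive i eta)) by exact: continuous_tensor.
  have [s' s'0 dets] := compactly_contained_box (bump_in_test dbump).2.
  have [C' C'0 deC] := continuous_support_bounded cdt dets.
  have [tau tau0 etau] := bump_in_shift ebump.
  pose m (t : R) := \int[mu]_(x in w) (u x * tensor eta (x + t *: e i)).
  have dm : is_derive (0 : R) (1 : R) m
      (\int[mu]_(x in w) (u x * tensor (tensor_derive i eta) x)).
    have := is_derive_translate 0 mw iu ct eC (fun x => is_derive_tensor i x se) deC.
    congr is_derive; apply: eq_Rintegral => x _.
    by rewrite scale0r addr0.
  have hk0 : (- sg * r k) @[k --> \oo] --> (0 : R).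
    rewrite -(mulr0 (- sg)); apply: cvgM; first exact: cvg_cst.
    exact: rk0.
  have sgn0 : sg != 0 by rewrite -normr_gt0 sg1.
  have hkn k : - sg * r k != 0 by rewrite mulf_neq0 ?oppr_eq0// gt_eqF.
  have lim1 := is_derive_seq dm hkn hk0.
  have lim2 : \int[mu]_(x in w) (q k x * tensor eta x) @[k --> \oo] -->
      \int[mu]_(x in w) (g x * tensor eta x).
    apply: (@Rintegral_dominated_cvg _ _ _ _ _ (fun=> 2 * M / rho * C)) => //.
    - by move=> k; exact: measurable_funM.
    - exact: measurable_funM.
    - by apply: aeW => x wx; apply: cvgM; [exact: gq|exact: cvg_cst].
    - by apply: (@bounded_integrable _ _ _ _ `|2 * M / rho * C|).
    - by apply: aeW => x k wx; rewrite normrM ler_pM// qL.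
  (* Moving u forward by r_k v moves the test function backward, hence the increment -sg r_k of [m].
     The equality holds once r_k <= tau, when the shifted bump still lies in the box. *)
  suff E : \forall k \near \oo, - sg * ((m (- sg * r k) - m 0) / (- sg * r k)) =
      \int[mu]_(x in w) (q k x * tensor eta x).
    have lim3 := near_cvg_eq E (cvgM (cvg_cst (- sg)) lim1).
    exact: (cvg_unique _ lim2 (lim3 _ _)).
  near=> k.
  have sg2 : sg * sg = 1.
    by rewrite -expr2 -real_normK ?num_real// sg1 expr1n.
  have -> : - sg * ((m (- sg * r k) - m 0) / (- sg * r k)) =
      (m (- sg * r k) - m 0) / r k by field; rewrite sgn0 gt_eqF.
  have rt : r k <= tau.
    near: k; move/cvgrPdist_le : rk0 => /(_ tau tau0); apply: filterS => k.
    by rewrite sub0r normrN => /(le_trans (ler_norm _)).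
  pose hv := r k *: v.
  have hvE : (- sg * r k) *: e i = - hv.
    by rewrite /hv /v scalerA -scaleNr; congr (_ *: _); ring.
  have hvtau : `|- hv| <= tau by rewrite normrN /hv vn gtr0_norm.
  have uw x : w x -> {for x, continuous u} by move=> wx; apply/uC/wA.
  have uhv x : w x -> {for x + hv, continuous u} by move=> wx; apply/uC/Arv.
  have mk : m (- sg * r k) = \int[mu]_(x in w) (u (x + hv) * tensor eta x).
    by rewrite /m hvE; exact: Rintegral_bump_shift ebump (etau _ hvtau) uw uhv.
  have iuh : mu.-integrable w (EFin \o (fun x => u (x + hv) * tensor eta x)).
    have i2 := mul_support_integrable (open_box (a := a) (b := b)) mw etaw ct
      (fun x wx => continuous_at_shift (uhv x wx)).
    move: i2.
    by apply: eq_integrable => // x _; rewrite /= mulrC.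
  have iut : mu.-integrable w (EFin \o (fun x => u x * tensor eta x)).
    by apply: integrable_mul_bounded (fun x _ => eC x).
  have m0E : m 0 = \int[mu]_(x in w) (u x * tensor eta x).
    by apply: eq_Rintegral => x _; rewrite scale0r addr0.
  rewrite mk m0E -RintegralB// mulrC -RintegralZl//; last first.
    exact: real_integrableB.
  by apply: eq_Rintegral => x _; rewrite /q -/hv; ring.
have : {ae mu, forall x, w x -> g x - sg * G x = 0}.
  apply: fundamental_lemma.
  - by apply: real_integrableB => //; exact: real_integrableZ.
  - move=> eta ebump; have [se _] := ebump; have [_ etaw] := bump_in_test ebump.
    have ct : continuous (tensor eta) by exact: continuous_tensor.
    have [s s0 ets] := compactly_contained_box etaw.
    have [C C0 eC] := continuous_support_bounded ct ets.
    have mt : measurable_fun w (tensor eta) by exact: measurable_continuous.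
    have igt := integrable_mul_bounded mw ig mt (fun x _ => eC x).
    have iGt := integrable_mul_bounded mw iG mt (fun x _ => eC x).
    transitivity (\int[mu]_(x in w) (g x * tensor eta x) -
        sg * \int[mu]_(x in w) (G x * tensor eta x)).
      rewrite -RintegralZl// -RintegralB//.
        by apply: eq_Rintegral => x _; ring.
      exact: real_integrableZ.
    by rewrite weakg// weakG// mulrNN subrr.
apply: filterS => x H wx; have := gq x wx.
by move: (H wx) => /eqP; rewrite subr_eq0 => /eqP ->.
Unshelve. all: by end_near.
Qed.

End slopes.

Section good_points.
Context {R : realType} {n : nat}.
Variables (A : set 'rV[R]_n.+1) (u : 'rV[R]_n.+1 -> R).
Hypothesis cA : forall x y (t : R), A x -> A y -> 0 <= t <= 1 ->
  A (t *: x + (1 - t) *: y).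
Hypothesis cu : forall x y (t : R), A x -> A y -> 0 <= t <= 1 ->
  u (t *: x + (1 - t) *: y) <= t * u x + (1 - t) * u y.
Hypothesis oA : open A.
Variables (a b : 'rV[R]_n.+1) (rho M : R).
Hypothesis rho0 : 0 < rho.
Hypothesis uM : forall x y, box a b x -> `|y - x| <= rho -> A y /\ `|u y| <= M.
Local Notation e := (delta_mx ord0).
Local Notation mu := (lebesgue_rV (R := R) n.+1).

(** One slope within eps of the limit is enough: slopes of a convex function increase with the step,
    so the bound at step [r] passes to all shorter steps. *)
Lemma slope_upper_bound x (d : R) (sg : R) (i : 'I_n.+1) (eps : R) : box a b x ->
  `|sg| = 1 -> 0 < eps ->
  (u (x + (rho / k.+1%:R) *: (sg *: e i)) - u x) / (rho / k.+1%:R)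
      @[k --> \oo] --> sg * d ->
  exists2 s0 : R, 0 < s0 & forall s : R, 0 <= s <= s0 ->
    u (x + (s * sg) *: e i) - u x <= (s * sg) * d + eps * s.
Proof.
move=> xab sg1 eps0 /cvgrPdist_lt/(_ eps eps0)[k _ /(_ k (leqnn k))].
set r := rho / k.+1%:R => H.
have r0 : 0 < r by rewrite divr_gt0.
have rrho : r <= rho by rewrite ler_pdivrMr// ler_peMr ?(ltW rho0)// ler1n.
have Ax : A x by have [|//] := @uM x x xab; rewrite subrr normr0 ltW.
have Ar : A (x + r *: (sg *: e i)).
  have [|//] := @uM x (x + r *: (sg *: e i)) xab.
  by rewrite addrC addKr scalerA norm_delta normrM sg1 mulr1 gtr0_norm.
exists r => // s /andP[s0 sr]; have [->|sn0] := eqVneq s 0.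
  by rewrite !mul0r scale0r addr0 subrr mulr0 addr0.
have {}s0 : 0 < s by rewrite lt0r sn0.
have sr' : 0 < s <= r by rewrite s0.
have := @convex_slope_le _ _ _ _ cu x (sg *: e i) s r Ax Ar sr'.
rewrite scalerA ler_pdivrMr// => /le_trans; apply.
have -> : s * sg * d + eps * s = (sg * d + eps) * s by ring.
apply: ler_wpM2r; first exact: ltW.
by move: H; rewrite distrC ltr_norml => /andP[_ /ltW]; rewrite lerBlDl.
Qed.

(** Right slopes handle s >= 0 and left slopes s < 0; a.e. their limits are G_i and -G_i. *)
Lemma ae_good (G : 'rV[R]_n.+1 -> 'rV[R]_n.+1) :
  (forall i, mu.-integrable (box a b) (EFin \o (fun x => G x ord0 i))) ->
  (forall i eta, bump_in a b eta ->
    \int[mu]_(x in box a b) (u x * tensor (tensor_derive i eta) x) =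
    - \int[mu]_(x in box a b) (G x ord0 i * tensor eta x)) ->
  {ae mu, forall x, box a b x -> forall eps : R, 0 < eps ->
    exists2 s0 : R, 0 < s0 & forall i (s : R), `|s| <= s0 ->
      u (x + s *: e i) - u x <= s * G x ord0 i + eps * `|s|}.
Proof.
move=> iG wG; have N1 : `|-1 : R| = 1 by rewrite normrN1.
have P1 : `|1 : R| = 1 by rewrite normr1.
have H1 := filter_forall _ (fun i => slope_cvg_weak cA cu oA rho0 uM P1 (iG i) (wG i)).
have H2 := filter_forall _ (fun i => slope_cvg_weak cA cu oA rho0 uM N1 (iG i) (wG i)).
apply: filterS2 (H1 _) (H2 _) => x {}H1 {}H2 xab eps eps0.
have K1 i := slope_upper_bound xab P1 eps0 (H1 i xab).
have K2 i := slope_upper_bound xab N1 eps0 (H2 i xab).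
have /fin_all_exists[s1 s1P] : forall i : 'I_n.+1, exists s0 : R, 0 < s0 /\
    forall s : R, `|s| <= s0 ->
      u (x + s *: e i) - u x <= s * G x ord0 i + eps * `|s|.
  move=> i; have [r1 r10 r1P] := K1 i; have [r2 r20 r2P] := K2 i.
  exists (Num.min r1 r2); split; first by rewrite lt_min r10.
  move=> s; rewrite le_min => /andP[sr1 sr2]; have [s0|s0] := leP 0 s.
    by move: sr1; rewrite ger0_norm// => sr1; have := r1P s; rewrite mulr1 s0; apply.
  have := r2P (- s); rewrite mulrN1 opprK (ltr0_norm s0) oppr_ge0 (ltW s0); apply.
  by move: sr2; rewrite ltr0_norm.
exists (\big[Num.min/1]_i s1 i).
  by apply/bigmin_gtP; split=> // i _; have [] := s1P i.
move=> i s ss; have [_] := s1P i; apply; apply: (le_trans ss).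
exact: bigmin_le_cond.
Qed.

End good_points.

(** * Smooth convex approximation *)

Section smooth_convex_functions.
Context {R : realType} {n : nat}.
Implicit Types (x y v : 'rV[R]_n).
Local Notation e := (delta_mx ord0).

(* f is C^2 with gradient G and Hessian H; H x is positive semidefinite and
   bounded by its trace. *)
Definition smooth_convex (f : 'rV[R]_n -> R) (G : 'rV[R]_n -> 'rV[R]_n)
    (H : 'rV[R]_n -> 'I_n -> 'I_n -> R) :=
  [/\ [/\ continuous f, forall i, continuous (fun x => G x ord0 i) &
        forall i j, continuous (fun x => H x i j)],
      forall x i, is_derive x (e i) f (G x ord0 i),
      forall x i j, is_derive x (e j) (fun y => G y ord0 i) (H x i j),
      forall x v, 0 <= \sum_i \sum_j v ord0 i * v ord0 j * H x i j <=
        dotp v v * \sum_i H x i i &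
      forall x y, f x + dotp (G x) (y - x) <= f y].

Lemma sqr_dotp_le (v y : 'rV[R]_n) : dotp v y ^+ 2 <= dotp v v * dotp y y.
Proof.
have H z : dotp z y <= enorm z * enorm y by exact: dotp_le.
rewrite -!sqr_enorm -exprMn -[leLHS]real_normK ?num_real//.
rewrite lerXn2r ?nnegrE ?mulr_ge0 ?enorm_ge0// ler_norml; apply/andP; split; last exact: H.
rewrite lerNl; have := H (- v); rewrite -scaleN1r dotpZl enormZ normrN1 mul1r.
by rewrite mulN1r.
Qed.

Section weighted.
Variables (I : Type) (L : seq I) (W : I -> R) (xi : I -> 'rV[R]_n).
Hypothesis W0 : forall l, 0 <= W l.
Hypothesis W1 : \sum_(l <- L) W l = 1.

Lemma weighted_variance (z : I -> R) (m : R) : m = \sum_(l <- L) W l * z l ->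
  \sum_(l <- L) W l * (z l - m) ^+ 2 = \sum_(l <- L) W l * z l ^+ 2 - m ^+ 2.
Proof.
move=> mE; transitivity (\sum_(l <- L) (W l * z l ^+ 2 - 2 * m * (W l * z l) + m ^+ 2 * W l)).
  by apply: eq_bigr => l _; ring.
rewrite big_split/= sumrB -!mulr_sumr W1 -mE; ring.
Qed.

(** The matrix is the covariance of the vectors [xi l] under the weights [W]. Its quadratic form at
    v is the variance of <xi, v>, its trace is the mean of |xi - m|^2, and Cauchy-Schwarz compares
    the two. *)
Lemma weighted_covariance_bound (v : 'rV[R]_n) (m : 'rV[R]_n) :
  (forall i, m ord0 i = \sum_(l <- L) W l * xi l ord0 i) ->
  0 <= \sum_i \sum_j v ord0 i * v ord0 j *
      (\sum_(l <- L) W l * (xi l ord0 i * xi l ord0 j) - m ord0 i * m ord0 j) <=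
    dotp v v * \sum_i
      (\sum_(l <- L) W l * (xi l ord0 i * xi l ord0 i) - m ord0 i * m ord0 i).
Proof.
move=> mE.
have mv : dotp m v = \sum_(l <- L) W l * dotp (xi l) v.
  rewrite /dotp; under eq_bigr do rewrite mE mulr_suml.
  rewrite exchange_big/=; apply: eq_bigr => l _.
  by rewrite mulr_sumr; apply: eq_bigr => i _; rewrite mulrA.
have E1 : \sum_i \sum_j v ord0 i * v ord0 j *
      (\sum_(l <- L) W l * (xi l ord0 i * xi l ord0 j) - m ord0 i * m ord0 j) =
    \sum_(l <- L) W l * (dotp (xi l) v - dotp m v) ^+ 2.
  have sq (z : 'rV[R]_n) : dotp z v ^+ 2 =
      \sum_i \sum_j v ord0 i * v ord0 j * (z ord0 i * z ord0 j).
    rewrite expr2 {1}/dotp mulr_suml; apply: eq_bigr => i _.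
    by rewrite /dotp mulr_sumr; apply: eq_bigr => j _; ring.
  rewrite (weighted_variance mv) sq.
  under [X in _ = X - _]eq_bigr do rewrite sq mulr_sumr.
  rewrite [X in _ = X - _]exchange_big/= -sumrB; apply: eq_bigr => i _.
  under [X in _ = X - _]eq_bigr do rewrite mulr_sumr.
  rewrite [X in _ = X - _]exchange_big/= -sumrB; apply: eq_bigr => j _.
  rewrite mulrBr mulr_sumr; congr (_ - _); apply: eq_bigr => l _; ring.
have E2 : \sum_i (\sum_(l <- L) W l * (xi l ord0 i * xi l ord0 i) -
      m ord0 i * m ord0 i) =
    \sum_(l <- L) W l * dotp (xi l - m) (xi l - m).
  rewrite [RHS](eq_bigr (fun l => \sum_i W l * (xi l ord0 i - m ord0 i) ^+ 2)).
    rewrite exchange_big/=; apply: eq_bigr => i _.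
    rewrite (weighted_variance (mE i)) expr2; congr (_ - _).
  by move=> l _; rewrite /dotp mulr_sumr; apply: eq_bigr => i _; rewrite !mxE expr2.
rewrite E1 E2; apply/andP; split.
  by apply: sumr_ge0 => l _; rewrite mulr_ge0// sqr_ge0.
rewrite mulr_sumr; apply: ler_sum => l _.
rewrite [leRHS]mulrCA ler_wpM2l// -dotpBl mulrC; exact: sqr_dotp_le.
Qed.

End weighted.

Section lse.
Variables (L : seq ('rV[R]_n * R)) (N : R).
Hypothesis N0 : 0 < N.
Hypothesis L0 : L != [::].
Implicit Types (l : 'rV[R]_n * R) (g : 'rV[R]_n * R -> R).

Definition affine l x : R := dotp l.1 x + l.2.

(** A general coefficient [g] makes the family stable under differentiation: the derivative
    multiplies g by N times a slope coordinate. *)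
Definition expsum g x : R := \sum_(l <- L) g l * expR (N * affine l x).

(* The gradient of lse is the mean of the slopes l.1, and its Hessian N times
   their covariance, for the weights exp (N l(x)). *)
Definition lse x : R := N^-1 * ln (expsum (fun=> 1) x).
Definition lse_grad x : 'rV[R]_n :=
  \row_i (expsum (fun l => l.1 ord0 i) x / expsum (fun=> 1) x).
Definition lse_hess x (i j : 'I_n) : R :=
  N * (expsum (fun l => l.1 ord0 i * l.1 ord0 j) x / expsum (fun=> 1) x -
       lse_grad x ord0 i * lse_grad x ord0 j).

Lemma is_derive_expsum g x (i : 'I_n) :
  is_derive x (e i) (expsum g) (N * expsum (fun l => g l * l.1 ord0 i) x).
Proof.
rewrite /expsum; elim: L => [|l s IHs].
  rewrite big_nil mulr0 (_ : (fun y => _) = cst 0); first exact: is_derive_cst.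
  by apply/funext => y; rewrite big_nil.
rewrite big_cons mulrDr (_ : (fun y => _) = (fun y => g l * expR (N * affine l y) +
    \sum_(k <- s) g k * expR (N * affine k y))); last first.
  by apply/funext => y; rewrite big_cons.
apply: is_deriveD => //.
have da : is_derive x (e i) (fun y => N * affine l y) (N * l.1 ord0 i).
  apply/is_derive_line0.
  have -> : (fun s : R => N * affine l (x + s *: e i)) =
      (fun s => (N * l.1 ord0 i) * s + N * affine l x).
    apply/funext => t; rewrite /affine dotpDr dotpZr dotp_delta; ring.
  have := is_deriveD (is_deriveZ (N * l.1 ord0 i) (is_derive_id (0 : R) (1 : R)))
    (is_derive_cst (N * affine l x) (0 : R) (1 : R)).
  by rewrite addr0 [_ *: _]mulr1.
have de := @is_derive_chain _ _ expR (fun y => N * affine l y) x (e i) _ _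
  (is_derive_expR _) da.
have := is_deriveZ (g l) de; rewrite [_ *: _]/GRing.scale/=.
congr is_derive; ring.
Qed.

Lemma continuous_at_affine l x : {for x, continuous (affine l)}.
Proof.
apply: continuous_atD; last exact: continuous_at_cst.
apply: continuous_at_sum => i; apply: continuous_atM; first exact: continuous_at_cst.
exact: continuous_at_coord.
Qed.

Lemma continuous_expsum g x : {for x, continuous (expsum g)}.
Proof.
apply: continuous_at_sum => l; apply: continuous_atM; first exact: continuous_at_cst.
apply: (@continuous_at_chain _ _ expR (fun y => N * affine l y)).
  exact: continuous_expR.
apply: continuous_atM; [exact: continuous_at_cst|exact: continuous_at_affine].
Qed.

Lemma expsum1_gt0 x : 0 < expsum (fun=> 1) x.
Proof.
rewrite /expsum; case: L L0 => // l s _; rewrite big_cons ltr_pwDl//.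
  by rewrite mul1r expR_gt0.
by apply: sumr_ge0 => k _; rewrite mul1r expR_ge0.
Qed.

Let W x l : R := expR (N * affine l x) / expsum (fun=> 1) x.

Let W0 x l : 0 <= W x l.
Proof. by rewrite divr_ge0 ?expR_ge0// ltW// expsum1_gt0. Qed.

Let W1 x : \sum_(l <- L) W x l = 1.
Proof.
rewrite -mulr_suml; under eq_bigr do rewrite -[expR _]mul1r.
by rewrite divff// gt_eqF// expsum1_gt0.
Qed.

Let WE g x : expsum g x / expsum (fun=> 1) x = \sum_(l <- L) W x l * g l.
Proof. by rewrite mulr_suml; apply: eq_bigr => l _; rewrite -mulrA mulrC. Qed.

Lemma smooth_convex_lse : smooth_convex lse lse_grad lse_hess.
Proof.
have S0 x : expsum (fun=> 1) x != 0 by rewrite gt_eqF// expsum1_gt0.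
have S1 g x : expsum (fun l => 1 * g l) x = expsum g x.
  by apply: eq_bigr => l _; rewrite mul1r.
have cV x : {for x, continuous (fun y => (expsum (fun=> 1) y)^-1)}.
  apply: (@continuous_at_chain _ _ (fun t => t^-1) (expsum (fun=> 1))).
    exact: inv_continuous.
  exact: continuous_expsum.
have gradE i : (fun x => lse_grad x ord0 i) =
    fun x => expsum (fun l => l.1 ord0 i) x * (expsum (fun=> 1) x)^-1.
  by apply/funext => x; rewrite mxE.
have cG i x : {for x, continuous (fun x => lse_grad x ord0 i)}.
  by rewrite gradE; apply: continuous_atM; [exact: continuous_expsum|exact: cV].
have dS x i := is_derive_expsum (fun=> 1) x i.
have cf x : {for x, continuous lse}.
  apply: continuous_atM; first exact: continuous_at_cst.
  apply: (@continuous_at_chain _ _ (@ln R) (expsum (fun=> 1))).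
    by apply: continuous_ln; exact: expsum1_gt0.
  exact: continuous_expsum.
have cH i j x : {for x, continuous (fun x => lse_hess x i j)}.
  apply: continuous_atM; first exact: continuous_at_cst.
  apply: continuous_atD.
    by apply: continuous_atM; [exact: continuous_expsum|exact: cV].
  by apply: continuous_atN; apply: continuous_atM; exact: cG.
split.
- by split=> [x|i x|i j x]; [exact: cf|exact: cG|exact: cH].
- move=> x i.
  have d1 := @is_derive_chain _ _ (@ln R) (expsum (fun=> 1)) x (e i) _ _
    (is_derive1_ln (expsum1_gt0 x)) (dS x i).
  have := is_deriveZ N^-1 d1; rewrite [_ *: _]/GRing.scale/=.
  congr is_derive; rewrite mxE.
  rewrite (S1 (fun l => l.1 ord0 i)); field; rewrite S0 gt_eqF//.
- move=> x i j; rewrite gradE.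
  have dV : is_derive x (e j) (fun y => (expsum (fun=> 1) y)^-1)
      (- (expsum (fun=> 1) x) ^- 2 * (N * expsum (fun l => 1 * l.1 ord0 j) x)).
    apply: (@is_derive_chain _ _ (fun t => t^-1) (expsum (fun=> 1))) (dS x j).
    have := is_deriveV (S0 x) (is_derive_id (expsum (fun=> 1) x) (1 : R)).
    by rewrite [_ *: _]mulr1.
  have := is_deriveM (is_derive_expsum (fun l => l.1 ord0 i) x j) dV.
  rewrite /GRing.scale/=; congr is_derive; rewrite /lse_hess !mxE.
  rewrite (S1 (fun l => l.1 ord0 j)); field; exact: S0.
- move=> x v.
  have GE i : lse_grad x ord0 i = \sum_(l <- L) W x l * l.1 ord0 i.
    by rewrite mxE WE.
  have := @weighted_covariance_bound _ L (W x) (fun l => l.1) (W0 x) (W1 x) v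
    (lse_grad x) GE.
  have HE i j : lse_hess x i j = N * (\sum_(l <- L) W x l *
      (l.1 ord0 i * l.1 ord0 j) - lse_grad x ord0 i * lse_grad x ord0 j).
    by rewrite /lse_hess WE.
  have -> : \sum_i \sum_j v ord0 i * v ord0 j * lse_hess x i j =
      N * \sum_i \sum_j v ord0 i * v ord0 j * (\sum_(l <- L) W x l *
        (l.1 ord0 i * l.1 ord0 j) - lse_grad x ord0 i * lse_grad x ord0 j).
    rewrite mulr_sumr; apply: eq_bigr => i _; rewrite mulr_sumr.
    by apply: eq_bigr => j _; rewrite HE mulrCA.
  have -> : \sum_i lse_hess x i i = N * \sum_i (\sum_(l <- L) W x l *
        (l.1 ord0 i * l.1 ord0 i) - lse_grad x ord0 i * lse_grad x ord0 i).
    by rewrite mulr_sumr; apply: eq_bigr => i _; rewrite HE.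
  move=> /andP[h1 h2]; rewrite mulr_ge0 ?(ltW N0)//=.
  by rewrite [leRHS]mulrCA ler_wpM2l ?(ltW N0).
(* The tangent-plane inequality is Jensen's inequality for exp under the weights [W x]: exp t >= exp
   m (1 + t - m) is averaged over the increments [t l], whose mean is [m]. *)
- move=> x y; pose t l := N * dotp l.1 (y - x).
  pose m := N * dotp (lse_grad x) (y - x).
  have mE : m = \sum_(l <- L) W x l * t l.
    rewrite /m /dotp mulr_sumr.
    under eq_bigr do rewrite mxE WE mulr_suml mulr_sumr.
    rewrite exchange_big/=; apply: eq_bigr => l _.
    by rewrite /t /dotp !mulr_sumr; apply: eq_bigr => i _; ring.
  have Sy : expsum (fun=> 1) y = expsum (fun=> 1) x * \sum_(l <- L) W x l * expR (t l).
    rewrite mulr_sumr; apply: eq_bigr => l _; rewrite mul1r /W.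
    have -> : expR (N * affine l y) = expR (N * affine l x) * expR (t l).
      by rewrite -expRD; congr expR; rewrite /t /affine dotpBr; ring.
    by field; exact: S0.
  have em : expR m <= \sum_(l <- L) W x l * expR (t l).
    apply: (@le_trans _ _ (\sum_(l <- L) W x l * (expR m * (1 + (t l - m))))).
      rewrite le_eqVlt; apply/orP; left; apply/eqP.
      transitivity (expR m * ((1 - m) * \sum_(l <- L) W x l + \sum_(l <- L) W x l * t l)).
        by rewrite W1 -mE; ring.
      by rewrite mulr_sumr -big_split/= mulr_sumr; apply: eq_bigr => l _; ring.
    apply: ler_sum => l _; apply: ler_wpM2l => //.
    have -> : expR (t l) = expR m * expR (t l - m) by rewrite -expRD addrC subrK.
    by rewrite ler_pM2l ?expR_gt0// expR_ge1Dx.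
  have : expsum (fun=> 1) x * expR m <= expsum (fun=> 1) y.
    by rewrite Sy ler_pM2l// expsum1_gt0.
  rewrite -ler_ln ?posrE ?mulr_gt0 ?expR_gt0 ?expsum1_gt0//.
  rewrite lnM ?posrE ?expR_gt0 ?expsum1_gt0// expRK => H.
  rewrite /lse -(ler_pM2l N0) mulrDr !mulrA divff ?gt_eqF// !mul1r.
  exact: H.
Qed.

Lemma lse_ge l x : l \in L -> affine l x <= lse x.
Proof.
move=> lL; rewrite /lse mulrC ler_pdivlMr// mulrC -[leLHS]expRK.
rewrite ler_ln ?posrE ?expR_gt0 ?expsum1_gt0// /expsum.
rewrite (big_rem _ lL)/= mul1r lerDl.
by apply: sumr_ge0 => k _; rewrite mul1r expR_ge0.
Qed.

(** At most [size L] terms, each at most exp(N B): the soft maximum exceeds the maximum by at most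
    ln(size L)/N. *)
Lemma lse_le x (B : R) : (forall l, l \in L -> affine l x <= B) ->
  lse x <= B + ln (size L)%:R / N.
Proof.
move=> LB; have sL : 0 < (size L)%:R :> R.
  by rewrite ltr0n lt0n size_eq0.
rewrite /lse mulrC ler_pdivrMr// mulrDl divfK ?gt_eqF//.
rewrite -[B * N]expRK -lnM ?posrE ?expR_gt0//.
rewrite ler_ln ?posrE ?mulr_gt0 ?expR_gt0 ?expsum1_gt0//.
rewrite /expsum mulr_natr.
apply: (@le_trans _ _ (\sum_(l <- L) expR (B * N))).
  rewrite big_seq [leRHS]big_seq; apply: ler_sum => l lL.
  by rewrite mul1r ler_expR mulrC ler_wpM2r ?(ltW N0)// LB.
by rewrite big_const_seq count_predT iter_addr_0.
Qed.

End lse.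

End smooth_convex_functions.

Section approximation.
Context {R : realType} {n : nat}.
Variables (A : set 'rV[R]_n.+1) (u : 'rV[R]_n.+1 -> R).
Hypothesis cA : forall x y (t : R), A x -> A y -> 0 <= t <= 1 ->
  A (t *: x + (1 - t) *: y).
Hypothesis cu : forall x y (t : R), A x -> A y -> 0 <= t <= 1 ->
  u (t *: x + (1 - t) *: y) <= t * u x + (1 - t) * u y.
Hypothesis oA : open A.
Variables (a b : 'rV[R]_n.+1) (rho M : R).
Hypothesis rho0 : 0 < rho.
Hypothesis uM : forall x y, box a b x -> `|y - x| <= rho -> A y /\ `|u y| <= M.
Variable G : 'rV[R]_n.+1 -> 'rV[R]_n.+1.
Local Notation e := (delta_mx ord0).
Local Notation mu := (lebesgue_rV (R := R) n.+1).
Implicit Types (x y v : 'rV[R]_n.+1).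

Let wA x : box a b x -> A x.
Proof. by move=> wx; have [|//] := @uM x x wx; rewrite subrr normr0 ltW. Qed.

(* By convexity G x is then a subgradient of u at x. *)
Definition good x := forall eps : R, 0 < eps ->
  exists2 s0 : R, 0 < s0 & forall i (s : R), `|s| <= s0 ->
    u (x + s *: e i) - u x <= s * G x ord0 i + eps * `|s|.

Hypothesis aegood : {ae mu, forall x, box a b x -> good x}.

(** The exceptional set is null, whereas any small box around x has positive measure. *)
Lemma good_dense x (d : R) : box a b x -> 0 < d ->
  exists y, [/\ box a b y, good y & `|x - y| < d].
Proof.
move=> xab d0; apply: contrapT => noy.
pose c := \row_i Num.max (a ord0 i) (x ord0 i - d).
pose c' := \row_i Num.min (b ord0 i) (x ord0 i + d).
have cc' : forall i, c ord0 i < c' ord0 i.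
  move=> i; rewrite !mxE gt_max !lt_min; have /andP[h1 h2] := xab i.
  by rewrite (lt_trans h1 h2) (lt_trans h1)/= ?ltrDl// (lt_trans _ h2)/= ?gtrBl//
    (@lt_trans _ _ (x ord0 i)) ?gtrBl ?ltrDl.
have := lebesgue_rV_box_gt0 cc'.
have [N [mN N0 sub]] := aegood.
suff : (mu (box c c') <= mu N)%E by rewrite N0 => /le_lt_trans/[apply]; rewrite ltxx.
apply: le_measure; rewrite ?inE//; first exact: measurable_box.
move=> y yc; apply: sub => /= goody; apply: noy; exists y; split.
- move=> i; have := yc i; rewrite !mxE gt_max lt_min => /andP[/andP[-> _]].
  by move=> /andP[-> _].
- apply: goody => i; have := yc i; rewrite !mxE gt_max lt_min => /andP[/andP[-> _]].
  by move=> /andP[-> _].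
- apply/rV_norm_ltP => // i; have := yc i.
  rewrite !mxE gt_max lt_min ltr_norml => /andP[/andP[_ h1]] /andP[_ h2].
  by apply/andP; split; lra.
Qed.

Lemma good_subgradient x : box a b x -> good x ->
  forall y, A y -> u x + dotp (G x) (y - x) <= u y.
Proof. by move=> /wA Ax gx y Ay; apply: (convex_subgradient cA cu oA Ax gx). Qed.

Lemma good_gradient_bound x i : box a b x -> good x ->
  `|G x ord0 i| <= 2 * M / rho.
Proof.
move=> xab gx; have sub := good_subgradient xab gx.
have [|Ax Mx] := @uM x x xab; first by rewrite subrr normr0 ltW.
have side (s : R) : `|s| = rho -> s * G x ord0 i <= 2 * M.
  move=> sr; have [|Ay My] := @uM x (x + s *: e i) xab.
    by rewrite addrC addKr norm_delta sr.
  have := sub _ Ay; rewrite addrAC subrr add0r dotpZr dotp_delta.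
  by move: Mx My; rewrite !ler_norml => /andP[? ?] /andP[? ?]; lra.
have s1 := side rho (gtr0_norm rho0).
have s2 : - rho * G x ord0 i <= 2 * M by apply: side; rewrite normrN gtr0_norm.
by rewrite ler_norml lerNl !ler_pdivlMr// !(mulrC _ rho); apply/andP; split; lra.
Qed.

Variables (a' b' : 'rV[R]_n.+1).
Hypothesis sub_ab : cbox a' b' `<=` box a b.
Hypothesis ne_ab : cbox a' b' !=set0.

(** By compactness finitely many good points are d-dense in the closed box. The tangent plane at
    such a point y loses at most [K * d] at a point x within d: [L] bounds both the slope of u
    between x and y and each coordinate of G y. As these planes are minorants on all of [A], the
    upper estimate of their soft maximum holds on [A], and so also far from the box. *)
Lemma convex_smooth_approx (eps : R) : 0 < eps -> exists f Gf Hf,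
  [/\ smooth_convex f Gf Hf, forall y, A y -> f y <= u y + eps &
      forall x, cbox a' b' x -> u x - eps <= f x].
Proof.
move=> eps0; pose L := 2 * M / rho; pose K : R := (L + n.+1%:R * L).
have L0 : 0 <= L.
  have [z /sub_ab zab] := ne_ab; have [|_ Mz] := @uM z z zab.
    by rewrite subrr normr0 ltW.
  by rewrite divr_ge0 ?(ltW rho0)// mulr_ge0// (le_trans _ Mz).
have K0 : 0 <= K by rewrite addr_ge0// mulr_ge0.
(* [d <= rho] makes [convex_lipschitz] applicable, [K * d <= eps] bounds the loss, and K + 1
   excludes a zero denominator. *)
pose d := Num.min rho (eps / (K + 1)).
have d0 : 0 < d by rewrite lt_min rho0 divr_gt0// ltr_wpDl.
have cc : cover_compact (cbox a' b') by rewrite -compact_cover; exact: compact_cbox.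
have oB y : open (ball y d) by exact: ball_open.
have cov : cbox a' b' `<=` cover [set y | box a b y /\ good y] (fun y => ball y d).
  move=> x /sub_ab xab; have [y [yab gy xy]] := good_dense xab d0.
  by exists y => //; rewrite mx_norm_ball /ball_/= distrC.
have [D' D'sub D'cov] := cc _ _ _ (fun y _ => oB y) cov.
pose T := [seq (G y, u y - dotp (G y) y) | y <- finmap.enum_fset D'].
have goodD y : y \in finmap.enum_fset D' -> box a b y /\ good y.
  by move=> /D'sub; rewrite inE.
have T0 : T != [::].
  have [z zab] := ne_ab; have [y /= yD _] := D'cov _ zab.
  have {}yD : y \in finmap.enum_fset D' by [].
  by rewrite -size_eq0 size_map size_eq0; apply: contraTneq yD => ->.
(* This makes the excess ln(size T)/N of the soft maximum at most eps; the summand 1 keeps N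
   positive when T is a singleton. *)
pose N := ln (size T)%:R / eps + 1.
have lnT : 0 <= ln ((size T)%:R : R) by rewrite ln_ge0// ler1n lt0n size_eq0.
have N0 : 0 < N by rewrite ltr_wpDl// divr_ge0// ltW.
exists (lse T N), (lse_grad T N), (lse_hess T N); split.
- exact: smooth_convex_lse.
- move=> y Ay; apply: (le_trans (lse_le N0 T0 (B := u y) _)).
    move=> l /mapP[z zD ->]; rewrite /affine/=; have [zab gz] := goodD _ zD.
    by have := good_subgradient zab gz Ay; rewrite dotpBr; lra.
  rewrite lerD2l ler_pdivrMr// /N mulrDr mulr1 mulrCA divff ?gt_eqF// mulr1.
  by rewrite lerDl ltW.
- move=> x xab'; have [y /= yD] := D'cov _ xab'.
  rewrite mx_norm_ball /ball_/= lt_min => /andP[yr yd].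
  have [yab gy] := goodD _ yD.
  apply: le_trans (lse_ge (l := (G y, u y - dotp (G y) y)) N0 T0 _ _); last first.
    by apply/mapP; exists y.
  rewrite /affine/=.
  have lip : `|u x - u y| <= L * `|x - y|.
    have := @convex_lipschitz _ _ _ _ cu y rho M (x - y) rho0 (fun z => @uM y z yab).
    by rewrite (addrC y) subrK; apply; rewrite distrC ltW.
  have dG : `|dotp (G y) (x - y)| <= n.+1%:R * L * `|x - y|.
    rewrite (le_trans (ler_norm_sum _ _ _))//.
    apply: (@le_trans _ _ (\sum_(i < n.+1) L * `|x - y|)).
      apply: ler_sum => i _; rewrite normrM ler_pM//.
        exact: good_gradient_bound.
      exact: coord_le_norm.
    by rewrite sumr_const card_ord -[leRHS]mulrA mulr_natl.
  have xyK : K * `|x - y| <= eps.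
    rewrite distrC; apply: (@le_trans _ _ ((K + 1) * `|y - x|)).
      by rewrite ler_wpM2r// lerDl.
    by rewrite mulrC -ler_pdivlMr ?ltr_wpDl// ltW.
  have KE : K * `|x - y| = L * `|x - y| + n.+1%:R * L * `|x - y| by rewrite -mulrDl.
  have := le_trans (ler_norm _) lip; have := le_trans (ler_norm _) dG.
  have : - dotp (G y) (x - y) <= n.+1%:R * L * `|x - y|.
    by apply: le_trans dG; rewrite -normrN ler_norm.
  rewrite dotpBr.
  lra.
Qed.

(** The tangent plane of f at x is tested at x + rho e_i and x - rho e_i, where f is at most M + 1,
    against f x >= -M - 1. *)
Lemma smooth_gradient_bound f Gf Hf (eps : R) x i : eps <= 1 -> box a b x ->
  smooth_convex f Gf Hf -> (forall y, A y -> f y <= u y + eps) ->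
  u x - eps <= f x -> `|Gf x ord0 i| <= (2 * M + 2) / rho.
Proof.
move=> eps1 xab [_ _ _ _ sub] fu ux.
have [|Ax Mx] := @uM x x xab; first by rewrite subrr normr0 ltW.
have side (s : R) : `|s| = rho -> s * Gf x ord0 i <= 2 * M + 2.
  move=> sr; have [|Ay My] := @uM x (x + s *: e i) xab.
    by rewrite addrC addKr norm_delta sr.
  have := sub x (x + s *: e i); rewrite addrAC subrr add0r dotpZr dotp_delta.
  have := fu _ Ay.
  by move: Mx My; rewrite !ler_norml => /andP[? ?] /andP[? ?]; lra.
have s1 := side rho (gtr0_norm rho0).
have s2 : - rho * Gf x ord0 i <= 2 * M + 2 by apply: side; rewrite normrN gtr0_norm.
by rewrite ler_norml lerNl !ler_pdivlMr// !(mulrC _ rho); apply/andP; split; lra.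
Qed.

(** At a good point the axis bounds of u and the tangent planes of f_k squeeze the gradient: for |t|
    = s, t times its i-th coordinate is at most t G_i + (d/2) s + 2 eps_k. Taking t = s and t = -s
    bounds both sides. *)
Lemma smooth_gradient_cvg (f : nat -> 'rV[R]_n.+1 -> R) Gf Hf (eps : nat -> R) x i :
  box a b x -> good x ->
  eps k @[k --> \oo] --> (0 : R) ->
  (forall k, smooth_convex (f k) (Gf k) (Hf k)) ->
  (forall k y, A y -> f k y <= u y + eps k) ->
  (forall k, u x - eps k <= f k x) ->
  Gf k x ord0 i @[k --> \oo] --> G x ord0 i.
Proof.
move=> xab gx eps0 sf fu ux; apply/cvgrPdist_lt => d d0.
have d40 : 0 < d / 2 by rewrite divr_gt0.
have [s0 s00 sG] := gx _ d40.
pose s := Num.min s0 rho.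
have sp : 0 < s by rewrite lt_min s00.
have ss0 : s <= s0 by rewrite ge_min lexx.
have srho : s <= rho by rewrite ge_min lexx orbT.
(* With eps_k < s d / 8 the error after division by s is below d/2 + d/4 < d. *)
have e0 : 0 < s * d / 8 by rewrite divr_gt0// mulr_gt0.
near=> k.
have ek : eps k < s * d / 8.
  near: k; move/cvgrPdist_lt : eps0 => /(_ _ e0); apply: filterS => k.
  by rewrite sub0r normrN => /(le_lt_trans (ler_norm _)).
have side (t : R) : `|t| = s -> t * Gf k x ord0 i <= t * G x ord0 i + d / 2 * s + s * d / 4.
  move=> ts; have [|Ay My] := @uM x (x + t *: e i) xab.
    by rewrite addrC addKr norm_delta ts.
  have [_ _ _ _ sub] := sf k.
  have := sub x (x + t *: e i); rewrite addrAC subrr add0r dotpZr dotp_delta.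
  have := fu k _ Ay; have := ux k.
  have := sG i t; rewrite ts => /(_ ss0).
  by lra.
have s1 := side s (gtr0_norm sp).
have s2 : - s * Gf k x ord0 i <= - s * G x ord0 i + d / 2 * s + s * d / 4.
  by apply: side; rewrite normrN gtr0_norm.
rewrite -(ltr_pM2l sp) -{1}(gtr0_norm sp) -normrM mulrBr ltr_norml.
have sd : 0 < s * d by rewrite mulr_gt0.
by apply/andP; split; lra.
Unshelve. all: by end_near.
Qed.

End approximation.

(** * The vanishing of the weak second derivatives *)

Section flux.
Context {R : realType} {n : nat}.
Local Notation e := (delta_mx ord0).
Implicit Types (x : 'rV[R]_n) (q : R).

(** This is |z|^(2q) z: q = -1/2 gives z/|z| and q = (p-2)/2 gives [pflux p], so one computation
    covers both terms of the equation. *)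
Definition flux q (z : 'rV[R]_n) (i : 'I_n) : R := dotp z z `^ q * z ord0 i.

(** The i-th term of the divergence of [flux q] along a field with value z and derivative matrix H,
    by the product and chain rules. *)
Definition flux_derive q (z : 'rV[R]_n) (H : 'I_n -> 'I_n -> R) (i : 'I_n) : R :=
  dotp z z `^ q * H i i +
  z ord0 i * (q * dotp z z `^ (q - 1) * (2 * \sum_k z ord0 k * H k i)).

Variables (f : 'rV[R]_n -> R) (Gf : 'rV[R]_n -> 'rV[R]_n).
Variable (Hf : 'rV[R]_n -> 'I_n -> 'I_n -> R).
Hypothesis sf : smooth_convex f Gf Hf.

Lemma continuous_at_dotp_gradient x : {for x, continuous (fun y => dotp (Gf y) (Gf y))}.
Proof.
have [[_ cG _] _ _ _ _] := sf.
by apply: continuous_at_sum => i; apply: continuous_atM; exact: cG.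
Qed.

Lemma is_derive_dotp_gradient x (j : 'I_n) :
  is_derive x (e j) (fun y => dotp (Gf y) (Gf y))
    (2 * \sum_k Gf x ord0 k * Hf x k j).
Proof.
have [_ _ dG _ _] := sf; rewrite mulr_sumr /dotp.
elim: (index_enum _) => [|k s IHs].
  rewrite big_nil (_ : (fun y => _) = cst 0); first exact: is_derive_cst.
  by apply/funext => y; rewrite big_nil.
rewrite big_cons (_ : (fun y => _) = (fun y => Gf y ord0 k * Gf y ord0 k +
    \sum_(l <- s) Gf y ord0 l * Gf y ord0 l)); last first.
  by apply/funext => y; rewrite big_cons.
apply: is_deriveD => //; have := is_deriveM (dG x k j) (dG x k j).
by congr is_derive; rewrite /GRing.scale/=; ring.
Qed.

Lemma continuous_at_powR_dotp q x : 0 < dotp (Gf x) (Gf x) ->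
  {for x, continuous (fun y => dotp (Gf y) (Gf y) `^ q)}.
Proof.
move=> S0; apply: (@continuous_at_chain _ _ (fun t => t `^ q)
  (fun y => dotp (Gf y) (Gf y))).
  exact: is_derive_continuous1 (is_derive1_powR q S0).
exact: continuous_at_dotp_gradient.
Qed.

Lemma continuous_at_flux q x (i : 'I_n) : 0 < dotp (Gf x) (Gf x) ->
  {for x, continuous (fun y => flux q (Gf y) i)}.
Proof.
have [[_ cG _] _ _ _ _] := sf.
move=> S0; apply: continuous_atM; first exact: continuous_at_powR_dotp.
exact: cG.
Qed.

Lemma is_derive_flux q x (i : 'I_n) : 0 < dotp (Gf x) (Gf x) ->
  is_derive x (e i) (fun y => flux q (Gf y) i) (flux_derive q (Gf x) (Hf x) i).
Proof.
move=> S0; have [_ _ dG _ _] := sf.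
have dP := @is_derive_chain _ _ (fun t => t `^ q) (fun y => dotp (Gf y) (Gf y))
  x (e i) _ _ (is_derive1_powR q S0) (is_derive_dotp_gradient x i).
exact: (is_deriveM dP (dG x i i)).
Qed.

Lemma continuous_at_flux_derive q x (i : 'I_n) : 0 < dotp (Gf x) (Gf x) ->
  {for x, continuous (fun y => flux_derive q (Gf y) (Hf y) i)}.
Proof.
have [[_ cG cH] _ _ _ _] := sf.
move=> S0; apply: continuous_atD.
  by apply: continuous_atM; [exact: continuous_at_powR_dotp|exact: cH].
apply: continuous_atM; first exact: cG.
apply: continuous_atM.
  apply: continuous_atM; first exact: continuous_at_cst.
  exact: continuous_at_powR_dotp.
apply: continuous_atM; first exact: continuous_at_cst.
by apply: continuous_at_sum => k; apply: continuous_atM; [exact: cG|exact: cH].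
Qed.

Lemma trace_ge0 x : 0 < dotp (Gf x) (Gf x) -> 0 <= \sum_i Hf x i i.
Proof.
have [_ _ _ psd _] := sf; move=> S0; have /andP[h1 h2] := psd x (Gf x).
by have := le_trans h1 h2; rewrite pmulr_rge0.
Qed.

Lemma hess_diag_ge0 x i : 0 <= Hf x i i.
Proof.
have [_ _ _ psd _] := sf; have /andP[+ _] := psd x (e i).
rewrite (bigD1 i)//= (bigD1 i)//= !delta_coord eqxx !mul1r.
rewrite big1 => [|j ji]; last by rewrite delta_coord (negPf ji) mulr0 mul0r.
rewrite big1 ?addr0// => k ki; rewrite big1// => j _.
by rewrite delta_coord (negPf ki) !mul0r.
Qed.

(* In the smooth case the divergence of |z|^(2q) z at z = grad f is
   |z|^(2q) (tr H + 2 q <H z, z> / |z|^2), and 0 <= <H z, z> <= |z|^2 tr H. *)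
Lemma flux_divergence_ge q x : 0 < dotp (Gf x) (Gf x) -> 0 <= 1 + 2 * q ->
  Num.min 1 (1 + 2 * q) * dotp (Gf x) (Gf x) `^ q * (\sum_i Hf x i i) <=
  \sum_i flux_derive q (Gf x) (Hf x) i.
Proof.
move=> S0 q0; have [_ _ _ psd _] := sf; have /andP[] := psd x (Gf x).
set Q := (\sum_i \sum_j _); set S := dotp _ _ in S0 *; set T := \sum_i _ => Q0 QST.
have T0 : 0 <= T by exact: trace_ge0.
have E : \sum_i flux_derive q (Gf x) (Hf x) i = S `^ q * T + 2 * q * S `^ (q - 1) * Q.
  rewrite /flux_derive big_split/= -mulr_sumr; congr (_ + _).
  rewrite /Q exchange_big/= mulr_sumr; apply: eq_bigr => i _.
  rewrite !mulr_sumr; apply: eq_bigr => k _; rewrite -/S; ring.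
rewrite E powRB; last by apply/implyP => _; rewrite gt_eqF.
rewrite powRr1 ?(ltW S0)//.
have P0 : 0 < S `^ q by exact: powR_gt0.
have Sn0 : S != 0 by rewrite gt_eqF.
pose r := Q / S; have r0 : 0 <= r by rewrite divr_ge0// ltW.
have rT : r <= T by rewrite ler_pdivrMr// mulrC.
have -> : S `^ q * T + 2 * q * (S `^ q / S) * Q = S `^ q * (T + 2 * q * r).
  by rewrite /r; field.
rewrite mulrAC mulrC ler_pM2l//.
have [q1|q1] := leP 0 q.
  rewrite min_l; last by rewrite lerDl mulr_ge0.
  by rewrite mul1r lerDl mulr_ge0// mulr_ge0.
rewrite min_r; last by rewrite gerDl mulr_ge0_le0// ltW.
rewrite mulrDl mul1r lerD2l; apply: ler_wnM2l => //.
by rewrite mulr_ge0_le0// ltW.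
Qed.

End flux.

(** Away from 0 the Euclidean norm has a single subgradient, so the multiplier in the weak equation
    is no longer free. *)
Lemma flux_subdifferential {R : realType} {n : nat} (z w : 'rV[R]_n) (i : 'I_n) :
  0 < dotp z z -> subdifferential enorm z w -> w ord0 i = flux (- 2^-1) z i.
Proof.
move=> z0; rewrite subdifferential_enormE; have [z00|zn0] := eqVneq z 0.
  by move: z0; rewrite z00 dotp0 ltxx.
move=> /= ->; rewrite mxE /flux powRN; congr (_^-1 * _).
by rewrite powR12_sqrt// dotpp_ge0.
Qed.

Lemma flux_pflux {R : realType} {n : nat} (p : R) (z : 'rV[R]_n) (i : 'I_n) :
  (pflux p z) ord0 i = flux ((p - 2) / 2) z i.
Proof.
rewrite mxE /flux; congr (_ * _); rewrite /enorm.
by rewrite -powR12_sqrt ?dotpp_ge0// -powRrM mulrC.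
Qed.

Lemma Rintegral_sum {R : realType} {n : nat} (w : set 'rV[R]_n) (I : Type)
    (r : seq I) (F : I -> 'rV[R]_n -> R) : measurable w ->
  (forall i, (lebesgue_rV n).-integrable w (EFin \o F i)) ->
  (lebesgue_rV n).-integrable w (EFin \o (fun x => \sum_(i <- r) F i x)) /\
  \int[lebesgue_rV n]_(x in w) (\sum_(i <- r) F i x) =
    \sum_(i <- r) \int[lebesgue_rV n]_(x in w) F i x.
Proof.
move=> mw iF; elim: r => [|i r [ir Er]].
  have -> : (fun x => \sum_(i <- [::]) F i x) = (fun=> 0).
    by apply/funext => x; rewrite big_nil.
  split; last by rewrite big_nil /Rintegral integral0.
  exact: integrable0.
have -> : (fun x => \sum_(j <- i :: r) F j x) =
    (fun x => F i x + \sum_(j <- r) F j x).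
  by apply/funext => x; rewrite big_cons.
by split; [exact: real_integrableD|rewrite RintegralD// Er big_cons].
Qed.

Lemma tensor_bounded {R : realType} {n : nat} (a b : 'rV[R]_n) eta :
  bump_in a b eta -> exists2 C : R, 0 <= C & forall x, `|tensor eta x| <= C.
Proof.
move=> ebump; have [se _] := ebump; have [_ etaw] := bump_in_test ebump.
have [s _ ets] := compactly_contained_box etaw.
exact: continuous_support_bounded (continuous_tensor se) ets.
Qed.

(** The exponent (p-2)/2 has either sign according to whether p exceeds 2, so the power may increase
    or decrease; either way the endpoint values enclose it. *)
Lemma powR_between {R : realType} (lo hi s q : R) : 0 < lo -> lo <= s <= hi ->
  Num.min (lo `^ q) (hi `^ q) <= s `^ q <= Num.max (lo `^ q) (hi `^ q).
Proof.
move=> lo0 /andP[los shi]; have s0 := lt_le_trans lo0 los.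
have hi0 := lt_le_trans s0 shi.
have [q0|q0] := leP 0 q.
  have h1 : lo `^ q <= s `^ q by apply: ge0_ler_powR => //; rewrite nnegrE ltW.
  have h2 : s `^ q <= hi `^ q by apply: ge0_ler_powR => //; rewrite nnegrE ltW.
  by rewrite ge_min h1 le_max h2 orbT.
have neg t : 0 < t -> t `^ q = (t `^ (- q))^-1.
  by move=> t0; rewrite -powRN opprK.
have q1 : 0 <= - q by rewrite oppr_ge0 ltW.
have h1 : s `^ q <= lo `^ q.
  rewrite !neg// lef_pV2 ?posrE ?powR_gt0//.
  by apply: ge0_ler_powR => //; rewrite nnegrE ltW.
have h2 : hi `^ q <= s `^ q.
  rewrite !neg// lef_pV2 ?posrE ?powR_gt0//.
  by apply: ge0_ler_powR => //; rewrite nnegrE ltW.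
by rewrite ge_min h2 orbT le_max h1.
Qed.

Definition tensor_gradient {R : realType} {n : nat} (eta : 'I_n -> R -> R)
    (x : 'rV[R]_n) : 'rV[R]_n :=
  \row_i tensor (tensor_derive i eta) x.

Section laplacian.
Context {R : realType} {n : nat}.
Variables (A : set 'rV[R]_n.+1) (u : 'rV[R]_n.+1 -> R).
Hypothesis cA : forall x y (t : R), A x -> A y -> 0 <= t <= 1 ->
  A (t *: x + (1 - t) *: y).
Hypothesis cu : forall x y (t : R), A x -> A y -> 0 <= t <= 1 ->
  u (t *: x + (1 - t) *: y) <= t * u x + (1 - t) * u y.
Hypothesis oA : open A.
Variables (a b : 'rV[R]_n.+1) (rho M : R).
Hypothesis rho0 : 0 < rho.
Hypothesis uM : forall x y, box a b x -> `|y - x| <= rho -> A y /\ `|u y| <= M.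
Variable G : 'rV[R]_n.+1 -> 'rV[R]_n.+1.
Local Notation e := (delta_mx ord0).
Local Notation mu := (lebesgue_rV (R := R) n.+1).
Implicit Types (x y v : 'rV[R]_n.+1).
Hypothesis aegood : {ae mu, forall x, box a b x -> good u G x}.
Variables (a' b' : 'rV[R]_n.+1).
Hypothesis sub_ab : cbox a' b' `<=` box a b.
Hypothesis ne_w : box a' b' !=set0.
Variables (y1 : 'rV[R]_n.+1) (kappa : R).
Hypothesis kappa0 : 0 < kappa.
Hypothesis Ay1 : A y1.
Hypothesis uy1 : forall x, box a b x -> u y1 + kappa <= u x.
Variables (beta p : R) (Z : 'rV[R]_n.+1 -> 'rV[R]_n.+1).
Hypothesis beta0 : 0 < beta.
Hypothesis p1 : 1 < p.
Let w := box a' b'.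
Hypothesis mG : forall i, measurable_fun w (fun x => G x ord0 i).
Hypothesis aeZ : {ae mu, forall x, w x -> subdifferential enorm (G x) (Z x)}.
Hypothesis mZ : forall i, measurable_fun w (fun x => Z x ord0 i).
Hypothesis weak : forall eta, bump_in a' b' eta ->
  beta * \int[mu]_(x in w) dotp (Z x) (tensor_gradient eta x) +
  \int[mu]_(x in w) dotp (pflux p (G x)) (tensor_gradient eta x) = 0.

Let mw : measurable w. Proof. exact: measurable_box. Qed.
Let ow : open w. Proof. exact: open_box. Qed.

Let w_sub x : w x -> cbox a' b' x.
Proof. by move=> wx i; have /andP[/ltW -> /ltW ->] := wx i. Qed.

Let ne_ab : cbox a' b' !=set0.
Proof. by have [x wx] := ne_w; exists x; exact: w_sub. Qed.

Let w_ab x : w x -> box a b x.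
Proof. by move=> /w_sub /sub_ab. Qed.

Let woo : (mu w < +oo)%E. Proof. exact: lebesgue_rV_box_lty. Qed.

Lemma smooth_sequence : exists (f : nat -> 'rV[R]_n.+1 -> R) Gf Hf (eps : nat -> R),
  [/\ forall k, smooth_convex (f k) (Gf k) (Hf k),
      forall k y, A y -> f k y <= u y + eps k,
      forall k x, cbox a' b' x -> u x - eps k <= f k x,
      forall k, 0 < eps k /\ eps k <= Num.min 1 (kappa / 4) &
      eps k @[k --> \oo] --> (0 : R)].
Proof.
(* The bound 1 serves the upper estimate of the gradients; kappa/4 leaves half of the gap kappa for
   the lower one. *)
pose e0 := Num.min 1 (kappa / 4).
have e00 : 0 < e0 by rewrite lt_min ltr01 divr_gt0.
pose eps (k : nat) := e0 / k.+1%:R.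
have eps0 k : 0 < eps k by rewrite divr_gt0.
have /choice[F FP] : forall k, exists F : ('rV[R]_n.+1 -> R) *
    ('rV[R]_n.+1 -> 'rV[R]_n.+1) * ('rV[R]_n.+1 -> 'I_n.+1 -> 'I_n.+1 -> R),
    [/\ smooth_convex F.1.1 F.1.2 F.2, forall y, A y -> F.1.1 y <= u y + eps k &
      forall x, cbox a' b' x -> u x - eps k <= F.1.1 x].
  move=> k; have [f [Gf [Hf [h1 h2 h3]]]] :=
    convex_smooth_approx cA cu oA rho0 uM aegood sub_ab ne_ab (eps0 k).
  by exists (f, Gf, Hf).
exists (fun k => (F k).1.1), (fun k => (F k).1.2), (fun k => (F k).2), eps; split.
- by move=> k; have [] := FP k.
- by move=> k; have [] := FP k.
- by move=> k; have [] := FP k.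
- by move=> k; split => //; rewrite ler_pdivrMr// ler_peMr ?(ltW e00)// ler1n.
- rewrite -(mulr0 e0); apply: cvgM; first exact: cvg_cst.
  exact: cvg_harmonic.
Qed.

Lemma box_dist_bounded : exists2 D : R, 0 < D & forall x, w x -> enorm (x - y1) <= D.
Proof.
pose m := `|a'| + `|b'| + `|y1|.
exists (Num.sqrt n.+1%:R * m + 1).
  by rewrite ltr_wpDl// mulr_ge0// ?sqrtr_ge0// !addr_ge0.
move=> x wx; rewrite (le_trans (enorm_le _))//.
apply: (@le_trans _ _ (Num.sqrt n.+1%:R * m)); last by rewrite lerDl.
rewrite ler_wpM2l ?sqrtr_ge0//; apply/rV_norm_leP => [|i].
  by rewrite !addr_ge0.
rewrite !mxE (le_trans (ler_normB _ _))// lerD ?coord_le_norm//.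
have /andP[h1 h2] := wx i.
have := coord_le_norm a' i; have := coord_le_norm b' i.
rewrite !ler_norml => /andP[h3 h4] /andP[h5 h6].
have := normr_ge0 a'; have := normr_ge0 b'.
by move=> ? ?; apply/andP; split; lra.
Qed.

Section sequence.
Variables (f : nat -> 'rV[R]_n.+1 -> R) (Gf : nat -> 'rV[R]_n.+1 -> 'rV[R]_n.+1).
Variables (Hf : nat -> 'rV[R]_n.+1 -> 'I_n.+1 -> 'I_n.+1 -> R) (eps : nat -> R).
Hypothesis sf : forall k, smooth_convex (f k) (Gf k) (Hf k).
Hypothesis fu : forall k y, A y -> f k y <= u y + eps k.
Hypothesis ux : forall k x, cbox a' b' x -> u x - eps k <= f k x.
Hypothesis epsb : forall k, 0 < eps k /\ eps k <= Num.min 1 (kappa / 4).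
Hypothesis eps0 : eps k @[k --> \oo] --> (0 : R).

Let B := (2 * M + 2) / rho.

Lemma seq_gradient_bound k x i : w x -> `|Gf k x ord0 i| <= B.
Proof.
move=> wx; have eps1 : eps k <= 1 by have [_] := epsb k; rewrite le_min => /andP[].
have h := smooth_gradient_bound rho0 uM i eps1 (w_ab wx).
exact: h (sf k) (fu k) (ux k (w_sub wx)).
Qed.

(** The tangent plane of f_k at x, evaluated at [y1], gives <grad f_k(x), x - y1> >= kappa - 2 eps_k
    >= kappa/2, and |x - y1| <= D turns this into a lower bound on the gradient. This is where
    non-minimality of u on the box enters. *)
Lemma seq_dotp_between : exists lo hi : R, 0 < lo /\
  forall k x, w x -> lo <= dotp (Gf k x) (Gf k x) <= hi.
Proof.
have [D D0 yD] := box_dist_bounded.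
exists ((kappa / 2 / D) ^+ 2), (n.+1%:R * B ^+ 2); split.
  by rewrite exprn_gt0// !divr_gt0.
move=> k x wx; apply/andP; split; last first.
  rewrite /dotp (@le_trans _ _ (\sum_(i < n.+1) B ^+ 2))//.
    apply: ler_sum => i _; rewrite -expr2 -real_normK ?num_real//.
    rewrite lerXn2r ?nnegrE//.
      exact: le_trans (seq_gradient_bound k i wx).
    exact: seq_gradient_bound.
  by rewrite sumr_const card_ord mulr_natl.
have [_ _ _ _ sub] := sf k.
have h1 := sub x y1; have h2 := @fu k _ Ay1; have h3 := ux k (w_sub wx).
have h4 := uy1 (w_ab wx); have [_] := epsb k; rewrite le_min => /andP[_ h5].
have h6 : kappa / 2 <= dotp (Gf k x) (x - y1).
  have -> : dotp (Gf k x) (x - y1) = - dotp (Gf k x) (y1 - x).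
    by rewrite !dotpBr opprB.
  by lra.
have h7 := le_trans h6 (dotp_le _ _).
have h8 : kappa / 2 <= enorm (Gf k x) * D.
  by rewrite (le_trans h7)// ler_wpM2l ?enorm_ge0// yD.
rewrite -sqr_enorm lerXn2r ?nnegrE ?enorm_ge0//.
  by rewrite !divr_ge0// ltW.
by rewrite ler_pdivrMr.
Qed.

Lemma seq_gradient_cvg : {ae mu, forall x, w x -> forall i,
  Gf k x ord0 i @[k --> \oo] --> G x ord0 i}.
Proof.
apply: filterS aegood => x gx wx i.
apply: (smooth_gradient_cvg rho0 uM (w_ab wx) (gx (w_ab wx)) eps0 sf fu).
by move=> k; apply: ux; exact: w_sub.
Qed.

Lemma cvg_sum_seq (I : Type) (r : seq I) (F : I -> nat -> R) (l : I -> R) :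
  (forall i, F i k @[k --> \oo] --> l i) ->
  \sum_(i <- r) F i k @[k --> \oo] --> \sum_(i <- r) l i.
Proof.
move=> Fl; elim: r => [|i r IHr].
  rewrite big_nil; have -> : (fun k => \sum_(i <- [::]) F i k) = (fun=> 0).
    by apply/funext => k; rewrite big_nil.
  exact: cvg_cst.
rewrite big_cons; have -> : (fun k => \sum_(j <- i :: r) F j k) =
    (fun k => F i k + \sum_(j <- r) F j k).
  by apply/funext => k; rewrite big_cons.
exact: cvgD.
Qed.

Lemma seq_dotp_gt0 k x : w x -> 0 < dotp (Gf k x) (Gf k x).
Proof.
have [lo [hi [lo0 lohi]]] := seq_dotp_between.
by move=> /(lohi k)/andP[+ _]; exact: lt_le_trans.
Qed.

(** The lower bound on the gradients passes to the limit, so [G] is nonzero a.e. and the power of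
    |G|^2 is continuous there, even for negative q. *)
Lemma seq_flux_cvg : {ae mu, forall x, w x -> 0 < dotp (G x) (G x) /\
  forall q i, flux q (Gf k x) i @[k --> \oo] --> flux q (G x) i}.
Proof.
have [lo [hi [lo0 lohi]]] := seq_dotp_between.
apply: filterS seq_gradient_cvg => x cG wx; have {}cG := cG wx.
have cS : dotp (Gf k x) (Gf k x) @[k --> \oo] --> dotp (G x) (G x).
  by apply: cvg_sum_seq => i; apply: cvgM; exact: cG.
have S0 : 0 < dotp (G x) (G x).
  apply: (lt_le_trans lo0); apply: (cvgr_to_ge cS); apply: nearW => k.
  by have /andP[] := lohi k x wx.
split=> // q i; apply: cvgM; last exact: cG.
have cP := is_derive_continuous1 (is_derive1_powR q S0).
exact: (cvg_comp _ _ cS cP).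
Qed.

Lemma measurable_flux q i : measurable_fun w (fun x => flux q (G x) i).
Proof.
apply: measurable_funM => //.
apply: (@measurableT_comp _ _ _ _ _ _ (fun t : R => t `^ q)).
  exact: measurable_powR.
rewrite /dotp; apply: measurable_sum => j.
exact: measurable_funM.
Qed.

(** Dominated convergence with a constant majorant: the two-sided bound on |grad f_k|^2 tames the
    power for either sign of q. *)
Lemma seq_flux_integral_cvg q eta : bump_in a' b' eta ->
  \int[mu]_(x in w) (\sum_i tensor (tensor_derive i eta) x * flux q (Gf k x) i)
    @[k --> \oo] -->
  \int[mu]_(x in w) (\sum_i tensor (tensor_derive i eta) x * flux q (G x) i).
Proof.
move=> ebump; have [lo [hi [lo0 lohi]]] := seq_dotp_between.
have /fin_all_exists[C CP] : forall i : 'I_n.+1, exists C : R,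
    forall x, `|tensor (tensor_derive i eta) x| <= C.
  by move=> i; have [C _ CP] := tensor_bounded (bump_in_derive i ebump); exists C.
have mt i : measurable_fun w (tensor (tensor_derive i eta)).
  apply: measurable_continuous => //; apply: continuous_tensor.
  by apply: tensor_derive_smooth; case: ebump.
pose P := Num.max (lo `^ q) (hi `^ q).
pose K := \sum_i C i * (P * B).
apply: (@Rintegral_dominated_cvg _ _ _ _ _ (fun=> K)) => //.
- move=> k; apply: measurable_sum => i; apply: measurable_funM => //.
  apply: continuous_rV_measurable => // x wx.
  apply: (continuous_at_flux (sf k)); exact: seq_dotp_gt0.
- apply: measurable_sum => i; apply: measurable_funM => //.
  exact: measurable_flux.
- apply: filterS seq_flux_cvg => x Fx wx; have [_ {}Fx] := Fx wx.
  apply: cvg_sum_seq => i; apply: cvgM; first exact: cvg_cst.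
  exact: Fx.
- by apply: (@bounded_integrable _ _ _ _ `|K|).
- apply: aeW => x k wx; rewrite (le_trans (ler_norm_sum _ _ _))//.
  apply: ler_sum => i _; rewrite normrM ler_pM//.
  rewrite /flux normrM ler_pM//; last exact: seq_gradient_bound.
  rewrite ger0_norm ?powR_ge0//.
  by have /andP[] := powR_between q lo0 (lohi k x wx).
Qed.

Lemma seq_flux_by_parts q k eta : bump_in a' b' eta ->
  mu.-integrable w (EFin \o (fun x => tensor eta x *
    \sum_i flux_derive q (Gf k x) (Hf k x) i)) /\
  \int[mu]_(x in w) (tensor eta x * \sum_i flux_derive q (Gf k x) (Hf k x) i) =
  - \int[mu]_(x in w) (\sum_i tensor (tensor_derive i eta) x * flux q (Gf k x) i).
Proof.
move=> ebump; have [se _] := ebump; have [_ etaw] := bump_in_test ebump.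
have ct : continuous (tensor eta) by exact: continuous_tensor.
have E : (fun x => tensor eta x * \sum_i flux_derive q (Gf k x) (Hf k x) i) =
    fun x => \sum_i tensor eta x * flux_derive q (Gf k x) (Hf k x) i.
  by apply/funext => x; rewrite mulr_sumr.
have cdt i : continuous (tensor (tensor_derive i eta)).
  by apply: continuous_tensor; exact: tensor_derive_smooth.
have i1 i : mu.-integrable w (EFin \o (fun x => tensor eta x *
    flux_derive q (Gf k x) (Hf k x) i)).
  apply: (mul_support_integrable ow mw etaw ct) => x wx.
  apply: (continuous_at_flux_derive (sf k)); exact: seq_dotp_gt0.
have i2 i : mu.-integrable w (EFin \o (fun x => tensor (tensor_derive i eta) x *
    flux q (Gf k x) i)).
  apply: (mul_support_integrable ow mw (bump_in_test (bump_in_derive i ebump)).2 (cdt i)) => x wx.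
  apply: (continuous_at_flux (sf k)); exact: seq_dotp_gt0.
rewrite E; have [j1 ->] := Rintegral_sum (index_enum _) mw i1; split => //.
have [_ ->] := Rintegral_sum (index_enum _) mw i2.
rewrite -sumrN; apply: eq_bigr => i _.
apply: (Rintegral_by_parts ow etaw ct (fun x => is_derive_tensor i x se) (cdt i)).
- by move=> x wx; apply: (continuous_at_flux (sf k)); exact: seq_dotp_gt0.
- by move=> x wx; apply: (is_derive_flux (sf k)); exact: seq_dotp_gt0.
- by move=> x wx; apply: (continuous_at_flux_derive (sf k)); exact: seq_dotp_gt0.
Qed.

(** Since [G] is nonzero a.e., [Z] equals G/|G| a.e. and the weak equation becomes one about the
    limit fluxes of [seq_flux_integral_cvg]. *)
Lemma weak_flux eta : bump_in a' b' eta ->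
  beta * \int[mu]_(x in w) (\sum_i tensor (tensor_derive i eta) x * flux (- 2^-1) (G x) i) +
  \int[mu]_(x in w) (\sum_i tensor (tensor_derive i eta) x * flux ((p - 2) / 2) (G x) i) = 0.
Proof.
move=> ebump; rewrite -[RHS](weak ebump).
have mt i : measurable_fun w (tensor (tensor_derive i eta)).
  apply: measurable_continuous => //; apply: continuous_tensor.
  by apply: tensor_derive_smooth; case: ebump.
congr (_ * _ + _); last first.
  apply: eq_Rintegral => x _; apply: eq_bigr => i _.
  by rewrite flux_pflux mxE mulrC.
congr fine; apply: ae_eq_integral => //.
- apply/measurable_EFinP; apply: measurable_sum => i; apply: measurable_funM => //.
  exact: measurable_flux.
- apply/measurable_EFinP; apply: measurable_sum => i; apply: measurable_funM => //.
  rewrite (_ : (fun x => _) = tensor (tensor_derive i eta))//.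
  by apply/funext => x; rewrite mxE.
- apply: filterS2 seq_flux_cvg aeZ => x Sx Zx wx; have [S0 _] := Sx wx.
  congr EFin; apply: eq_bigr => i _.
  by rewrite mxE mulrC (flux_subdifferential i S0 (Zx wx)).
Qed.

Lemma trace_integral_cvg0 eta : bump_in a' b' eta -> (forall i t, 0 <= eta i t) ->
  \int[mu]_(x in w) (tensor eta x * \sum_i Hf k x i i) @[k --> \oo] --> (0 : R).
Proof.
move=> ebump eta0; have [se _] := ebump; have [_ etaw] := bump_in_test ebump.
have ct : continuous (tensor eta) by exact: continuous_tensor.
have t0 x : 0 <= tensor eta x by apply: prodr_ge0 => i _.
have [lo [hi [lo0 lohi]]] := seq_dotp_between.
pose q := (p - 2) / 2.
have q1 : 0 < 1 + 2 * q.
  have -> : 1 + 2 * q = p - 1 by rewrite /q; field.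
  by rewrite subr_gt0.
have hi0 : 0 < hi.
  have [x0 x0w] := ne_w.
  by have /andP[h1 h2] := lohi 0%N x0 x0w; rewrite (lt_le_trans lo0)// (le_trans h1).
(* The constant from [flux_divergence_ge], with |grad f_k|^(2q) replaced by its uniform lower bound;
   it is positive because 1 + 2q = p - 1. *)
pose c := Num.min 1 (1 + 2 * q) * Num.min (lo `^ q) (hi `^ q).
have c0 : 0 < c by rewrite mulr_gt0// lt_min ?ltr01 ?q1// !powR_gt0.
pose J k := beta * \int[mu]_(x in w) (tensor eta x *
    \sum_i flux_derive (- 2^-1) (Gf k x) (Hf k x) i) +
  \int[mu]_(x in w) (tensor eta x * \sum_i flux_derive q (Gf k x) (Hf k x) i).
have Jcvg : J k @[k --> \oo] --> (0 : R).
  have L1 := @seq_flux_integral_cvg (- 2^-1) _ ebump.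
  have L2 := @seq_flux_integral_cvg q _ ebump.
  have -> : J = fun k => - (beta * \int[mu]_(x in w)
      (\sum_i tensor (tensor_derive i eta) x * flux (- 2^-1) (Gf k x) i) +
      \int[mu]_(x in w) (\sum_i tensor (tensor_derive i eta) x * flux q (Gf k x) i)).
    apply/funext => k; rewrite /J (seq_flux_by_parts _ k ebump).2.
    by rewrite (seq_flux_by_parts _ k ebump).2 mulrN opprD.
  have wf := weak_flux ebump; rewrite -/q in wf.
  by have h := cvgN (cvgD (cvgM (cvg_cst beta) L1) L2); rewrite wf oppr0 in h; apply: h.
have iT k : mu.-integrable w (EFin \o (fun x => tensor eta x * \sum_i Hf k x i i)).
  apply: (mul_support_integrable ow mw etaw ct) => x wx.
  by apply: continuous_at_sum => i; have [[_ _ cH] _ _ _ _] := sf k; exact: cH.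
have bnd k : 0 <= \int[mu]_(x in w) (tensor eta x * \sum_i Hf k x i i) <= c^-1 * J k.
  apply/andP; split.
    apply: Rintegral_ge0 => x wx; apply: mulr_ge0 => //.
    by apply: sumr_ge0 => i _; exact: hess_diag_ge0 (sf k) _ _.
  rewrite ler_pdivlMl// -RintegralZl//.
  have [i1 _] := seq_flux_by_parts (- 2^-1) k ebump.
  have [i2 _] := seq_flux_by_parts q k ebump.
  rewrite /J -RintegralZl// -RintegralD//; last exact: real_integrableZ.
  apply: le_Rintegral => //.
  - exact: real_integrableZ.
  - by apply: real_integrableD => //; exact: real_integrableZ.
  - move=> x wx; have S0 := seq_dotp_gt0 k wx.
    have tr0 := trace_ge0 (sf k) S0.
    have h1 := @flux_divergence_ge _ _ _ _ _ (sf k) (- 2^-1) x S0.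
    have h2 := @flux_divergence_ge _ _ _ _ _ (sf k) q x S0 (ltW q1).
    have h3 : 0 <= \sum_i flux_derive (- 2^-1) (Gf k x) (Hf k x) i.
      have z0 : 1 + 2 * - 2^-1 = 0 :> R by rewrite mulrN divff ?subrr.
      by have := h1; rewrite z0 lexx min_r// !mul0r; apply.
    have h4 : c * (\sum_i Hf k x i i) <= \sum_i flux_derive q (Gf k x) (Hf k x) i.
      apply: le_trans h2; rewrite ler_wpM2r// /c ler_wpM2l//.
        by rewrite le_min ler01 ltW.
      by have /andP[] := powR_between q lo0 (lohi k x wx).
    rewrite mulrCA (mulrCA beta) -mulrDr ler_wpM2l//.
    by rewrite (le_trans h4)// lerDr mulr_ge0// ltW.
apply: (@squeeze_cvgr _ _ _ _ (fun=> 0) (fun k => c^-1 * J k)).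
- by apply: nearW => k; exact: bnd.
- exact: cvg_cst.
- by rewrite -(mulr0 c^-1); apply: cvgM; [exact: cvg_cst|exact: Jcvg].
Qed.

(** A single diagonal entry of the Hessian lies between 0 and the trace, so its integral against eta
    tends to 0. Two integrations by parts move both derivatives to eta, where the convergence of f_k
    to u is enough. *)
Lemma second_derivative_weak eta (i : 'I_n.+1) : bump_in a' b' eta ->
  (forall i t, 0 <= eta i t) ->
  \int[mu]_(x in w) (u x * tensor (tensor_derive i (tensor_derive i eta)) x) = 0.
Proof.
move=> ebump eta0; have [se _] := ebump; have [_ etaw] := bump_in_test ebump.
have ct : continuous (tensor eta) by exact: continuous_tensor.
have t0 x : 0 <= tensor eta x by apply: prodr_ge0 => j _.
have db := bump_in_derive i ebump; have [sd _] := db; have [_ dw] := bump_in_test db.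
have ddb := bump_in_derive i db; have [sdd _] := ddb; have [_ ddw] := bump_in_test ddb.
have cdt := continuous_tensor sd; have cddt := continuous_tensor sdd.
have Hii k : \int[mu]_(x in w) (tensor eta x * Hf k x i i) =
    \int[mu]_(x in w) (tensor (tensor_derive i (tensor_derive i eta)) x * f k x).
  have [[cf cG cH] df dG _ _] := sf k.
  rewrite (Rintegral_by_parts ow etaw ct (fun x => is_derive_tensor i x se) cdt
    (fun x _ => cG i x) (fun x _ => dG x i i) (fun x _ => cH i i x)).
  rewrite (Rintegral_by_parts ow dw cdt (fun x => is_derive_tensor i x sd) cddt
    (fun x _ => cf x) (fun x _ => df x i) (fun x _ => cG i x)).
  by rewrite opprK.
have lim1 : \int[mu]_(x in w) (tensor eta x * Hf k x i i) @[k --> \oo] --> (0 : R).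
  apply: (@squeeze_cvgr _ _ _ _ (fun=> 0)
    (fun k => \int[mu]_(x in w) (tensor eta x * \sum_i Hf k x i i))).
  - apply: nearW => k; have [[_ _ cH] _ _ _ _] := sf k; apply/andP; split.
      by apply: Rintegral_ge0 => x wx; apply: mulr_ge0 => //; exact: hess_diag_ge0 (sf k) _ _.
    apply: le_Rintegral => //.
    + by apply: (mul_support_integrable ow mw etaw ct) => x wx; exact: cH.
    + apply: (mul_support_integrable ow mw etaw ct) => x wx.
      by apply: continuous_at_sum => j; exact: cH.
    + move=> x wx; apply: ler_wpM2l => //; rewrite [leRHS](bigD1 i)//= lerDl.
      by apply: sumr_ge0 => j _; exact: hess_diag_ge0 (sf k) _ _.
  - exact: cvg_cst.
  - exact: trace_integral_cvg0.
have [C C0 CP] := tensor_bounded ddb.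
have lim2 : \int[mu]_(x in w) (tensor (tensor_derive i (tensor_derive i eta)) x * f k x)
    @[k --> \oo] -->
    \int[mu]_(x in w) (tensor (tensor_derive i (tensor_derive i eta)) x * u x).
  have mt : measurable_fun w (tensor (tensor_derive i (tensor_derive i eta))).
    exact: measurable_continuous.
  have Ax x : w x -> A x /\ `|u x| <= M.
    by move=> /w_ab xab; apply: (@uM x) => //; rewrite subrr normr0 ltW.
  apply: (@Rintegral_dominated_cvg _ _ _ _ _ (fun=> C * (M + 1))) => //.
  - move=> k; apply: measurable_funM => //; apply: measurable_continuous => //.
    by have [[cf _ _] _ _ _ _] := sf k.
  - apply: measurable_funM => //; apply: continuous_rV_measurable => // x wx.
    by apply: (convex_continuous cA cu oA); have [] := Ax x wx.
  - apply: aeW => x wx; apply: cvgM; first exact: cvg_cst.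
    apply: (@squeeze_cvgr _ _ _ _ (fun k => u x - eps k) (fun k => u x + eps k)).
    + apply: nearW => k; rewrite ux; last exact: w_sub.
      by rewrite fu; have [] := Ax x wx.
    + by rewrite -[X in _ --> X]subr0; apply: cvgB => //; exact: cvg_cst.
    + by rewrite -[X in _ --> X]addr0; apply: cvgD => //; exact: cvg_cst.
  - by apply: (@bounded_integrable _ _ _ _ `|C * (M + 1)|).
  - apply: aeW => x k wx; rewrite normrM ler_pM//.
    have [Axx] := Ax x wx; have := fu k Axx; have := ux k (w_sub wx).
    have [_] := epsb k; rewrite le_min => /andP[e1 _].
    by rewrite !ler_norml => h1 h2 /andP[h3 h4]; apply/andP; split; lra.
under eq_Rintegral do rewrite mulrC.
have E : (fun k => \int[mu]_(x in w) (tensor eta x * Hf k x i i)) = (fun k =>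
    \int[mu]_(x in w) (tensor (tensor_derive i (tensor_derive i eta)) x * f k x)).
  by apply/funext => k; exact: Hii.
by rewrite E in lim1; exact: (cvg_unique _ lim2 lim1).
Qed.

End sequence.

Lemma weak_second_derivative_eq0 eta (i : 'I_n.+1) : bump_in a' b' eta ->
  (forall i t, 0 <= eta i t) ->
  \int[mu]_(x in w) (u x * tensor (tensor_derive i (tensor_derive i eta)) x) = 0.
Proof.
have [f [Gf [Hf [eps [h1 h2 h3 h4 h5]]]]] := smooth_sequence.
by move=> ebump eta0; exact: (second_derivative_weak h1 h2 h3 h4 h5 i ebump eta0).
Qed.

End laplacian.

(** A positive value at x would give f > f(x)/2 on a box around x, which has positive measure. *)
Lemma continuous_Rintegral_eq0 {R : realType} {n : nat} (w : set 'rV[R]_n)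
    (f : 'rV[R]_n -> R) x : open w -> measurable w ->
  (lebesgue_rV n).-integrable w (EFin \o f) ->
  (forall y, w y -> 0 <= f y) -> \int[lebesgue_rV n]_(y in w) f y = 0 ->
  w x -> {for x, continuous f} -> f x = 0.
Proof.
move=> ow mw iw f0 If wx cf; apply/eqP; rewrite eq_le f0// andbT leNgt.
apply/negP => fx; set mu := lebesgue_rV n in iw If.
have : \forall y \near x, w y /\ f x / 2 < f y.
  near=> y; split; first by near: y; exact: open_nbhs_nbhs.
  by near: y; apply: (cvgr_gt _ cf); rewrite ltr_pdivrMr// ltr_pMr// ltr1n.
move/nbhs_ballP => [r /= r0 rP].
pose c := x - const_mx r; pose d := x + const_mx r.
have cd : forall i, c ord0 i < d ord0 i by move=> i; rewrite !mxE; lra.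
have cdP y : box c d y -> w y /\ f x / 2 < f y.
  move=> ycd; apply: rP; rewrite -ball_normE /=; apply/rV_norm_ltP => // i.
  by have := ycd i; rewrite !mxE ltr_norml => /andP[? ?]; apply/andP; split; lra.
have mB : measurable (box c d) by exact: measurable_box.
have mB0 : 0 < fine (mu (box c d)).
  by apply: fine_gt0; rewrite lebesgue_rV_box_gt0//=; exact: lebesgue_rV_box_lty.
have : ((f x / 2)%:E * mu (box c d) <= \int[mu]_(y in w) (f y)%:E)%E.
  rewrite -integral_cst//.
  apply: (@le_trans _ _ (\int[mu]_(y in box c d) (f y)%:E)%E).
    apply: ge0_le_integral => //.
    - by move=> y _; rewrite lee_fin divr_ge0// ltW.
    - apply: measurable_funS (measurable_int _ iw) => //.
      by move=> y /cdP[].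
    - by move=> y /cdP[_ /ltW]; rewrite lee_fin.
  apply: ge0_subset_integral => //.
  - exact: measurable_int iw.
  - by move=> y /cdP[].
rewrite -(fineK (integrable_fin_num mw iw)) -/(Rintegral mu w f) If.
rewrite -(@fineK _ (mu (box c d))); last first.
  by rewrite ge0_fin_numE ?measure_ge0//; exact: lebesgue_rV_box_lty.
by rewrite -EFinM lee_fin leNgt mulr_gt0// divr_gt0.
Unshelve. all: by end_near.
Qed.

(** By the mean value theorem the two increments of m are h times values of m1 at points of ]0,
    h[ and ]-h, 0[, and m1 is constant on [-h, h]. *)
Lemma derive_derive_eq0_diff {R : realType} (m m1 : R -> R) (h : R) : 0 < h ->
  (forall t, is_derive t (1 : R) m (m1 t)) ->
  (forall t, `|t| <= h -> is_derive t (1 : R) m1 0) ->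
  m h + m (- h) = 2 * m 0.
Proof.
move=> h0 dm dm1.
have mc t : {for t, continuous m} by exact: is_derive_continuous1 (dm t).
have m1c t : `|t| <= h -> {for t, continuous m1}.
  by move=> th; exact: is_derive_continuous1 (dm1 t th).
have [c1 + E1] : exists2 c, c \in `]0, h[ & m h - m 0 = m1 c * (h - 0).
  apply: MVT => //; apply: continuous_subspaceT; exact: mc.
have [c2 + E2] : exists2 c, c \in `](- h), 0[ & m 0 - m (- h) = m1 c * (0 - - h).
  apply: MVT; rewrite ?oppr_lt0//; apply: continuous_subspaceT; exact: mc.
rewrite !in_itv/= => /andP[c21 c22] /andP[c11 c12].
have [c _] : exists2 c, c \in `]c2, c1[ & m1 c1 - m1 c2 = (fun=> 0) c * (c1 - c2).
  apply: (@MVT _ _ (fun=> 0)); first exact: lt_trans c22 c11.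
    move=> t; rewrite in_itv/= => /andP[t1 t2]; apply: dm1.
    by rewrite ler_norml; apply/andP; split; lra.
  apply: continuous_in_subspaceT => t; rewrite inE/= in_itv/= => /andP[t1 t2].
  by apply: m1c; rewrite ler_norml; apply/andP; split; lra.
rewrite mul0r => /eqP; rewrite subr_eq0 => /eqP E3.
by move: E1 E2; rewrite E3; lra.
Qed.

(** * Second differences *)

Section second_difference.
Context {R : realType} {n : nat}.
Variables (A : set 'rV[R]_n.+1) (u : 'rV[R]_n.+1 -> R).
Hypothesis cA : forall x y (t : R), A x -> A y -> 0 <= t <= 1 ->
  A (t *: x + (1 - t) *: y).
Hypothesis cu : forall x y (t : R), A x -> A y -> 0 <= t <= 1 ->
  u (t *: x + (1 - t) *: y) <= t * u x + (1 - t) * u y.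
Hypothesis oA : open A.
Variables (a b : 'rV[R]_n.+1) (rho M : R).
Hypothesis rho0 : 0 < rho.
Hypothesis uM : forall x y, box a b x -> `|y - x| <= rho -> A y /\ `|u y| <= M.
Local Notation e := (delta_mx ord0).
Local Notation mu := (lebesgue_rV (R := R) n.+1).
Let w := box a b.
Hypothesis weak2 : forall eta i, bump_in a b eta -> (forall j t, 0 <= eta j t) ->
  \int[mu]_(x in w) (u x * tensor (tensor_derive i (tensor_derive i eta)) x) = 0.

Let wA x : w x -> A x.
Proof. by move=> wx; have [|//] := @uM x x wx; rewrite subrr normr0 ltW. Qed.

Let uC x : A x -> {for x, continuous u}.
Proof. exact: convex_continuous. Qed.

Let mw : measurable w. Proof. exact: measurable_box. Qed.
Let ow : open w. Proof. exact: open_box. Qed.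

Let wAs x v : w x -> `|v| <= rho -> A (x + v).
Proof. by move=> wx vr; have [|//] := @uM x (x + v) wx; rewrite addrC addKr. Qed.

(** As a function of t, the integral of u against eta translated by t e_i has second derivative the
    integral of u against the second derivative of the translate. This vanishes while the translate
    stays in the box, and translating back moves the shift from eta to u. *)
Lemma second_difference_weak eta i : bump_in a b eta -> (forall j t, 0 <= eta j t) ->
  exists2 tau : R, 0 < tau & forall h, 0 < h <= tau ->
  \int[mu]_(x in w) (tensor eta x *
    (u (x + h *: e i) + u (x - h *: e i) - 2 * u x)) = 0.
Proof.
move=> eb eta0; have iu : mu.-integrable w (EFin \o u) := box_u_integrable cA cu oA rho0 uM.
have [tau tau0 tauP] := bump_in_shift eb; have [se _] := eb.
have db := bump_in_derive i eb; have [sd _] := db.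
have ddb := bump_in_derive i db.
have [C _ CP] := tensor_bounded eb; have [C1 _ C1P] := tensor_bounded db.
have [C2 _ C2P] := tensor_bounded ddb.
have ct := continuous_tensor se; have ct1 := continuous_tensor sd.
exists (Num.min tau rho); first by rewrite lt_min tau0.
move=> h /andP[h0]; rewrite le_min => /andP[htau hrho].
pose m (t : R) := \int[mu]_(x in w) (u x * tensor eta (x + t *: e i)).
pose m1 (t : R) := \int[mu]_(x in w) (u x * tensor (tensor_derive i eta) (x + t *: e i)).
have dm t : is_derive t (1 : R) m (m1 t).
  exact: is_derive_translate t mw iu ct CP (fun x => is_derive_tensor i x se) C1P.
have dm1 t : `|t| <= h -> is_derive t (1 : R) m1 0.
  move=> th.
  have := is_derive_translate t mw iu ct1 C1P (fun x => is_derive_tensor i x sd) C2P.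
  congr is_derive.
  have tb : bump_in a b (bump_shift (t *: e i) eta).
    by apply: tauP; rewrite norm_delta (le_trans th).
  have := @weak2 _ i tb (fun j s => eta0 _ _).
  rewrite bump_shift_derive// bump_shift_derive// => <-.
  by apply: eq_Rintegral => x _; rewrite tensor_bump_shift.
have := derive_derive_eq0_diff h0 dm dm1.
have shift (s : R) : `|s| <= h -> m s = \int[mu]_(x in w) (u (x - s *: e i) * tensor eta x).
  move=> sh; rewrite -(Rintegral_bump_shift eb); first by rewrite /m opprK.
  - by rewrite opprK; apply: tauP; rewrite norm_delta (le_trans sh).
  - by move=> x wx; exact/uC/wA.
  - by move=> x wx; apply/uC/wAs => //; rewrite normrN norm_delta (le_trans sh).
rewrite !shift ?normrN ?normr0 ?gtr0_norm ?(ltW h0)//.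
have iut (s : R) : `|s| <= h ->
    mu.-integrable w (EFin \o (fun x => tensor eta x * u (x - s *: e i))).
  move=> sh; have [_ etaw] := bump_in_test eb.
  apply: (mul_support_integrable ow mw etaw ct) => x wx.
  apply: continuous_at_shift; apply/uC/wAs => //.
  by rewrite normrN norm_delta (le_trans sh).
have ih : `|h| <= h by rewrite gtr0_norm.
have iNh : `|- h| <= h by rewrite normrN.
have i0 : `|0 : R| <= h by rewrite normr0 ltW.
move=> E; rewrite (_ : (fun x => _) = (fun x => (tensor eta x * u (x - h *: e i) +
  tensor eta x * u (x - (- h) *: e i)) - 2 * (tensor eta x * u (x - 0 *: e i)))).
  rewrite RintegralB//; [|by apply: real_integrableD; rewrite // iut|
    by apply: real_integrableZ; rewrite // iut].
  rewrite RintegralD ?iut// RintegralZl ?iut//.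
  apply/eqP; rewrite subr_eq0; apply/eqP; rewrite -[RHS]/(2 * _).
  have comm (s : R) : \int[mu]_(x in w) (tensor eta x * u (x - s *: e i)) =
      \int[mu]_(x in w) (u (x - s *: e i) * tensor eta x).
    by apply: eq_Rintegral => x _; rewrite mulrC.
  by rewrite !comm.
by apply/funext => x; rewrite scaleNr opprK scale0r subr0; ring.
Qed.

(** By convexity the second difference is nonnegative, and it is continuous; a zero integral against
    a bump that is positive at x forces it to vanish at x. *)
Lemma second_difference_eq0 x i : w x -> exists2 tau : R, 0 < tau &
  forall h, 0 < h <= tau -> u (x + h *: e i) + u (x - h *: e i) = 2 * u x.
Proof.
move=> wx.
pose k0 := \big[Num.min/1]_(j < n.+1) (Num.min (x ord0 j - a ord0 j) (b ord0 j - x ord0 j)).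
have k00 : 0 < k0.
  apply/bigmin_gtP; split=> // j _; have /andP[? ?] := wx j.
  by rewrite lt_min !subr_gt0; apply/andP.
have k0_le j : k0 <= x ord0 j - a ord0 j /\ k0 <= b ord0 j - x ord0 j.
  by apply/andP; rewrite -le_min; exact: bigmin_le_cond.
(* The bump is positive at distance more than 1/k = k0/2 from the faces, and x is at distance at
   least k0 from them. *)
pose k := 2 / k0; have k_gt0 : 0 < k by rewrite divr_gt0.
have kV : k^-1 = k0 / 2 by rewrite /k invf_div.
pose eta j := bump k (a ord0 j) (b ord0 j).
have eb : bump_in a b eta.
  split; first by move=> j; exact: smooth_bump.
  exists (a + const_mx k^-1), (b - const_mx k^-1); split.
    by move=> j; rewrite !mxE ltrDl gtrBl invr_gt0.
  by move=> j t et; rewrite !mxE; exact: bump_support et.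
have [tau tau0 tauP] := second_difference_weak i eb (fun j t => bump_ge0 _ _ _ _).
exists (Num.min tau rho); first by rewrite lt_min tau0.
move=> h /andP[h0]; rewrite le_min => /andP[htau hrho].
have htau' : 0 < h <= tau by rewrite h0.
have hn : `|h *: e i : 'rV[R]_n.+1| <= rho by rewrite norm_delta gtr0_norm.
have [_ etaw] := bump_in_test eb; have [se _] := eb.
have dC y : w y -> {for y, continuous (fun z : 'rV[R]_n.+1 =>
    u (z + h *: e i) + u (z - h *: e i) - 2 * u z)}.
  move=> wy; apply: continuous_atD; first apply: continuous_atD.
  - by apply/continuous_at_shift/uC/wAs.
  - by apply/continuous_at_shift/uC/wAs; rewrite ?normrN.
  - apply: continuous_atN; apply: continuous_atM; first exact: continuous_at_cst.
    exact/uC/wA.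
have := @continuous_Rintegral_eq0 _ _ w _ x ow mw
  (mul_support_integrable ow mw etaw (continuous_tensor se) dC) _ (tauP h htau') wx _.
have pos : 0 < tensor eta x.
  apply: prodr_gt0 => j _; apply: bump_gt0 => //.
  have [? ?] := k0_le j; rewrite kV; apply/andP; split; lra.
have d0 y : w y -> 0 <= u (y + h *: e i) + u (y - h *: e i) - 2 * u y.
  move=> wy; have := @cu (y + h *: e i) (y - h *: e i) 2^-1 (wAs wy hn).
  have -> : 2^-1 *: (y + h *: e i) + (1 - 2^-1) *: (y - h *: e i) = y.
    by apply/rowP => j; rewrite !mxE; field.
  move=> H; have := H _ _; rewrite ?normrN => /(_ (wAs wy _)).
  rewrite normrN => /(_ hn); have h2 : 0 <= (2^-1 : R) <= 1 by apply/andP; split; lra.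
  by move/(_ h2); lra.
move=> H; have : tensor eta x * (u (x + h *: e i) + u (x - h *: e i) - 2 * u x) = 0.
  apply: H.
  - move=> y wy; apply: mulr_ge0; last exact: d0.
    by apply: prodr_ge0 => j _; exact: bump_ge0.
  - apply: continuous_atM; last exact: dC.
    exact: continuous_tensor.
by move/eqP; rewrite mulf_eq0 (gt_eqF pos)/= subr_eq0 => /eqP.
Qed.

(* On the axes through x, u - u x is convex and odd, hence linear. Its slopes form
   a subgradient, which bounds u from below; the upper bound is convex_coord_split. *)
Lemma convex_locally_affine x : w x -> exists (g : 'rV[R]_n.+1),
  \forall y \near x, u y = u x + dotp g (y - x).
Proof.
move=> wx; have Ax := wA wx.
have /fin_all_exists[t tP] : forall i : 'I_n.+1, exists t : R, 0 < t /\
    forall h, 0 < h <= t -> u (x + h *: e i) + u (x - h *: e i) = 2 * u x.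
  by move=> i; have [t ? ?] := second_difference_eq0 i wx; exists t.
pose tau := Num.min rho (\big[Num.min/1]_(i < n.+1) t i).
have tau0 : 0 < tau.
  rewrite lt_min rho0; apply/bigmin_gtP; split=> // i _; by have [] := tP i.
have taut i : tau <= t i by rewrite ge_min; apply/orP; right; exact: bigmin_le_cond.
have taur : tau <= rho by rewrite ge_min lexx.
have dd i h : 0 < h <= tau -> u (x + h *: e i) + u (x - h *: e i) = 2 * u x.
  by move=> /andP[h0 ht]; apply: (tP i).2; rewrite h0 (le_trans ht).
have Al i s : `|s| <= tau -> A (x + s *: e i).
  by move=> st; apply: wAs => //; rewrite norm_delta (le_trans st).
pose g : 'rV[R]_n.+1 := \row_i ((u (x + tau *: e i) - u x) / tau).
have linep i s : 0 < s <= tau -> u (x + s *: e i) - u x = s * g ord0 i.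
  move=> sb; have /andP[s0 st] := sb; have tt : `|tau| <= tau by rewrite gtr0_norm.
  apply/eqP; rewrite eq_le; apply/andP; split.
    have := convex_slope_le cu Ax (Al i tau tt) sb.
    by rewrite ler_pdivrMr// mxE mulrC.
  have tt' : `|- tau| <= tau by rewrite normrN.
  (* The slope comparison in direction -e_i, reversed by the vanishing second difference, supplies
     the opposite inequality. *)
  have := convex_slope_le (v := - e i) cu Ax _ sb.
  rewrite !scalerN => /(_ _)/wrap[]; first by rewrite -scaleNr; exact: Al.
  rewrite ler_pdivrMr// mxE.
  have := dd i s sb; have := dd i tau; rewrite tau0 lexx => /(_ erefl) E1 E2.
  have -> : u (x - tau *: e i) - u x = - (u (x + tau *: e i) - u x) by lra.
  by rewrite mulNr (mulrC s); lra.
have line i s : `|s| <= tau -> u (x + s *: e i) = u x + s * g ord0 i.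
  move=> st; have [s0|s0|s0] := ltgtP 0 s; last 1 first.
  - by rewrite -s0 scale0r mul0r !addr0.
  - have sP : 0 < s <= tau by rewrite s0 -(gtr0_norm s0).
    by rewrite -linep// [RHS]addrC subrK.
  - have sN : 0 < - s <= tau by rewrite oppr_gt0 s0 -(ltr0_norm s0).
    have := linep i _ sN; have := dd i _ sN.
    by rewrite !scaleNr opprK mulNr; lra.
exists g; near=> y.
have yx : `|y - x| <= tau / n.+1%:R.
  rewrite -opprB normrN; near: y; apply/nbhs_ballP.
  exists (tau / n.+1%:R) => [|y]; first by rewrite /= divr_gt0.
  by rewrite -ball_normE => /ltW.
have Ay : A y.
  apply: (@uM x y wx _).1; rewrite (le_trans yx)// (le_trans _ taur)//.
  by rewrite ler_pdivrMr// ler_peMr ?ler1n// ltW.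
apply/eqP; rewrite eq_le; apply/andP; split; last first.
  apply: (convex_subgradient cA cu oA Ax) => // eps eps0; exists tau => // i s st.
  by rewrite line// addrAC subrr add0r lerDl mulr_ge0// ltW.
have nv i : `|n.+1%:R * (y - x) ord0 i| <= tau.
  rewrite normrM ger0_norm// mulrC -ler_pdivlMr//.
  exact: le_trans (coord_le_norm _ _) yx.
have := convex_coord_split cA cu (fun i => Al i _ (nv i)).
rewrite addrC subrK => /le_trans; apply.
under eq_bigr do rewrite line//.
rewrite big_split/= sumr_const card_ord mulrDr -[u x *+ _]mulr_natl mulrA mulVf ?mul1r//.
rewrite lerD2l mulr_sumr /dotp; apply: ler_sum => i _.
by rewrite !mulrA mulVf// mul1r mulrC.
Unshelve. all: by end_near.
Qed.

End second_difference.

(** * Euclidean balls *)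

Section ball.
Context {R : realType} {n : nat}.
Implicit Types (x y z c e : 'rV[R]_n) (A : set 'rV[R]_n).

(** The weak equation is posed on Lipschitz domains. For a Euclidean ball the inner normal serves as
    graph direction at each boundary point, without the case distinction at edges and corners of a
    box. *)
Definition eball c (r : R) : set 'rV[R]_n := [set x | enorm (x - c) < r].

Lemma ler_enormD x y : enorm (x + y) <= enorm x + enorm y.
Proof.
rewrite -ler_sqr ?nnegrE ?addr_ge0 ?enorm_ge0// sqrrD !sqr_enorm.
rewrite dotpDr !(dotpC (x + y)) !dotpDr (dotpC y x).
by have := dotp_le x y; rewrite mulr2n; lra.
Qed.

Lemma ler_dist_enorm x y : `|enorm x - enorm y| <= enorm (x - y).
Proof.
have h1 := ler_enormD (x - y) y; have h2 := ler_enormD (y - x) x.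
have h3 : enorm (y - x) = enorm (x - y).
  by rewrite -opprB -scaleN1r enormZ normrN1 mul1r.
rewrite !subrK h3 in h1 h2.
by rewrite ler_norml; apply/andP; split; lra.
Qed.

Lemma continuous_enorm : continuous (@enorm R n).
Proof.
move=> x; apply/continuous_at_normP => d d0.
have s0 : 0 < Num.sqrt (n%:R : R) + 1 by rewrite ltr_wpDl// sqrtr_ge0.
exists (d / (Num.sqrt n%:R + 1)); first by rewrite divr_gt0.
move=> y yx; rewrite (le_lt_trans (ler_dist_enorm _ _))//.
rewrite (le_lt_trans (enorm_le _))//.
move: yx; rewrite ltr_pdivlMr// mulrC; apply: le_lt_trans.
by rewrite ler_wpM2r// lerDl.
Qed.

Lemma convex_connected A : (forall x y (t : R), A x -> A y -> 0 <= t <= 1 ->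
  A (t *: x + (1 - t) *: y)) -> connected A.
Proof.
move=> cA; have [->|/set0P[x Ax]] := eqVneq A set0; first exact: connected0.
have -> : A = \bigcup_(y in A) ((fun t : R => t *: x + (1 - t) *: y) @` `[0, 1]).
  apply/seteqP; split => [y Ay|y [z Az [t /=]]].
    exists y => //; exists 0 => /=; first by rewrite in_itv/= lexx ler01.
    by rewrite scale0r add0r subr0 scale1r.
  by rewrite in_itv/= => t01 <-; exact: cA.
apply: bigcup_connected.
  exists x => y Ay; exists 1 => /=; first by rewrite in_itv/= lexx ler01.
  by rewrite scale1r subrr scale0r addr0.
move=> y Ay; apply: connected_continuous_connected; first exact: segment_connected.
apply: continuous_subspaceT => t; apply: cvgD; apply: cvgZr_tmp.
  exact: cvg_id.
by apply: cvgB; [exact: cvg_cst|exact: cvg_id].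
Qed.

Lemma open_eball c (r : R) : open (eball c r).
Proof.
rewrite openE => x /= xc.
have cf : {for x, continuous (fun y : 'rV[R]_n => enorm (y - c))}.
  exact/continuous_at_shift/continuous_enorm.
exact: (cvgr_lt _ cf).
Qed.

Lemma eball_domain c (r : R) : 0 < r -> domain (eball c r).
Proof.
move=> r0; split; first by exists c; rewrite /eball /= subrr enorm0.
  exact: open_eball.
apply: convex_connected => x y t; rewrite /eball /= => xr yr /andP[t0 t1].
have -> : t *: x + (1 - t) *: y - c = t *: (x - c) + (1 - t) *: (y - c).
  by apply/rowP => i; rewrite !mxE; ring.
rewrite (le_lt_trans (ler_enormD _ _))// !enormZ (ger0_norm t0) ger0_norm ?subr_ge0//.
have [t_eq|t_neq] := eqVneq t 0; first by rewrite t_eq mul0r subr0 mul1r add0r.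
have {}t0 : 0 < t by rewrite lt0r t_neq.
have h1 : t * enorm (x - c) < t * r by rewrite ltr_pM2l.
have h2 : (1 - t) * enorm (y - c) <= (1 - t) * r by rewrite ler_wpM2l ?subr_ge0// ltW.
lra.
Qed.

Lemma eball_sub_cbox c (r : R) : eball c r `<=` cbox (c - const_mx r) (c + const_mx r).
Proof.
move=> x /= xc i; have := le_lt_trans (coord_le_enorm (x - c) i) xc.
by rewrite !mxE ltr_norml => /andP[? ?]; apply/andP; split; lra.
Qed.

Lemma eball_bounded c (r : R) : bounded_set (eball c r).
Proof.
apply: (@filterS _ _ _ [set M | `|c| + r <= M]); last first.
  exact: nbhs_pinfty_ge (num_real _).
move=> M /= cM x /= xc; apply: le_trans cM.
rewrite -[x](subrK c) addrC (le_trans (ler_normD _ _))// lerD2l.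
exact: le_trans (enorm_le_norm _) (ltW xc).
Qed.

Lemma lipschitz_of_bound A (g : 'rV[R]_n -> R) (K : R) :
  (forall y z, A y -> A z -> `|g y - g z| <= K * `|y - z|) ->
  [lipschitz g y | y in A].
Proof.
move=> gK; apply: (@filterS _ _ _ [set M | K <= M]); last first.
  exact: nbhs_pinfty_ge (num_real _).
move=> M /= KM [y z] [/= Ay Az].
by rewrite (le_trans (gK y z Ay Az))// ler_wpM2r.
Qed.

(** For the roots s, t and the capped values m, l, (s - t)(s + t) = (l - m)(l + m); the cap gives l
    + m <= r <= s + t, hence Lipschitz constant 1. *)
Lemma sqrt_cap_lipschitz (r h k : R) : 0 < r -> 0 <= h -> 0 <= k ->
  `|Num.sqrt (r ^+ 2 - Num.min h (r / 2) ^+ 2) -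
    Num.sqrt (r ^+ 2 - Num.min k (r / 2) ^+ 2)| <= `|h - k|.
Proof.
move=> r0 h0 k0.
set m := Num.min h _; set l := Num.min k _.
have mb : 0 <= m <= r / 2 by rewrite /m le_min h0 ge_min lexx orbT divr_ge0// ltW.
have lb : 0 <= l <= r / 2 by rewrite /l le_min k0 ge_min lexx orbT divr_ge0// ltW.
have ml : `|m - l| <= `|h - k|.
  rewrite /m /l; case: (leP h (r / 2)) => h1; case: (leP k (r / 2)) => h2 //.
  - rewrite !ler0_norm ?subr_le0 ?(le_trans h1 (ltW h2))//; lra.
  - by rewrite !ger0_norm ?subr_ge0 ?(le_trans h2 (ltW h1))//; lra.
  - by rewrite subrr normr0.
apply: le_trans ml; set s := Num.sqrt _; set t := Num.sqrt _.
have low (v : R) : 0 <= v <= r / 2 -> r / 2 <= Num.sqrt (r ^+ 2 - v ^+ 2) /\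
    Num.sqrt (r ^+ 2 - v ^+ 2) ^+ 2 = r ^+ 2 - v ^+ 2.
  move=> /andP[v0 vr].
  have v2 : v ^+ 2 <= (r / 2) ^+ 2 by rewrite lerXn2r ?nnegrE// divr_ge0// ltW.
  have q : (r / 2) ^+ 2 <= r ^+ 2 - v ^+ 2.
    have := sqr_ge0 r; have E : (r / 2) ^+ 2 = r ^+ 2 / 4 by field.
    by rewrite E in v2 *; lra.
  split; last by rewrite sqr_sqrtr// (le_trans (sqr_ge0 _) q).
  rewrite -[leLHS]ger0_norm ?divr_ge0 ?(ltW r0)// -sqrtr_sqr ler_sqrt//.
  by rewrite (le_trans (sqr_ge0 _) q).
have [s1 s2] := low m mb; have [t1 t2] := low l lb.
have E : (s - t) * (s + t) = (l - m) * (l + m).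
  by rewrite -!subr_sqr /s /t s2 t2; ring.
have st : r <= s + t by rewrite /s /t; lra.
have lm : 0 <= l + m <= r by move: mb lb => /andP[? ?] /andP[? ?]; apply/andP; split; lra.
have st0 : 0 < s + t by exact: lt_le_trans st.
rewrite -(ler_pM2r st0) -[X in _ * X <= _](gtr0_norm st0) -normrM E normrM distrC.
have /andP[lm0 lmr] := lm.
by rewrite (ger0_norm lm0) ler_wpM2l// (le_trans lmr st).
Qed.

(** With e the inner normal at x0 and [P] the projection orthogonal to e, the ball near x0 lies
    above the hemisphere [g]. There |P x - P c| < r/2, so the cap is inactive, and Pythagoras turns
    the graph condition into |x - c| < r. *)
Lemma eball_lipschitz c (r : R) : 0 < r -> lipschitz_boundary (eball c r).
Proof.
move=> r0 x0 [clx0 nix0].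
have cE x : {for x, continuous (fun y : 'rV[R]_n => enorm (y - c))}.
  exact/continuous_at_shift/continuous_enorm.
have x0r : enorm (x0 - c) = r.
  apply/eqP; rewrite eq_le; apply/andP; split; last first.
    by rewrite leNgt; apply/negP => h; apply: nix0; exact: open_eball.
  rewrite leNgt; apply/negP => h.
  have [y [/= yr]] := clx0 _ (cvgr_gt _ (cE x0) _ h).
  by rewrite ltNge (ltW yr).
have [e Pe] : exists e, x0 - c = - (r *: e).
  exists (r^-1 *: (c - x0)).
  by rewrite scalerA mulfV ?gt_eqF// scale1r opprB.
pose P y : 'rV[R]_n := y - dotp y e *: e.
have e1 : enorm e = 1.
  move: x0r; rewrite Pe -scaleNr enormZ normrN gtr0_norm// => h.
  by apply: (mulfI (lt0r_neq0 r0)); rewrite h mulr1.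
have ee : dotp e e = 1 by rewrite -sqr_enorm e1 expr1n.
(* The cap r / 2 keeps the hemisphere below Lipschitz. *)
pose m y := Num.min (enorm (y - P c)) (r / 2).
pose g y := dotp c e - Num.sqrt (r ^+ 2 - m y ^+ 2).
exists e, g; split => //.
  (* The factor sqrt n converts the Euclidean norm into the max norm used by the Lipschitz
     predicate. *)
  apply: (@lipschitz_of_bound _ _ (Num.sqrt n%:R)) => y z _ _.
  have -> : g y - g z = Num.sqrt (r ^+ 2 - m z ^+ 2) - Num.sqrt (r ^+ 2 - m y ^+ 2).
    by rewrite /g; ring.
  rewrite (le_trans (sqrt_cap_lipschitz r0 (enorm_ge0 _) (enorm_ge0 _)))//.
  apply: le_trans (ler_dist_enorm _ _) _.
  have -> : z - P c - (y - P c) = -1 *: (y - z).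
    by apply/rowP => i; rewrite !mxE; ring.
  by rewrite enormZ normrN1 mul1r enorm_le.
have PB x : P x - P c = (x - c) - dotp (x - c) e *: e.
  by rewrite /P dotpBl scalerBl; apply/rowP => i; rewrite !mxE; ring.
have pyth x : dotp (x - c) (x - c) = enorm (P x - P c) ^+ 2 + dotp (x - c) e ^+ 2.
  rewrite PB; move: (x - c) => v.
  by rewrite sqr_enorm dotpBr !dotpBl !dotpZr !dotpZl ee (dotpC e v); ring.
have cd : {for x0, continuous (fun y : 'rV[R]_n => dotp (y - c) e)}.
  apply: continuous_at_sum => i; apply: continuous_atM; last exact: continuous_at_cst.
  by apply: (continuous_at_shift (f := fun y : 'rV[R]_n => y ord0 i)); exact: continuous_at_coord.
have cP : {for x0, continuous (fun y : 'rV[R]_n => enorm (P y - P c) ^+ 2)}.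
  have -> : (fun y => enorm (P y - P c) ^+ 2) =
      (fun y : 'rV[R]_n => enorm (y - c) * enorm (y - c) + - (dotp (y - c) e * dotp (y - c) e)).
    by apply/funext => y; rewrite -!expr2 (sqr_enorm (y - c)) pyth addrK.
  apply: continuous_atD; first by apply: continuous_atM; exact: cE.
  by apply: continuous_atN; apply: continuous_atM.
have d0 : dotp (x0 - c) e = - r by rewrite Pe -scaleNr dotpZl ee mulr1.
have P0 : enorm (P x0 - P c) ^+ 2 = 0.
  by have := pyth x0; rewrite -sqr_enorm x0r d0 sqrrN; lra.
near=> x.
have dx : dotp (x - c) e < 0.
  by near: x; apply: (cvgr_lt _ cd); rewrite d0 oppr_lt0.
have Px : enorm (P x - P c) ^+ 2 < (r / 2) ^+ 2.
  by near: x; apply: (cvgr_lt _ cP); rewrite P0 exprn_gt0// divr_gt0.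
have {}Px : enorm (P x - P c) < r / 2.
  by move: Px; rewrite ltr_pXn2r// ?nnegrE ?enorm_ge0// divr_ge0// ltW.
have mx : m (P x) = enorm (P x - P c) by apply/min_idPl/ltW.
have pos : 0 < r ^+ 2 - m (P x) ^+ 2.
  rewrite mx subr_gt0 ltr_pXn2r ?nnegrE ?enorm_ge0 ?(ltW r0)//.
  by rewrite (lt_trans Px)// ltr_pdivrMr// ltr_pMr// ltr1n.
have -> : (g (x - dotp x e *: e) < dotp x e) = (enorm (x - c) < r).
  have E : dotp c e - dotp x e = Num.sqrt (dotp (x - c) e ^+ 2).
    by rewrite sqrtr_sqr ltr0_norm// dotpBl opprB.
  rewrite /g -/(P x) ltrBlDr -ltrBlDl E ltr_sqrt// mx ltrBrDl -pyth -sqr_enorm.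
  rewrite ltr_pXn2r ?nnegrE ?enorm_ge0//.
  exact: ltW.
by [].
Unshelve. all: by end_near.
Qed.

Lemma eball_bounded_lipschitz_domain c (r : R) : 0 < r ->
  bounded_lipschitz_domain (eball c r).
Proof.
by move=> r0; split; [exact: eball_domain|exact: eball_bounded|exact: eball_lipschitz].
Qed.

End ball.

Lemma compactly_contained_sub {R : realType} {n : nat} (A B U : set 'rV[R]_n) :
  A `<=` B -> compactly_contained B U -> compactly_contained A U.
Proof.
move=> AB [cB BU]; have cAB := closureS AB; split; last exact: subset_trans BU.
exact: subclosed_compact (@closed_closure _ A) cB cAB.
Qed.

(** * Product test functions in Sobolev spaces *)

Section Lp.
Context {R : realType} {n : nat}.
Local Notation mu := (lebesgue_rV (R := R) n).
Implicit Types (w : set 'rV[R]_n) (f : 'rV[R]_n -> R).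

Lemma Lp_on_measurable w q f : measurable w -> Lp_on w q f -> measurable_fun w f.
Proof.
move=> mw; rewrite /Lp_on inE => /andP[+ _]; rewrite inE/= => mf.
exact/measurable_restrictT.
Qed.

(** On a set of finite measure |f| <= 1 + |f|^p is an integrable bound. *)
Lemma Lp_on_integrable w (p : R) f : measurable w -> (mu w < +oo)%E -> 1 <= p ->
  Lp_on w p%:E f -> mu.-integrable w (EFin \o f).
Proof.
move=> mw woo p1 fp; have mf := Lp_on_measurable mw fp.
have ip : mu.-integrable w (EFin \o (fun x => `|(f \_ w) x| `^ p)).
  exact: integrableS measurableT mw (@subsetT _ w) (Lfun_integrable p1 fp).
have i1 : mu.-integrable w (EFin \o (fun=> 1 : R)).
  by apply: (@bounded_integrable _ _ _ _ 1) => // x _; rewrite normr1.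
apply: le_integrable (real_integrableD mw i1 ip) => //; first exact/measurable_EFinP.
move=> x wx /=; rewrite patchE mem_set//= lee_fin [leRHS]ger0_norm ?addr_ge0 ?powR_ge0//.
have [f1|f1] := leP `|f x| 1; first by rewrite (le_trans f1)// lerDl powR_ge0.
rewrite -[leLHS]powRr1// (@le_trans _ _ (`|f x| `^ p)) ?lerDr//.
by apply: ler_powR => //; exact: ltW.
Qed.

Lemma bounded_Lp_on w (p : R) f (C r : R) : measurable w -> 1 <= p ->
  measurable_fun w f -> (forall x, w x -> `|f x| <= C) ->
  (forall x, f x != 0 -> box (const_mx (- r)) (const_mx r) x) ->
  Lp_on w p%:E f.
Proof.
move=> mw p1 mf fC fr; have mfw : measurable_fun setT (f \_ w).
  exact: (measurable_restrictT f mw).1.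
have p0 : 0 < p := lt_le_trans ltr01 p1.
rewrite /Lp_on inE; apply/andP; split; rewrite inE//=.
rewrite /finite_norm unlock /Lnorm poweR_lty//=.
pose g x := `|(f \_ w) x| `^ p.
have ig : mu.-integrable setT (EFin \o g).
  apply: (@support_integrable _ _ _ _ (`|C| `^ p) r) => //.
  - apply: (@measurableT_comp _ _ _ _ _ _ (fun t : R => t `^ p)) => //.
    exact: measurableT_comp.
  - move=> x _; rewrite ger0_norm ?powR_ge0//; apply: ge0_ler_powR; rewrite ?nnegrE ?(ltW p0)//.
    rewrite patchE; case: ifPn => [/set_mem wx|_]; last by rewrite normr0 normr_ge0.
    exact: le_trans (fC x wx) (ler_norm _).
  - move=> x _; rewrite /g patchE; case: ifPn => [_|_].
      by move=> h; apply: fr; apply: contra_neq h => ->; rewrite normr0 powR0// gt_eqF.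
    by rewrite normr0 powR0 ?eqxx// gt_eqF.
have := integrable_lty measurableT ig.
by [].
Qed.

(** The constant sequence approximates the test function, and its classical gradient is the weak one
    by integration by parts. *)
Lemma sobolev0_tensor (om : set 'rV[R]_n) (a b : 'rV[R]_n) (p : R)
    (eta : 'I_n -> R -> R) : open om -> box a b `<=` om -> 1 <= p ->
  bump_in a b eta -> sobolev0 om p (tensor eta) (tensor_gradient eta).
Proof.
move=> oom abom p1 eb; have [se _] := eb.
have mom : measurable om by exact: open_rV_measurable.
have [Ck etaab] := bump_in_test eb.
have etaom : compactly_contained [set x | tensor eta x != 0] om.
  by case: etaab => h1 h2; split=> //; exact: subset_trans abom.
have Lp xi : bump_in a b xi -> Lp_on om p%:E (tensor xi).
  move=> xb; have [C _ CP] := tensor_bounded xb.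
  have [r _ rP] := compactly_contained_box (bump_in_test xb).2.
  have [sx _] := xb.
  apply: (@bounded_Lp_on _ _ _ C r) => //; apply: measurable_continuous => //.
  exact: continuous_tensor.
have gradE i : (fun x => tensor_gradient eta x ord0 i) = tensor (tensor_derive i eta).
  by apply/funext => x; rewrite mxE.
split; first split.
- exact: Lp.
- by move=> i; rewrite gradE; apply: Lp; exact: bump_in_derive.
- move=> phi i [phik _]; have [cphi /(_ i)[dphi cdphi]] := phik 1%N.
  under [in RHS]eq_Rintegral do rewrite mxE.
  apply: (Rintegral_by_parts oom etaom (continuous_tensor se)
    (fun x => is_derive_tensor i x se)).
  + exact: continuous_tensor (tensor_derive_smooth i se).
  + by move=> x _; exact: cphi.
  + by move=> x _; split => //; exact: dphi.
  + by move=> x _; case: cdphi => + _; apply.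
- have L0 (f : 'rV[R]_n -> R) : cvg_Lp om p (fun=> f) f.
    rewrite /cvg_Lp; have -> : (fun k : nat => Lnorm mu p%:E (EFin \o (f \- f) \_ om)) = fun=> 0%E.
      apply/funext => k; rewrite (_ : EFin \o _ = cst 0%E).
        by rewrite Lnorm0// eqe gt_eqF// (lt_le_trans ltr01).
      by apply/funext => x /=; rewrite patchE; case: ifP => // _ /=; rewrite subrr.
    exact: cvg_cst.
  exists (fun=> tensor eta); split => //.
  by move=> i; rewrite gradE partial_tensor//; exact: L0.
Qed.

End Lp.

(** [G] and [Z] are chosen before the box [l], [h], since the two nested cubes used later must share
    the same gradient field. *)
Lemma weak_solution_ball {R : realType} {n : nat} (b p : R) (Omega : set 'rV[R]_n)
    u c (r : R) : 1 < p -> weak_solution b p Omega u -> 0 < r ->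
  compactly_contained (eball c r) Omega ->
  exists G Z : 'rV[R]_n -> 'rV[R]_n, forall l h,
  box l h `<=` eball c r ->
  [/\ forall i, (lebesgue_rV n).-integrable (box l h) (EFin \o (fun x => G x ord0 i)),
      forall i eta, bump_in l h eta ->
        \int[lebesgue_rV n]_(x in box l h) (u x * tensor (tensor_derive i eta) x) =
        - \int[lebesgue_rV n]_(x in box l h) (G x ord0 i * tensor eta x),
      {ae lebesgue_rV n, forall x, box l h x -> subdifferential enorm (G x) (Z x)},
      forall i, measurable_fun (box l h) (fun x => Z x ord0 i) &
      forall eta, bump_in l h eta ->
        b * \int[lebesgue_rV n]_(x in box l h) dotp (Z x) (tensor_gradient eta x) +
        \int[lebesgue_rV n]_(x in box l h) dotp (pflux p (G x)) (tensor_gradient eta x) = 0].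
Proof.
move=> p1 [G sobG weak] r0 ccO.
have oB : open (eball c r) by exact: open_eball.
have [Z [ZL ZG Zweak]] := weak _ (eball_bounded_lipschitz_domain c r0) ccO.
exists G, Z => l h lhB.
have mB : measurable (eball c r) by exact: open_rV_measurable.
have mw : measurable (box l h) by exact: measurable_box.
have [_ GL Gweak] := sobG _ (open_box (a := l) (b := h)) (compactly_contained_sub lhB ccO).
split.
- move=> i; apply: (Lp_on_integrable mw _ (ltW p1) (GL i)).
  exact: lebesgue_rV_box_lty.
- move=> i eta eb; have [se _] := eb.
  by rewrite -(Gweak _ _ (bump_in_test eb)) partial_tensor.
- by apply: filterS ZG => x H /lhB.
- move=> i; apply: measurable_funS (Lp_on_measurable mB (ZL i)) => //.
- move=> eta eb; have [se _] := eb.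
  rewrite -[RHS](Zweak _ _ (sobolev0_tensor oB lhB (ltW p1) eb)).
  (* The gradient of the bump vanishes outside the box, so integrals over the ball reduce to the
     box. *)
  have grad0 x : ~ box l h x -> tensor_gradient eta x = 0.
    move=> nx; apply/rowP => i; rewrite !mxE; apply/eqP/negPn/negP => ex.
    apply: nx; have [_ [_ etaw]] := bump_in_test (bump_in_derive i eb).
    by apply: etaw; exact: subset_closure.
  have E (F : 'rV[R]_n -> 'rV[R]_n) :
      \int[lebesgue_rV n]_(x in box l h) dotp (F x) (tensor_gradient eta x) =
      \int[lebesgue_rV n]_(x in eball c r) dotp (F x) (tensor_gradient eta x).
    have supp x : dotp (F x) (tensor_gradient eta x) != 0 -> box l h x.
      by move=> Fx; apply: contrapT => nx; move: Fx; rewrite grad0// dotp0 eqxx.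
    rewrite (Rintegral_support supp) (@Rintegral_support _ _ (eball c r))//.
    by move=> x /supp /lhB.
  by rewrite !E.
Qed.

(** * From local to global affinity *)

(** Comparing the values at z and at z + t (g - h), for a small t > 0, gives t |g - h|^2 = 0. *)
Lemma affine_near_eq {R : realType} {n : nat} (g h z : 'rV[R]_n) (c d : R) :
  (\forall y \near z, dotp g y + c = dotp h y + d) -> g = h /\ c = d.
Proof.
move=> gh; have /nbhs_ballP[r /= r0 rP] := gh.
pose v := g - h; pose t := r / (`|v| + 1).
have v1 : 0 < `|v| + 1 by rewrite ltr_wpDl.
have t0 : 0 < t by rewrite divr_gt0.
have E1 := nbhs_singleton gh.
have E2 : dotp g (z + t *: v) + c = dotp h (z + t *: v) + d.
  apply: rP; rewrite -ball_normE /= opprD addNKr normrN normrZ gtr0_norm//.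
  by rewrite /t mulrAC ltr_pdivrMr// ltr_pM2l// ltrDl ltr01.
have : t * dotp v v = 0.
  rewrite /v dotpBl -/v mulrBr -!dotpZr.
  by move: E1 E2; rewrite !dotpDr; lra.
move/eqP; rewrite mulf_eq0 (gt_eqF t0)/= => /eqP /dotpp_eq0 /eqP.
rewrite subr_eq0 => /eqP ghE; split=> //.
by move: E1; rewrite ghE; lra.
Qed.

(** The points near which u coincides with the affine function found at x0 form an open set that is
    also closed in C: at a limit point the local affine function agrees with that one on a nonempty
    open set, hence equals it. *)
Lemma connected_affine {R : realType} {n : nat} (C : set 'rV[R]_n) (u : 'rV[R]_n -> R) :
  connected C ->
  (forall x, C x -> exists g : 'rV[R]_n, \forall y \near x, u y = u x + dotp g (y - x)) ->
  affine_on C u.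
Proof.
move=> cC loc; have [->|/set0P[x0 Cx0]] := eqVneq C set0; first by exists 0, 0.
have aff x : C x -> exists g : 'rV[R]_n, exists c, \forall y \near x, u y = dotp g y + c.
  move=> Cx; have [g gP] := loc x Cx; exists g, (u x - dotp g x).
  by apply: filterS gP => y ->; rewrite dotpBr; ring.
have [g [c gc]] := aff x0 Cx0.
pose S := [set x : 'rV[R]_n | \forall y \near x, u y = dotp g y + c].
have oS : open S.
  by rewrite openE => x /= Sx; exact: nbhs_interior Sx.
have SE : C `&` S = C.
  apply: cC; [by exists x0|by exists S|exists (closure S); first exact: closed_closure].
  apply/seteqP; split => x [Cx Sx]; split => //; first exact: subset_closure.
  have [h [d hd]] := aff x Cx.
  have [z [Sz zx]] := Sx _ (nbhs_interior hd).
  rewrite /S /=; have [-> ->] : g = h /\ c = d.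
    apply: (@affine_near_eq _ _ _ _ z).
    by apply: filterS2 Sz zx => y <-.
  exact: hd.
exists g, c => x Cx; have [_ /nbhs_singleton] : (C `&` S) x by rewrite SE.
by [].
Qed.

(** * Affinity near a non-minimal point *)

Section convex_solution.
Context {R : realType} {n : nat}.
Variables (b p : R) (Omega : set 'rV[R]_n.+1) (u : 'rV[R]_n.+1 -> R).
Hypothesis b0 : 0 < b.
Hypothesis p1 : 1 < p.
Hypothesis oO : open Omega.
Hypothesis cA : forall x y (t : R), Omega x -> Omega y -> 0 <= t <= 1 ->
  Omega (t *: x + (1 - t) *: y).
Hypothesis cu : forall x y (t : R), Omega x -> Omega y -> 0 <= t <= 1 ->
  u (t *: x + (1 - t) *: y) <= t * u x + (1 - t) * u y.
Hypothesis weak : weak_solution b p Omega u.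

Lemma locally_affine x0 y1 : Omega x0 -> Omega y1 -> u y1 < u x0 ->
  exists g : 'rV[R]_n.+1, \forall y \near x0, u y = u x0 + dotp g (y - x0).
Proof.
move=> Ox0 Oy1 uy1.
have [r0 [M [r00 r0P]]] := convex_locally_bounded cA cu oO Ox0.
(* Half of the gap absorbs the variation of u near x0; the other half remains between u near x0 and
   u y1. *)
pose kappa := (u x0 - u y1) / 2.
have kappa0 : 0 < kappa by rewrite divr_gt0// subr_gt0.
have [d /= d0 dP] : exists2 d : R, 0 < d & forall x, `|x - x0| < d -> u y1 + kappa <= u x.
  have /continuous_at_normP/(_ kappa kappa0)[d d0 dP] := convex_continuous cA cu oO Ox0.
  exists d => // x /dP; rewrite ltr_norml => /andP[h _]; rewrite /kappa in h *; lra.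
(* The factor 2 leaves a margin r: points within r of a point of the cube still lie where u is
   bounded by M. *)
pose r := Num.min r0 d / 2; have r_gt0 : 0 < r by rewrite divr_gt0// lt_min r00.
have rr0 : 2 * r <= r0 by rewrite /r mulrC divfK// ge_min lexx.
have rd : 2 * r <= d by rewrite /r mulrC divfK// ge_min lexx orbT.
have ccO : compactly_contained (eball x0 r) Omega.
  apply: compactly_contained_cbox (@eball_sub_cbox _ _ x0 r) _ => x xr.
  apply: (r0P x _).1; apply: (@le_trans _ _ r); last by lra.
  apply/rV_norm_leP => [|i]; first exact: ltW.
  by have := xr i; rewrite !mxE ler_norml => /andP[? ?]; apply/andP; split; lra.
have [G [Z GZ]] := weak_solution_ball p1 weak r_gt0 ccO.
(* A cube of half-width s = r/K lies in the Euclidean ball of radius r, because the Euclidean norm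
   is at most sqrt(n+1) times the max norm. *)
pose K : R := Num.sqrt n.+1%:R + 1.
have K0 : 0 < K by rewrite ltr_wpDl// sqrtr_ge0.
pose s := r / K; have s0 : 0 < s by rewrite divr_gt0.
have sr : s <= r by rewrite ler_pdivrMr// ler_peMr ?(ltW r_gt0)// lerDr sqrtr_ge0.
pose cube (t : R) := box (x0 - const_mx t) (x0 + const_mx t).
have cubeP t x : 0 < t -> cube t x -> `|x - x0| < t.
  move=> t0 xt; apply/rV_norm_ltP => // i; have := xt i.
  by rewrite !mxE ltr_norml => /andP[? ?]; apply/andP; split; lra.
have cube_ball t : 0 < t -> t <= s -> cube t `<=` eball x0 r.
  move=> t0 ts x /(cubeP _ _ t0) xt; rewrite /eball /=.
  rewrite (le_lt_trans (enorm_le _))// (@le_lt_trans _ _ (Num.sqrt n.+1%:R * s))//.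
    by rewrite ler_wpM2l ?sqrtr_ge0// ltW// (lt_le_trans xt).
  by rewrite /s mulrA ltr_pdivrMr// mulrC ltr_pM2l// ltrDl.
have [iG Gweak _ _ _] := GZ _ _ (cube_ball s s0 (lexx s)).
have s20 : 0 < s / 2 by rewrite divr_gt0.
have s2s : s / 2 <= s by rewrite ler_pdivrMr// ler_pMr// ler1n.
(* The equation is tested on the inner cube, whose closure lies in the outer one: the approximation
   needs a compact box surrounded by good points. *)
have [iG' _ subdiff mZ Zweak] := GZ _ _ (cube_ball (s / 2) s20 s2s).
have uM x y : cube s x -> `|y - x| <= r -> Omega y /\ `|u y| <= M.
  move=> /(cubeP _ _ s0) xs yx; apply: r0P.
  by rewrite -(subrK x y) -addrA (le_trans (ler_normD _ _))//; lra.
have good := ae_good cA cu oO r_gt0 uM iG Gweak.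
have sub : cbox (x0 - const_mx (s / 2)) (x0 + const_mx (s / 2)) `<=` cube s.
  by move=> x xs i; have := xs i; rewrite !mxE => /andP[? ?]; apply/andP; split; lra.
have cx0 t : 0 < t -> cube t x0.
  by move=> t0 i; rewrite !mxE; apply/andP; split; lra.
have ne : cube (s / 2) !=set0 by exists x0; exact: cx0.
have uk x : cube s x -> u y1 + kappa <= u x.
  by move=> /(cubeP _ _ s0) xs; apply: dP; lra.
have mG i : measurable_fun (cube (s / 2)) (fun x => G x ord0 i).
  by have /measurable_int/measurable_EFinP := iG' i.
have weak2 := weak_second_derivative_eq0 cA cu oO r_gt0 uM good sub ne kappa0 Oy1 uk
  b0 p1 mG subdiff mZ Zweak.
have uM' x y : cube (s / 2) x -> `|y - x| <= r -> Omega y /\ `|u y| <= M.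
  by move=> xs; apply: uM; apply: sub => i; have /andP[/ltW -> /ltW ->] := xs i.
by rewrite /cube in uM'; apply: (convex_locally_affine cA cu oO r_gt0 uM' weak2); exact: cx0.
Qed.

End convex_solution.

Lemma convex_functionP {R : realType} {n : nat} (A : set 'rV[R]_n) u :
  convex_set A -> convex_function A u ->
  (forall x y (t : R), A x -> A y -> 0 <= t <= 1 -> A (t *: x + (1 - t) *: y)) /\
  (forall x y (t : R), A x -> A y -> 0 <= t <= 1 ->
    u (t *: x + (1 - t) *: y) <= t * u x + (1 - t) * u y).
Proof.
move=> cA cu; split => x y t Ax Ay /andP[t0 t1].
  have := cA x y (Itv01 t0 t1) (mem_set Ax) (mem_set Ay).
  by rewrite inE.
exact: (cu (Itv01 t0 t1) x y (mem_set Ax) (mem_set Ay)).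
Qed.

Theorem theorem2 (R : realType) (n : nat) (b p : R)
    (Omega : set 'rV[R]_n) (u : 'rV[R]_n -> R) :
  0 < b -> 1 < p ->
  domain Omega -> convex_set Omega ->
  convex_function Omega u ->
  weak_solution b p Omega u ->
  let F := facet Omega u in
  let D := Omega `\` F in
  [/\ open D,
      forall x, D x -> affine_on (connected_component D x) u &
      F = set0 -> affine_on Omega u].
Proof.
move=> b0 p1 [_ oO conO] cO cuO weak F D.
have [cA cu] := convex_functionP cO cuO.
(* In dimension 0 the only point is minimal, so D is empty and u is constant on [Omega]; the
   preceding sections work in dimension n+1, by which [convex_coord_split] divides. *)
case: n => [|n] in Omega u oO conO cO cuO weak F D cA cu *.
  have D0 : D = set0.
    by apply/seteqP; split => // x [Ox]; apply; split => // y _;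
      rewrite !(thinmx0 y) !(thinmx0 x).
  split; first by rewrite D0; exact: open0.
    by rewrite D0.
  move=> _; exists 0, (u 0) => x _; by rewrite (thinmx0 x) dotp0 add0r.
(* A point off the facet comes with a strictly lower point of [Omega], the [y1] of
   [locally_affine]. *)
have DP x : D x -> Omega x /\ exists2 y, Omega y & u y < u x.
  move=> [Ox Fx]; split => //; apply: contrapT => no; apply: Fx; split => // y Oy.
  by rewrite leNgt; apply/negP => yx; apply: no; exists y.
have loc x : D x -> exists g : 'rV[R]_n.+1, \forall y \near x, u y = u x + dotp g (y - x).
  move=> /DP[Ox [y Oy yx]].
  by have := locally_affine b0 p1 oO cA cu weak Ox Oy yx.
split.
- rewrite openE => x /DP[Ox [y Oy yx]].
  have uC := convex_continuous cA cu oO Ox.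
  have near1 : \forall z \near x, Omega z by exact: open_nbhs_nbhs.
  have near2 : \forall z \near x, u y < u z by exact: (cvgr_gt _ uC).
  apply: filterS2 near1 near2 => z Oz yz; split => // -[_ /(_ y Oy)].
  by rewrite leNgt yz.
- move=> x Dx; apply: connected_affine; first exact: component_connected.
  by move=> y /connected_component_sub /loc.
- move=> F0; apply: connected_affine => // x Ox; apply: loc.
  by rewrite /D F0 setD0.
Qed.
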